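(* Let $\tau\in\mathcal{E}$ and $\ell\in\{1,2,3\}$. Then in each one-parameter family of nonspecial solutions of type $\ell$ of the equation $$\Delta u+e^u=4\pi\sum_{i=0}^3\delta_{\omega_i/2}\quad\text{on }E_\tau ,$$ for each $j\in\{1,2,3\}\setminus\{\ell\}$ there is a unique solution $u_j$ which is symmetric with respect to $\frac{\omega_j}{4}$, i.e. $u_j(\frac{\omega_j}{2}-z)=u_j(z)$.
   Context: $\mathbb{H}$ is the upper half plane; $\omega_0=0$, $\omega_1=1$, $\omega_2=\tau$, $\omega_3=1+\tau$; $E_\tau=\mathbb{C}/(\mathbb{Z}+\mathbb{Z}\tau)$. $G(z;\tau)$ is the Green function on the flat torus $E_\tau$ with singularity at $0$ ($-\Delta G=\delta_0-\frac1{|E_\tau|}$, $\int_{E_\tau}G=0$); $\mathcal{E}$ is the set of $\tau\in\mathbb{H}$ for which $G(z;\tau)$ has critical points other than the three half periods $\frac{\omega_1}{2},\frac{\omega_2}{2},\frac{\omega_3}{2}$. For a (real-valued) solution $u$, a developing map is a meromorphic $h$ on $\mathbb{C}$ with $u=\log\frac{8|h'|^2}{(1+|h|^2)^2}$ (unique up to the Möbius action of $SU(2)$). A solution $v$ with developing map $g$ is generated by $u$ if $g=Rh=\frac{ah+b}{ch+d}$ for some $R=\begin{pmatrix}a&b\\c&d\end{pmatrix}\in SL(2,\mathbb{C})$. A solution $u$ is nonspecial if it generates a real one-parameter family of solutions, i.e. for a suitable developing map $h$ of $u$ the set of solutions generated by $u$ is $\{u_t\}_{t\in\mathbb{R}}$,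 $u_t=\log\frac{8e^{2t}|h'|^2}{(1+e^{2t}|h|^2)^2}$, with distinct $t$ giving distinct solutions; this set is a one-parameter family of nonspecial solutions. Types. Let $\wp,\zeta$ be the Weierstrass functions with periods $1,\tau$, $\eta_0=0$, $\eta_i=\zeta(z+\omega_i)-\zeta(z)$ for $i=1,2,3$. For $\ell\in\{1,2,3\}$, $\{\ell,j,k\}=\{1,2,3\}$, put $\varepsilon^{(\ell)}_0=\varepsilon^{(\ell)}_\ell=1$, $\varepsilon^{(\ell)}_j=\varepsilon^{(\ell)}_k=-1$, and for $T\in\mathbb{C}$ $$q_\ell(z;T)=\frac34\sum_{i=0}^3\wp(z-\tfrac{\omega_i}{2})+T\sum_{i=0}^3\varepsilon_i^{(\ell)}\zeta(z-\tfrac{\omega_i}{2})+T^2-\eta_{3-\ell}T .$$ $\mathcal{L}_\ell(T)$ is the ODE $y''=q_\ell(z;T)y$. To a solution $u$ one associates the ODE $\mathcal{L}(u)$: $y''=-\frac12\big(u_{zz}-\frac12u_z^2\big)y$. A nonspecial solution $u$ is of type $\ell$ if $\mathcal{L}(u)=\mathcal{L}_\ell(T)$ (equality of potentials) for some $T\in\mathbb{C}$ (necessarily $T\neq0$). All members of a one-parameter family of nonspecial solutions have the same $\mathcal{L}(u)$. *)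

(* Defs.v *)
From HB Require Import structures.
From mathcomp Require Import all_boot all_order all_algebra.
From mathcomp Require Import complex.
From mathcomp Require Import all_classical all_reals all_analysis.

Set Implicit Arguments.
Unset Strict Implicit.
Unset Printing Implicit Defensive.

Import Order.TTheory GRing.Theory Num.Theory.
Import numFieldNormedType.Exports.

Local Open Scope classical_set_scope.
Local Open Scope complex_scope.
Local Open Scope ring_scope.

(* The normed-space structure of R[i] over itself, transported from R[i]^o as
   MathComp-Analysis does for abstract number fields.  Consequently derive1 f
   is the complex derivative when f : R[i] -> R[i]. *)
#[non_forgetful_inheritance]
HB.instance Definition _ (R : realType) := GRing.ComAlgebra.copy R[i] R[i]^o.
#[non_forgetful_inheritance]
HB.instance Definition _ (R : realType) := Vector.copy R[i] R[i]^o.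
#[non_forgetful_inheritance]
HB.instance Definition _ (R : realType) := NormedModule.copy R[i] R[i]^o.

Section Defs.
Variable R : realType.
Local Notation C := R[i].
Local Notation normc := ComplexField.Normc.normc.
Implicit Types (tau z w T : C) (u v phi G : C -> R) (f g h : C -> C).

Definition lattice tau : set C :=
  [set z | exists m n : int, z = m%:~R + n%:~R * tau].

(* The lattice points together with all translates of the three half periods;
   its image in E_tau is {omega_i / 2 | i = 0, ..., 3}. *)
Definition half_lattice tau : set C := [set z | lattice tau (2 * z)].

Definition omega tau (i : nat) : C :=
  match i with 0 => 0 | 1 => 1 | 2 => tau | _ => 1 + tau end.

(* Solutions and Green functions are undefined (infinite) at their
   singularities; as total functions they carry arbitrary values there, so
   they are only ever compared off the singular set. *)
Definition eq_off (D : set C) u v := forall z, ~ D z -> u z = v z.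

Definition periodic_off tau (D : set C) u :=
  forall z, ~ D z -> u (z + 1) = u z /\ u (z + tau) = u z.

Section RealDifferentiation.

Definition ddir (e : C) u z : R := derive1 (fun s : R => u (z + s%:C * e)) 0.
Definition has_ddir (e : C) u z : Prop :=
  derivable (fun s : R => u (z + s%:C * e)) 0 1.

Definition dx u : C -> R := ddir 1 u.
Definition dy u : C -> R := ddir 'i u.

(* u is of class C^k on the open set D. *)
Fixpoint Ck (k : nat) (D : set C) u : Prop :=
  (forall z, D z -> {for z, continuous u}) /\
  match k with
  | 0 => True
  | k'.+1 => [/\ forall z, D z -> has_ddir 1 u z /\ has_ddir 'i u z,
                 Ck k' D (dx u) & Ck k' D (dy u)]
  end.

Definition laplacian u z : R := dx (dx u) z + dy (dy u) z.

(* The Wirtinger derivative (1/2) (d/dx - i d/dy) of a complex-valued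
   function, computed on its real and imaginary parts. *)
Definition dz f z : C :=
  let re w := complex.Re (f w) in let im w := complex.Im (f w) in
  ((dx re z + dy im z) / 2) +i* ((dx im z - dy re z) / 2).

Definition critical_point u z : Prop := dx u z = 0 /\ dy u z = 0.

End RealDifferentiation.

Section TorusIntegration.

Definition unit_square : set (R * R) := `[0, 1] `*` `[0, 1].

(* (x, y) |-> x + y tau parametrizes the torus, with Jacobian
   Im tau = |E_tau|. *)
Definition torus_param tau (p : R * R) : C := p.1%:C + p.2%:C * tau.

Definition torus_integrable tau u : Prop :=
  ((@lebesgue_measure R) \x (@lebesgue_measure R))%E.-integrable unit_square
    (fun p => (u (torus_param tau p))%:E).

Definition torus_int tau u : R :=
  complex.Im tau *
  Rintegral ((@lebesgue_measure R) \x (@lebesgue_measure R))%E unit_square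
    (fun p => u (torus_param tau p)).

Definition test_function tau phi : Prop :=
  periodic_off tau set0 phi /\ forall k, Ck k setT phi.

End TorusIntegration.

(* - Delta G = delta_0 - 1/|E_tau| in the sense of distributions, with the
   representative that is regular off the singularity, and zero mean. *)
Definition is_green tau G : Prop :=
  [/\ periodic_off tau (lattice tau) G,
      Ck 2 (~` lattice tau) G,
      torus_integrable tau G,
      torus_int tau G = 0
    & forall phi, test_function tau phi ->
        torus_int tau (fun z => - (G z * laplacian phi z)) =
        phi 0 - (complex.Im tau)^-1 * torus_int tau phi].

Definition extra_critical : set C :=
  [set tau | 0 < complex.Im tau /\
     exists G z, [/\ is_green tau G, ~ half_lattice tau z
                   & critical_point G z]].

(* Delta u + e^u = 4 pi sum_i delta_(omega_i / 2) on E_tau, in the sense of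
   distributions; a solution is regular off the singularities. *)
Definition is_solution tau u : Prop :=
  [/\ periodic_off tau (half_lattice tau) u,
      Ck 2 (~` half_lattice tau) u,
      torus_integrable tau u,
      torus_integrable tau (fun z => expR (u z))
    & forall phi, test_function tau phi ->
        torus_int tau (fun z => u z * laplacian phi z + expR (u z) * phi z) =
        4 * pi * \sum_(i < 4) phi (omega tau i / 2)].

Section Meromorphic.

Definition analytic_at f z : Prop :=
  exists a : nat -> C, \forall w \near z,
    series (fun k => a k * (w - z) ^+ k) @ \oo --> f w.

(* The value of f at a pole is irrelevant. *)
Definition pole_at f z : Prop :=
  exists (n : nat) (g : C -> C), [/\ (0 < n)%N, analytic_at g z, g z != 0
    & \forall w \near z^', f w = g w / (w - z) ^+ n].

Definition meromorphic f : Prop := forall z, analytic_at f z \/ pole_at f z.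

(* g = (a h + b) / (c h + d) as meromorphic functions; it suffices to compare
   them off their poles, and there c h + d cannot vanish. *)
Definition moebius_of (a b c d : C) h g : Prop :=
  forall z, analytic_at h z -> analytic_at g z ->
    c * h z + d != 0 /\ g z = (a * h z + b) / (c * h z + d).

End Meromorphic.

(* At the poles of h the value of u is determined by continuity. *)
Definition developing_map tau u h : Prop :=
  meromorphic h /\
  forall z, ~ half_lattice tau z -> analytic_at h z ->
    derive1 h z != 0 /\
    u z = ln (8 * normc (derive1 h z) ^+ 2 / (1 + normc (h z) ^+ 2) ^+ 2).

Definition generated tau u : set (C -> R) :=
  [set v | is_solution tau v /\
     exists h g, [/\ developing_map tau u h, developing_map tau v g
       & exists a b c d, a * d - b * c = 1 /\ moebius_of a b c d h g]].

(* U t is u_t; as above, the formula determines it at the poles of h by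
   continuity, since U t is a solution by the third clause. *)
Definition nonspecial tau u : Prop :=
  is_solution tau u /\
  exists (h : C -> C) (U : R -> C -> R),
    [/\ developing_map tau u h,
        forall t z, ~ half_lattice tau z -> analytic_at h z ->
          U t z = ln (8 * expR (2 * t) * normc (derive1 h z) ^+ 2 /
                      (1 + expR (2 * t) * normc (h z) ^+ 2) ^+ 2),
        forall v, generated tau u v <->
                  exists t, eq_off (half_lattice tau) v (U t)
      & forall s t, eq_off (half_lattice tau) (U s) (U t) -> s = t].

Section Types.

(* The lattice points m + n tau with |m|, |n| <= N, indexed from 0 to 2N. *)
Definition lattice_point tau (N m n : nat) : C :=
  (m%:R - N%:R) + (n%:R - N%:R) * tau.

(* The Weierstrass series converge absolutely, so they may be summed over
   growing squares of lattice points. *)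
Definition zeta tau z : C :=
  limn (fun N : nat => z^-1 +
    \sum_(m < (2 * N).+1)
      \sum_(n < (2 * N).+1 | lattice_point tau N m n != 0)
        let w := lattice_point tau N m n in
        (z - w)^-1 + w^-1 + z / w ^+ 2).

Definition wp tau z : C :=
  limn (fun N : nat => (z ^+ 2)^-1 +
    \sum_(m < (2 * N).+1)
      \sum_(n < (2 * N).+1 | lattice_point tau N m n != 0)
        let w := lattice_point tau N m n in
        ((z - w) ^+ 2)^-1 - (w ^+ 2)^-1).

(* zeta (z + omega_i) - zeta z does not depend on z; z = tau / 2 is a point
   such that neither z nor z + omega_i is a pole of zeta. *)
Definition eta tau (i : nat) : C :=
  zeta tau (tau / 2 + omega tau i) - zeta tau (tau / 2).

Definition eps (l i : nat) : C :=
  if (i == 0)%N || (i == l)%N then 1 else -1.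

Definition q tau (l : nat) T z : C :=
  3 / 4 * (\sum_(i < 4) wp tau (z - omega tau i / 2))
  + T * (\sum_(i < 4) eps l i * zeta tau (z - omega tau i / 2))
  + T ^+ 2 - eta tau (3 - l)%N * T.

(* The potential of the ODE L(u). *)
Definition potential u z : C :=
  let u_z := dz (fun w => (u w)%:C) in
  - (1 / 2) * (dz u_z z - 1 / 2 * u_z z ^+ 2).

Definition of_type tau (l : nat) u : Prop :=
  exists T, forall z, ~ half_lattice tau z -> potential u z = q tau l T z.

End Types.

Definition nonspecial_family tau (l : nat) (F : set (C -> R)) : Prop :=
  exists u, [/\ nonspecial tau u, of_type tau l u & F = generated tau u].

Definition symmetric_about_quarter tau (j : nat) u : Prop :=
  forall z, ~ half_lattice tau z -> u (omega tau j / 2 - z) = u z.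

End Defs.

(* Main.v *)
Require Import Defs.
From HB Require Import structures.
From mathcomp Require Import all_boot all_order all_algebra.
From mathcomp Require Import complex.
From mathcomp Require Import all_classical all_reals all_analysis.
From mathcomp Require Import ring lra zify.
From mathcomp Require Import measurable_realfun.
Set Implicit Arguments.
Unset Strict Implicit.
Unset Printing Implicit Defensive.
Import Order.TTheory GRing.Theory Num.Theory.
Import numFieldNormedType.Exports.
Local Open Scope classical_set_scope.
Local Open Scope complex_scope.
Local Open Scope ring_scope.

(** The theorem rests on the monodromy of the developing map [h] and on its
behaviour under the reflection that maps [z] to [p - z], where
[p = omega tau j / 2].

All members [U t] of the family are doubly periodic. Comparing their densities
shows that translation by a period [e] multiplies [h] by a constant [rho] of
modulus one ([multiplier]). The two multipliers cannot both be one: the function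
[h + 1] would then develop a solution generated by [u] that is not one of the
[U t] ([trivial_monodromy_absurd]). That it develops a solution in the sense of
distributions is seen by writing the new solution as [u + w] with [w] smooth and
doubly periodic, so that Green's identity on the torus applies
([is_solution_add], [gap_smooth], [gap_equation]).

The potential of the ODE attached to [u] is, up to a factor, the Schwarzian
derivative of [h] ([potential_schwarzian]). For a solution of type [l] it is
[q tau l T], which is invariant under the reflection because [j <> l]
([q_reflect]): the reflection exchanges half-periods whose zeta terms have
opposite signs. Hence [h (p - z)] is a Moebius transform of [h z]
([schwarzian_moebius]). As the reflection reverses translations, this
transformation conjugates a nontrivial rotation to its inverse, so it is either a
dilation or an inversion ([reflection_dichotomy]). A dilation would make [h] even
about a point that is not a half-period, where [h] is locally injective in the
sense of the Riemann sphere ([dev_not_even]). Thus [h (p - z) * h z] is a nonzero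
constant [lam] ([reflection_inverts]).

Under an inversion with constant [lam] the solution [U t] becomes [U s] with
[s + t = - ln `|lam|], so exactly one member of the family is fixed, the one with
[expR (2 * t) * `|lam| = 1] ([unique_symmetric_member]).

Holomorphic functions are handled through local power series, limits through
difference quotients, and identities are propagated off discrete sets
([loc_const_off]). *)

(** * Modulus and limits in the complex field *)

Notation normc := ComplexField.Normc.normc.

Section ComplexTopology.
Variable R : realType.
Local Notation C := R[i].
Implicit Types (z w d e : C) (r : R).

Lemma normCE z : `|z| = (normc z)%:C. Proof. by case: z. Qed.

Lemma normc_ge0 z : 0 <= normc z. Proof. by case: z => x y; exact: sqrtr_ge0. Qed.

Lemma normc_gt0 z : (0 < normc z) = (z != 0).
Proof. by rewrite -ltcR -normCE normr_gt0. Qed.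

Lemma normc_eq0 z : (normc z == 0) = (z == 0).
Proof. by rewrite -(inj_eq (@complexI R)) -normCE normr_eq0. Qed.

Lemma normc0 : normc (0 : C) = 0. Proof. exact: ComplexField.Normc.normc0. Qed.

Lemma normcM z w : normc (z * w) = normc z * normc w.
Proof. exact: ComplexField.Normc.normcM. Qed.

Lemma normcV z : normc z^-1 = (normc z)^-1.
Proof. exact: ComplexField.Normc.normcV. Qed.

Lemma normcX z n : normc (z ^+ n) = normc z ^+ n.
Proof. by apply: (@complexI R); rewrite -normCE normrX rmorphXn /= -normCE. Qed.

Lemma normcB z w : normc (z - w) = normc (w - z).
Proof. by rewrite -normcN opprB. Qed.

Lemma normc_real (x : R) : normc x%:C = `|x|.
Proof. by rewrite /= expr0n /= addr0 sqrtr_sqr. Qed.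

Lemma normc_nat n : normc (n%:R : C) = n%:R.
Proof. by rewrite -(rmorph_nat (real_complex R)) normc_real normr_nat. Qed.

Lemma normc_i : normc ('i : C) = 1.
Proof. by rewrite -complexiE /= expr0n expr1n add0r sqrtr1. Qed.

Lemma real_complex_eq0 (x : R) : (x%:C == 0 :> C) = (x == 0).
Proof. exact: (inj_eq (@complexI R) x 0). Qed.

Lemma sqr_normc2 z : normc z ^+ 2 = complex.Re z ^+ 2 + complex.Im z ^+ 2.
Proof. by case: z => x y /=; rewrite sqr_sqrtr ?addr_ge0 ?sqr_ge0. Qed.

Lemma sqr_normcE z : (normc z ^+ 2)%:C = z * z^*.
Proof. by rewrite -sqr_normc normCE rmorphXn. Qed.

Lemma normc_conj z : normc z^* = normc z.
Proof. by apply: (@complexI R); rewrite -!normCE normcJ. Qed.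

Lemma ler_normcB z w : normc z <= normc w + normc (z - w).
Proof. by rewrite -{1}[z](subrK w) addrC; exact: le_normcD. Qed.

Lemma normc_geRe z : `|complex.Re z| <= normc z.
Proof. by rewrite -lecR -normCE; exact: normc_ge_Re. Qed.

Lemma normc_geIm z : `|complex.Im z| <= normc z.
Proof.
rewrite -ler_sqr ?nnegrE ?normc_ge0 // sqr_normc2 real_normK ?num_real //.
by rewrite lerDr sqr_ge0.
Qed.

Lemma normc_leReIm z : normc z <= `|complex.Re z| + `|complex.Im z|.
Proof.
rewrite -ler_sqr ?nnegrE ?addr_ge0 ?normc_ge0 // sqr_normc2.
rewrite sqrrD !real_normK ?num_real // addrAC lerDl.
by rewrite mulrn_wge0 // mulr_ge0.
Qed.

(** Neighbourhoods in [C] are described by real radii, since positive elements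
of [C] are exactly the positive reals. *)
Lemma nbhscP z (P : C -> Prop) : (\forall w \near z, P w) <->
  exists2 r, 0 < r & forall w, normc (w - z) < r -> P w.
Proof.
split.
- move=> /nbhs_ballP[e /= e0 he].
  have eE : e = (complex.Re e)%:C.
    by case: e e0 {he} => a b; rewrite ltcE /= => /andP[/eqP -> _].
  exists (complex.Re e); first by move: e0; rewrite ltcE => /andP[].
  by move=> w hw; apply: he; rewrite /ball /= distrC eE normCE ltcR.
- move=> [e e0 he]; apply/nbhs_ballP; exists e%:C; first by rewrite /= ltcR.
  by move=> w /=; rewrite /ball /= distrC normCE ltcR; exact: he.
Qed.

Lemma dnbhscP z (P : C -> Prop) : (\forall w \near z^', P w) <->
  exists2 r, 0 < r & forall w, normc (w - z) < r -> w != z -> P w.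
Proof.
rewrite /dnbhs /within /=; split => [/nbhscP[r r0 h]|[r r0 h]].
  by exists r.
by apply/nbhscP; exists r.
Qed.

Lemma cvgcP (T : Type) (F : set_system T) {FF : Filter F} (f : T -> C) d :
  (f @ F --> d) <-> forall r, 0 < r -> \forall t \near F, normc (f t - d) < r.
Proof.
split.
- move=> fd r r0; have : nbhs d [set w | normc (w - d) < r].
    by apply/nbhscP; exists r.
  by move=> /fd.
- move=> h A /nbhscP[r r0 hr].
  by apply: filterS (h r r0) => t; exact: hr.
Qed.

Lemma cvgc_ReIm (T : Type) (F : set_system T) {FF : Filter F} (f : T -> C) d :
  (f @ F --> d) <-> ((fun t => complex.Re (f t)) @ F --> complex.Re d) /\
                    ((fun t => complex.Im (f t)) @ F --> complex.Im d).
Proof.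
rewrite cvgcP; split.
- move=> h; split; apply/cvgrPdist_lt => e e0; have := h e e0;
    apply: filterS => t; apply: le_lt_trans.
  + by rewrite -raddfB /= -normcN opprB; exact: normc_geRe.
  + by rewrite -raddfB /= -normcN opprB; exact: normc_geIm.
- move=> [/cvgrPdist_lt h1 /cvgrPdist_lt h2] r r0.
  have r2 : 0 < r / 2 by rewrite divr_gt0.
  apply: filterS (filterI (h1 _ r2) (h2 _ r2)) => t /= [k1 k2].
  rewrite normcB; apply: le_lt_trans (normc_leReIm _) _.
  by rewrite !raddfB /= [r]splitr ltrD.
Qed.

Section Algebra.
Context {T : Type} {F : set_system T} {FF : Filter F}.
Implicit Types (f g : T -> C).

Lemma cvgcD f g d e : f @ F --> d -> g @ F --> e ->
  (fun t => f t + g t) @ F --> d + e.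
Proof. move=> cf cg; exact: (@cvgD C C T F FF f g d e cf cg). Qed.

Lemma cvgc_cst d : (fun _ : T => d) @ F --> d.
Proof. exact: (@cvg_cst C d T F FF). Qed.

Lemma cvgcM f g d e : f @ F --> d -> g @ F --> e ->
  (fun t => f t * g t) @ F --> d * e.
Proof. by move=> cf cg; exact: (@cvgM C T F FF f g d e cf cg). Qed.

Lemma cvgcV f d : f @ F --> d -> d != 0 -> (fun t => (f t)^-1) @ F --> d^-1.
Proof. by move=> cf cg; exact: (@cvgV C T F FF f d cg cf). Qed.

Lemma cvgcN f d : f @ F --> d -> (fun t => - f t) @ F --> - d.
Proof. by move=> cf; exact: (@cvgN C C T F FF f d cf). Qed.

Lemma cvgcB f g d e : f @ F --> d -> g @ F --> e ->
  (fun t => f t - g t) @ F --> d - e.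
Proof. by move=> cf cg; exact: (cvgcD cf (cvgcN cg)). Qed.

Lemma cvgcJ f d : f @ F --> d -> (fun t => (f t)^*) @ F --> d^*.
Proof.
rewrite !cvgcP => h r r0; apply: filterS (h r r0) => t.
by rewrite -rmorphB /= normc_conj.
Qed.

Lemma cvgc_norm f d : f @ F --> d -> (fun t => normc (f t)) @ F --> normc d.
Proof.
rewrite cvgcP => h; apply/cvgrPdist_lt => r r0; apply: filterS (h r r0) => t.
apply: le_lt_trans; rewrite ler_norml; have := ler_normcB (f t) d.
by have := ler_normcB d (f t); rewrite (normcB d); lra.
Qed.

Lemma cvgc_real (f : T -> R) (x : R) : f @ F --> x -> (fun t => (f t)%:C) @ F --> x%:C.
Proof.
move=> h; apply/cvgc_ReIm; split => //=; exact: cvg_cst.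
Qed.

End Algebra.

Lemma cvgc_uniq (T : Type) (F : set_system T) (f : T -> C) d e :
  ProperFilter F -> f @ F --> d -> f @ F --> e -> d = e.
Proof. by move=> PF; apply: cvg_unique => //; exact: norm_hausdorff. Qed.

End ComplexTopology.

(** * Difference quotients in the form of Caratheodory *)

Section Caratheodory.
Variable R : realType.
Local Notation C := R[i].

Section Generic.
Variables (T : topologicalType) (t0 : T) (p : T -> C).
Hypothesis p0 : p @ t0 --> (0 : C).
Hypothesis pI : forall t, p t = 0 -> t = t0.
Implicit Types (f g : T -> C) (d e : C).

(** The scale [p] vanishes only at [t0]. Taking [w - z] and [(t - s)%:C] for
it gives the derivatives of complex functions and those of curves, whose rules
are thus proved together, without any quotient. *)
Definition car f d := exists2 phi : T -> C,
  forall t, f t = f t0 + p t * phi t & phi @ t0 --> d.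

Lemma carP f d : car f d <-> forall e : R, 0 < e ->
  \forall t \near t0, normc (f t - f t0 - p t * d) <= e * normc (p t).
Proof.
split=> [[phi fE /cvgcP cphi] e e0|h].
  apply: filterS (cphi e e0) => t ht.
  rewrite fE [f t0 + _]addrC addrK -mulrBr normcM mulrC.
  by rewrite ler_wpM2r ?normc_ge0 // ltW.
exists (fun t => if p t == 0 then d else (f t - f t0) / p t).
  move=> t; case: eqP => [pt|/eqP pt]; last by rewrite mulrC divfK // addrC subrK.
  by rewrite pt mul0r addr0 (pI pt).
apply/cvgcP => e e0.
have e2 : 0 < e / 2 by rewrite divr_gt0.
apply: filterS (h _ e2) => t ht; case: eqP => [_|/eqP pt].
  by rewrite subrr normc0.
have pt0 : 0 < normc (p t) by rewrite normc_gt0.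
have -> : (f t - f t0) / p t - d = (f t - f t0 - p t * d) / p t by field.
rewrite normcM normcV ltr_pdivrMr //; apply: le_lt_trans ht _.
by rewrite ltr_pM2r // ltr_pdivrMr // mulr_natr mulr2n ltrDl.
Qed.

Lemma car_slope f d : car f d <->
  (fun t => if p t == 0 then d else (f t - f t0) / p t) @ t0 --> d.
Proof.
split=> [[phi fE /cvgcP cphi]|h].
  apply/cvgcP => e e0; apply: filterS (cphi e e0) => t ht.
  case: eqP => [_|/eqP pt]; first by rewrite subrr normc0.
  by rewrite [f t]fE [f t0 + _]addrC addrK mulrAC divff // mul1r.
exists (fun t => if p t == 0 then d else (f t - f t0) / p t) => //.
move=> t; case: eqP => [pt|/eqP pt]; last by rewrite mulrC divfK // addrC subrK.
by rewrite pt mul0r addr0 (pI pt).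
Qed.

Lemma car_eq f g d : (\forall t \near t0, f t = g t) -> car f d -> car g d.
Proof.
move=> fg /carP fd; apply/carP => e e0.
have fg0 := nbhs_singleton fg.
by apply: filterS (filterI fg (fd e e0)) => t [<-]; rewrite -fg0.
Qed.

Lemma car_cvg f d : car f d -> f @ t0 --> f t0.
Proof.
move=> [phi fE cphi].
have := cvgcD (@cvgc_cst R T (nbhs t0) _ (f t0)) (cvgcM p0 cphi).
rewrite mul0r addr0.
have -> : (fun t => f t0 + p t * phi t) = f by apply/funext => t; rewrite -fE.
by move=> cf; exact: cf.
Qed.

Lemma car_cst a : car (cst a) 0.
Proof. by exists (cst 0) => [t|]; [rewrite mulr0 addr0 | exact: cvg_cst]. Qed.

Lemma carD f g d e : car f d -> car g e -> car (fun t => f t + g t) (d + e).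
Proof.
move=> [phi fE cphi] [psi gE cpsi]; exists (fun t => phi t + psi t).
  by move=> t; rewrite [in LHS]fE [in LHS]gE; ring.
exact: (cvgcD cphi cpsi).
Qed.

Lemma carM f g d e : car f d -> car g e ->
  car (fun t => f t * g t) (d * g t0 + f t0 * e).
Proof.
move=> [phi fE cphi] cg; have [psi gE cpsi] := cg.
exists (fun t => phi t * g t + f t0 * psi t).
  move=> t; have e1 := fE t; have e2 := gE t.
  by rewrite [in LHS]e1 mulrDl [in f t0 * _]e2; ring.
exact: (cvgcD (cvgcM cphi (car_cvg cg)) (cvgcM (@cvgc_cst R T (nbhs t0) _ _) cpsi)).
Qed.

Lemma carN f d : car f d -> car (fun t => - f t) (- d).
Proof.
move=> [phi fE cphi]; exists (fun t => - phi t); last exact: (cvgcN cphi).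
by move=> t; rewrite [in LHS]fE; ring.
Qed.

Lemma carV f d : f t0 != 0 -> car f d ->
  car (fun t => (f t)^-1) (- d * (f t0)^-1 ^+ 2).
Proof.
move=> f0 fd; have cf := car_cvg fd; apply/carP.
move=> e e0.
have [phi fE cphi] := fd.
have cV : (fun t => (f t)^-1) @ t0 --> (f t0)^-1 by exact: cvgcV cf f0.
have cW : (fun t => (f t)^-1 * (f t0)^-1) @ t0 --> (f t0)^-1 * (f t0)^-1.
  exact: (cvgcM cV (@cvgc_cst R T (nbhs t0) _ (f t0)^-1)).
have cL : (fun t => - phi t * ((f t)^-1 * (f t0)^-1)) @ t0 -->
    - d * ((f t0)^-1 * (f t0)^-1).
  exact: (cvgcM (cvgcN cphi) cW).
have fn0 : \forall t \near t0, f t != 0.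
  have a0 : 0 < normc (f t0) by rewrite normc_gt0.
  move/cvgcP: cf => /(_ _ a0); apply: filterS => t; apply: contraTneq => ->.
  by rewrite sub0r normcN ltxx.
move/cvgcP: cL => /(_ e e0) cL.
apply: filterS (filterI cL fn0) => t [ht ft].
have -> : (f t)^-1 - (f t0)^-1 - p t * (- d * (f t0)^-1 ^+ 2) =
  (- phi t * ((f t)^-1 * (f t0)^-1) - - d * ((f t0)^-1 * (f t0)^-1)) * p t.
  have -> : (f t)^-1 - (f t0)^-1 = (f t)^-1 * (f t0)^-1 * (f t0 - f t).
    by field; rewrite f0 ft.
  have -> : f t0 - f t = - (p t * phi t) by rewrite [f t]fE opprD addNKr.
  by ring.
by rewrite normcM ler_wpM2r ?normc_ge0 // ltW.
Qed.

End Generic.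
(** * Derivatives of complex functions and of curves *)

Implicit Types (f g : C -> C) (c : R -> C) (d e z w : C) (s t : R).

Definition cder f z d := car z (fun w => w - z) f d.
Definition rder c s d := car s (fun t => (t - s)%:C) c d.

Lemma cder_p0 z : (fun w : C => w - z) @ z --> (0 : C).
Proof. by apply/(@cvgcP R C (nbhs z) _) => e e0; apply/nbhscP; exists e => // w; rewrite subr0. Qed.

Lemma cder_pI z w : w - z = 0 -> w = z. Proof. by move/eqP; rewrite subr_eq0 => /eqP. Qed.

Lemma rder_p0 s : (fun t : R => (t - s)%:C) @ s --> (0 : C).
Proof.
apply/(@cvgcP R R (nbhs s) _) => e e0; have : \forall t \near s, `|s - t| < e.
  by near=> t; near: t; exact: nbhsx_ballx.
by apply: filterS => t; rewrite subr0 normc_real distrC.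
Unshelve. all: by end_near. Qed.

Lemma rder_pI s t : (t - s)%:C = 0 :> C -> t = s.
Proof. by case=> /eqP; rewrite subr_eq0 => /eqP. Qed.

Lemma cder_cvg f z d : cder f z d -> f @ z --> f z.
Proof. exact: (car_cvg (@cder_p0 z)). Qed.

Lemma cderD f g z d e : cder f z d -> cder g z e -> cder (fun w => f w + g w) z (d + e).
Proof. exact: carD. Qed.
Lemma cderN f z d : cder f z d -> cder (fun w => - f w) z (- d).
Proof. exact: carN. Qed.
Lemma cderB f g z d e : cder f z d -> cder g z e -> cder (fun w => f w - g w) z (d - e).
Proof. by move=> cf cg; exact: (cderD cf (cderN cg)). Qed.
Lemma cderM f g z d e : cder f z d -> cder g z e ->
  cder (fun w => f w * g w) z (d * g z + f z * e).
Proof. exact: (carM (@cder_p0 z)). Qed.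
Lemma cderV f z d : f z != 0 -> cder f z d -> cder (fun w => (f w)^-1) z (- d * (f z)^-1 ^+ 2).
Proof. exact: (carV (@cder_p0 z) (@cder_pI z)). Qed.
Lemma cder_cst a z : cder (fun=> a) z 0.
Proof. exact: car_cst. Qed.
Lemma cder_id z : cder (fun w => w) z 1.
Proof. exists (cst 1); first by move=> w; rewrite mulr1 addrC subrK. exact: (@cvgc_cst R C (nbhs z) _ 1). Qed.
Lemma cder_eq f g z d : (\forall w \near z, f w = g w) -> cder f z d -> cder g z d.
Proof. exact: (car_eq (@cder_pI z)). Qed.

Lemma rder_cvg c s d : rder c s d -> c @ s --> c s.
Proof. exact: (car_cvg (@rder_p0 s)). Qed.
Lemma rderD c c' s d e : rder c s d -> rder c' s e -> rder (fun t => c t + c' t) s (d + e).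
Proof. exact: carD. Qed.
Lemma rderM c c' s d e : rder c s d -> rder c' s e ->
  rder (fun t => c t * c' t) s (d * c' s + c s * e).
Proof. exact: (carM (@rder_p0 s)). Qed.
Lemma rderV c s d : c s != 0 -> rder c s d -> rder (fun t => (c t)^-1) s (- d * (c s)^-1 ^+ 2).
Proof. exact: (carV (@rder_p0 s) (@rder_pI s)). Qed.

Lemma rder_conj c s d : rder c s d -> rder (fun t => (c t)^*) s d^*.
Proof.
move=> [phi cE cphi]; exists (fun t => (phi t)^*); last exact: cvgcJ.
by move=> t; rewrite [in LHS]cE rmorphD rmorphM; congr (_ + _ * _); exact: conjc_real.
Qed.

Lemma car_comp (T : topologicalType) (t0 : T) (p : T -> C) (f : T -> C) g d e :
  p @ t0 --> (0 : C) ->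
  car t0 p f d -> cder g (f t0) e -> car t0 p (fun x : T => g (f x)) (d * e).
Proof.
move=> p0 fd [psi gE cpsi]; have cf := car_cvg p0 fd; have [phi fE cphi] := fd.
exists (fun x : T => phi x * psi (f x)).
  by move=> t; rewrite [in LHS]gE mulrA; congr (_ + _ * _); rewrite [in LHS]fE addrC addKr.
by apply: (cvgcM cphi); exact: (@cvg_comp _ _ _ f psi _ _ _ cf cpsi).
Qed.

Lemma cder_comp f g z d e :
  cder f z d -> cder g (f z) e -> cder (fun w => g (f w)) z (d * e).
Proof. exact: (car_comp (@cder_p0 z)). Qed.

Lemma rder_comp c g s d e :
  rder c s d -> cder g (c s) e -> rder (fun t => g (c t)) s (d * e).
Proof. exact: (car_comp (@rder_p0 s)). Qed.

Lemma rder_line z e s : rder (fun t => z + t%:C * e) s e.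
Proof.
exists (cst e); last exact: (@cvgc_cst R R (nbhs s) _ e).
by move=> t /=; rewrite rmorphB /=; ring.
Qed.

Lemma cder_derive1 f z d : cder f z d -> derive1 f z = d.
Proof.
move=> [phi fE /cvgcP cphi]; rewrite /derive1.
have H : (fun h => h^-1 *: (f (h + z) - f z)) @ (0 : C)^' --> d.
  apply/(@cvgcP R C (0^') _) => e e0; have /nbhscP[r r0 hr] := cphi e e0.
  apply/dnbhscP; exists r => // h; rewrite subr0 => hr1 h0.
  rewrite [f (h + z)]fE addrK [f z + _]addrC addrK.
  have -> : h^-1 *: (h * phi (h + z)) = phi (h + z) by rewrite -[LHS]/(_ * _) mulKf.
  by apply: hr; rewrite addrK.
by move/cvg_lim: H => H; apply: H; exact: norm_hausdorff.
Qed.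

Lemma cder_uniq f z d e : cder f z d -> cder f z e -> d = e.
Proof. by move=> /cder_derive1 <- /cder_derive1 <-. Qed.

Lemma is_deriveP (x : R -> R) s (a : R) :
  is_derive s 1 x a <-> (fun h => h^-1 * (x (h + s) - x s)) @ (0 : R)^' --> a.
Proof.
have E : (fun h => h^-1 *: ((x \o shift s) (h *: (1 : R)) - x s)) =
         (fun h => h^-1 * (x (h + s) - x s)).
  by apply/funext => h /=; rewrite /shift /= [h *: 1]mulr1.
split.
- move=> [dx xa]; have := dx; rewrite /derivable E => h.
  by move: xa; rewrite /derive E => <-.
- move=> h; split; first by rewrite /derivable E; apply/cvg_ex; exists a.
  by rewrite /derive E; apply/cvg_lim.
Qed.

Lemma is_derive_slope (x : R -> R) s (a : R) : is_derive s 1 x a <->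
  (fun t => if t == s then a else (x t - x s) / (t - s)) @ s --> a.
Proof.
rewrite is_deriveP; split=> /cvgrPdist_lt h; apply/cvgrPdist_lt => e e0; have := h e e0.
- rewrite !near_simpl => /nbhs_ballP[r /= r0 hr]; apply/nbhs_ballP; exists r => // t /= ht.
  case: eqP => [_|/eqP ts]; first by rewrite subrr normr0.
  have := hr (t - s); rewrite subrK mulrC /ball /= sub0r normrN distrC; apply => //.
  by rewrite subr_eq0.
- move=> /nbhs_ballP[r /= r0 hr]; apply/nbhs_ballP; exists r => // t /= ht t0.
  have := hr (t + s); rewrite addrK -subr_eq0 addrK (negbTE t0) [_ / t]mulrC; apply.
  by move: ht; rewrite /ball /= sub0r normrN opprD addrCA subrr addr0 normrN.
Qed.

Lemma rder_ReIm c s d : rder c s d <->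
  is_derive s 1 (fun t => complex.Re (c t)) (complex.Re d) /\
  is_derive s 1 (fun t => complex.Im (c t)) (complex.Im d).
Proof.
rewrite /rder (car_slope (@rder_pI s)) cvgc_ReIm !is_derive_slope.
have E1 : (fun t => complex.Re (if (t - s)%:C == 0 then d else (c t - c s) / (t - s)%:C)) =
  (fun t => if t == s then complex.Re d else (complex.Re (c t) - complex.Re (c s)) / (t - s)).
  apply/funext => t; rewrite (inj_eq (@complexI R) _ 0) subr_eq0; case: eqP => // /eqP ts.
  rewrite -raddfB /= -fmorphV /=; case: (c t - c s) => x y /=.
  by rewrite mulr0 subr0.
have E2 : (fun t => complex.Im (if (t - s)%:C == 0 then d else (c t - c s) / (t - s)%:C)) =
  (fun t => if t == s then complex.Im d else (complex.Im (c t) - complex.Im (c s)) / (t - s)).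
  apply/funext => t; rewrite (inj_eq (@complexI R) _ 0) subr_eq0; case: eqP => // /eqP ts.
  rewrite -raddfB /= -fmorphV /=; case: (c t - c s) => x y /=.
  by rewrite mulr0 add0r mulrC.
by rewrite E1 E2; split => [[]|[]].
Qed.
End Caratheodory.

(** * Locally constant functions off a discrete set *)

Section Connectedness.
Variable R : realType.
Local Notation C := R[i].
Implicit Types (z w : C) (s t r : R) (S : set C).

Lemma is_derive0_const (x : R -> R) :
  (forall t, 0 <= t <= 1 -> is_derive t 1 x 0) -> x 1 = x 0.
Proof.
move=> h; have [||c _] := @MVT_segment R x (fun=> 0) 0 1 ler01.
- by move=> t; rewrite in_itv /= => /andP[t0 t1]; apply: h; rewrite !ltW.
- apply: derivable_within_continuous => t; rewrite in_itv /= => /h h1.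
  exact: ex_derive.
- by rewrite mul0r => /eqP; rewrite subr_eq0 => /eqP.
Qed.

Lemma near_const_derive0 (x : R -> R) t :
  (\forall s \near t, x s = x t) -> is_derive t 1 x 0.
Proof.
move=> xt; apply/is_derive_slope.
have E : \forall s \near t, (if s == t then 0 else (x s - x t) / (s - t)) = 0.
  by apply: filterS xt => s ->; rewrite subrr mul0r if_same.
apply/cvgrPdist_lt => e e0; apply: filterS E => s ->.
by rewrite subrr normr0.
Qed.

(** The indicator of a locally constant property has zero derivative, so the
mean value theorem plays the role of the connectedness of the segment. *)
Lemma loc_const_segment (P : R -> Prop) :
  (forall t, 0 <= t <= 1 -> \forall s \near t, P s <-> P t) -> P 0 -> P 1.
Proof.
move=> h P0; pose x t : R := if `[< P t >] then 0 else 1.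
have : x 1 = x 0.
  apply: is_derive0_const => t /h ht; apply: near_const_derive0.
  by apply: filterS ht => s hs; rewrite /x (asbool_equiv_eq hs).
rewrite /x (asboolT P0); case: asboolP => // _ /eqP.
by rewrite oner_eq0.
Qed.

Lemma line_cvg z w t : (fun s : R => z + s%:C * w) @ t --> z + t%:C * w.
Proof. exact: (rder_cvg (rder_line z w t)). Qed.

Lemma near_line z w t (P : C -> Prop) : (\forall v \near z + t%:C * w, P v) ->
  \forall s \near t, P (z + s%:C * w).
Proof. by move=> h; exact: (line_cvg h). Qed.

Variable X : Type.
Implicit Type F : C -> X.

Lemma loc_const_line F z w :
  (forall t, 0 <= t <= 1 -> \forall v \near z + t%:C * w, F v = F (z + t%:C * w)) ->
  F (z + w) = F z.
Proof.
move=> h; have := @loc_const_segment (fun t => F (z + t%:C * w) = F z).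
rewrite mul1r mul0r addr0; apply=> // t /h ht.
by apply: filterS (near_line ht) => s ->.
Qed.

(** Two points of a punctured disc can be joined by a segment that avoids the
centre or, if they are opposite, by two such segments. *)
Lemma loc_const_punctured F z0 r :
  (forall w, normc (w - z0) < r -> w != z0 -> \forall v \near w, F v = F w) ->
  forall w1 w2, normc (w1 - z0) < r -> w1 != z0 -> normc (w2 - z0) < r -> w2 != z0 ->
  F w1 = F w2.
Proof.
move=> h.
have seg w1 w2 : normc (w1 - z0) < r -> normc (w2 - z0) < r ->
    (forall t, 0 <= t <= 1 -> w1 + t%:C * (w2 - w1) != z0) -> F w1 = F w2.
  move=> r1 r2 hz; have := @loc_const_line F w1 (w2 - w1).
  rewrite [w1 + (w2 - w1)]addrC subrK => -> // t t01; apply: h; last exact: hz.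
  have -> : w1 + t%:C * (w2 - w1) - z0 = (1 - t)%:C * (w1 - z0) + t%:C * (w2 - z0).
    by rewrite rmorphB /=; ring.
  apply: le_lt_trans (le_normcD _ _) _; rewrite !normcM !normc_real.
  case/andP: t01 => t0 t1; rewrite !ger0_norm ?subr_ge0 //.
  case: (ltgtP t 1) t1 => // [t1 _|-> _]; last by rewrite subrr mul0r add0r mul1r.
  have -> : r = (1 - t) * r + t * r by ring.
  by rewrite ltr_leD ?ltr_pM2l ?subr_gt0 // ler_wpM2l // ltW.
move=> w1 w2 r1 n1 r2 n2.
have [H|/existsNP[s /not_implyP[/andP[s0 s1] /negP/negPn/eqP hs]]] :=
  pselect (forall t, 0 <= t <= 1 -> w1 + t%:C * (w2 - w1) != z0); first exact: seg.
(* A quarter turn of the first point: neither of its segments to the two given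
   points meets the centre. *)
pose w3 := z0 + 'i * (w1 - z0).
have r3 : normc (w3 - z0) < r.
  by rewrite /w3 addrC addKr normcM normc_i mul1r.
have x0 : w1 - z0 != 0 by rewrite subr_eq0.
have y0 : w2 - z0 != 0 by rewrite subr_eq0.
have Ei (a b : R) : a%:C + b%:C * 'i = 0 :> C -> a = 0 /\ b = 0.
  by move/eqP; rewrite eq_complex /= !mul0r !mulr0 !mulr1 ?subr0 ?addr0 ?add0r =>
    /andP[/eqP -> /eqP ->].
rewrite (seg w1 w3) //; last first.
  move=> t _; rewrite -subr_eq0.
  have -> : w1 + t%:C * (w3 - w1) - z0 = ((1 - t)%:C + t%:C * 'i) * (w1 - z0).
    by rewrite /w3 rmorphB /=; ring.
  rewrite mulf_eq0 negb_or x0 andbT; apply/eqP => /Ei[/eqP].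
  by rewrite subr_eq0 => /eqP <- /eqP; rewrite oner_eq0.
apply: seg => // t _; apply/eqP => ht.
have hs' : (1 - s)%:C * (w1 - z0) + s%:C * (w2 - z0) = 0.
  by rewrite -[RHS](subrr z0) -[X in _ = X - _]hs rmorphB /=; ring.
have ht' : (1 - t)%:C * ('i * (w1 - z0)) + t%:C * (w2 - z0) = 0.
  by rewrite -[RHS](subrr z0) -[X in _ = X - _]ht /w3 rmorphB /=; ring.
have : ((- (t * (1 - s)))%:C + (s * (1 - t))%:C * 'i) * (w1 - z0) = 0.
  have -> : ((- (t * (1 - s)))%:C + (s * (1 - t))%:C * 'i) * (w1 - z0) =
    s%:C * ((1 - t)%:C * ('i * (w1 - z0)) + t%:C * (w2 - z0)) -
    t%:C * ((1 - s)%:C * (w1 - z0) + s%:C * (w2 - z0)).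
    by rewrite rmorphN !rmorphM /=; ring.
  by rewrite hs' ht' !mulr0 subr0.
move/eqP; rewrite mulf_eq0 (negbTE x0) orbF => /eqP/Ei[/eqP e1 /eqP e2].
have s_neq0 : s != 0.
  apply: contraNneq x0 => s0'; move: hs'; rewrite s0' subr0 mul1r mul0r addr0.
  by move->.
move: e2; rewrite mulf_eq0 (negbTE s_neq0) /= subr_eq0 => /eqP t1.
move: e1; rewrite -t1 mul1r oppr_eq0 subr_eq0 => /eqP s1'.
by move: hs'; rewrite -s1' subrr mul0r add0r mul1r => /eqP; rewrite (negbTE y0).
Qed.

Definition discrete S := forall z, \forall w \near z^', ~ S w.

(** The value taken on a small punctured disc around a point that moves along a
segment is locally constant, also where the segment meets [S]. *)
Lemma loc_const_off S F : discrete S ->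
  (forall z, ~ S z -> \forall w \near z, F w = F z) ->
  forall z w, ~ S z -> ~ S w -> F z = F w.
Proof.
move=> dS h z w Sz Sw.
pose P t := \forall v \near (z + t%:C * (w - z))^', F v = F z.
have P0 : P 0.
  by rewrite /P mul0r addr0; apply: nbhs_dnbhs; exact: h.
have P1 : P 1.
  apply: loc_const_segment P0 => t _.
  set zt := z + t%:C * (w - z).
  have /dnbhscP[r r0 hr] := dS zt.
  have cF : forall w1 w2, normc (w1 - zt) < r -> w1 != zt ->
      normc (w2 - zt) < r -> w2 != zt -> F w1 = F w2.
    by apply: loc_const_punctured => v vr vzt; apply: h; exact: hr.
  have loc v : normc (v - zt) < r -> \forall v' \near v^', normc (v' - zt) < r /\ v' != zt.
    move=> vr.
    have [vzt|vzt] := eqVneq v zt.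
      by rewrite vzt; apply/dnbhscP; exists r.
    apply: nbhs_dnbhs; apply/nbhscP.
    exists (Num.min (r - normc (v - zt)) (normc (v - zt))).
      by rewrite lt_min subr_gt0 vr normc_gt0 subr_eq0.
    move=> v'; rewrite lt_min => /andP[v1 v2]; split.
      by have := ler_normcB (v' - zt) (v - zt); rewrite opprB addrA subrK; lra.
    apply: contraTneq v2 => ->; rewrite normcB -leNgt //.
  have [c cE] : exists c : X, forall v, normc (v - zt) < r -> v != zt -> F v = c.
    have [v [v1 v2]] : exists v, normc (v - zt) < r /\ v != zt.
      have := loc zt; rewrite subrr normc0 => /(_ r0) H.
      exact: (@filter_ex _ (zt^') _ _ H).
    by exists (F v) => v' *; exact: cF.
  have Pt s : normc (z + s%:C * (w - z) - zt) < r -> P s <-> c = F z.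
    move=> hs; rewrite /P; set zs := z + s%:C * _.
    split=> [Ps|<-].
      have [v [[v1 v2] <-]] := @filter_ex _ (zs^') _ _ (filterI (loc zs hs) Ps).
      by rewrite cE.
    by apply: filterS (loc zs hs) => v [v1 v2]; exact: cE.
  have : \forall v \near zt, normc (v - zt) < r by apply/nbhscP; exists r.
  move/near_line; apply: filterS => s /Pt ->; apply: iff_sym; apply: Pt.
  by rewrite subrr normc0.
have P1' : \forall v \near w^', F v = F z.
  by move: P1; rewrite /P mul1r [z + _]addrC subrK.
by have [v [<- <-]] := @filter_ex _ (w^') _ _ (filterI P1' (nbhs_dnbhs (h w Sw))).
Qed.

Lemma cder0_const (f : C -> C) z r :
  (forall w, normc (w - z) < r -> cder f w 0) ->
  forall w, normc (w - z) < r -> f w = f z.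
Proof.
move=> h w wr; pose c t := f (z + t%:C * (w - z)).
have H t : 0 <= t <= 1 -> rder c t 0.
  move=> /andP[t0 t1]; rewrite -(mulr0 (w - z)).
  apply: (rder_comp (rder_line z (w - z) t)); apply: h.
  rewrite addrC addKr normcM normc_real ger0_norm //; apply: le_lt_trans wr.
  by rewrite ler_piMl ?normc_ge0.
have -> : f w = c 1 by rewrite /c mul1r addrC subrK.
have -> : f z = c 0 by rewrite /c mul0r addr0.
by apply/eqP; rewrite eq_complex; apply/andP; split; apply/eqP;
  apply: (@is_derive0_const (fun t => _ (c t))) => t /H/rder_ReIm[].
Qed.

Lemma cder0_loc_const (f : C -> C) z :
  (\forall w \near z, cder f w 0) -> \forall w \near z, f w = f z.
Proof.
by move=> /nbhscP[r r0 h]; apply/nbhscP; exists r => //; exact: cder0_const.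
Qed.

End Connectedness.

(** * Power series *)

Section PowerSeries.
Variable R : realType.
Local Notation C := R[i].
Implicit Types (a b : nat -> C) (x y z w : C) (r M : R).

Lemma normc_sum (I : Type) (s : seq I) (P : pred I) (F : I -> C) :
  normc (\sum_(i <- s | P i) F i) <= \sum_(i <- s | P i) normc (F i).
Proof.
elim/big_rec2 : _ => [|i u v _ h]; first by rewrite normc0.
by apply: le_trans (le_normcD _ _) _; rewrite lerD2l.
Qed.

Lemma cseries_dom a (b : nat -> R) : (forall n, normc (a n) <= b n) ->
  cvgn (series b) -> exists2 l : C, series a @ \oo --> l & normc l <= limn (series b).
Proof.
move=> ab cb.
have b0 n : 0 <= b n by apply: le_trans (ab n); exact: normc_ge0.
have cRe : cvgn (series (fun n => complex.Re (a n))).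
  apply: normed_cvg; apply: (series_le_cvg _ b0 _ cb) => n; first exact: normr_ge0.
  exact: le_trans (normc_geRe _) (ab n).
have cIm : cvgn (series (fun n => complex.Im (a n))).
  apply: normed_cvg; apply: (series_le_cvg _ b0 _ cb) => n; first exact: normr_ge0.
  exact: le_trans (normc_geIm _) (ab n).
set l := limn (series (fun n => complex.Re (a n))) +i* limn (series (fun n => complex.Im (a n))).
have al : series a @ \oo --> l.
  apply/(@cvgc_ReIm R nat \oo _); split.
    have -> : (fun t => complex.Re (series a t)) = series (fun n => complex.Re (a n)).
      by apply/funext => n; rewrite /series /= raddf_sum.
    exact: cRe.
  have -> : (fun t => complex.Im (series a t)) = series (fun n => complex.Im (a n)).
    by apply/funext => n; rewrite /series /= raddf_sum.
  exact: cIm.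
exists l; first exact: al.
apply: (@ler_cvg_to _ \oo _ R (fun n => normc (series a n)) (series b)).
- exact: cvgc_norm.
- exact: cb.
- apply: nearW => n; rewrite /series /=.
  by apply: le_trans (normc_sum _ _ _) _; apply: ler_sum.
Qed.

Lemma cseries_bounded a (l : C) : series a @ \oo --> l ->
  exists2 M : R, 0 < M & forall n, normc (a n) <= M.
Proof.
move=> /(@cvgcP R nat \oo _) /(_ 1 ltr01)[N _ hN].
exists (2 + \sum_(i < N) normc (a i)).
  by rewrite ltr_wpDr // sumr_ge0 // => i _; exact: normc_ge0.
move=> n; have [nN|Nn] := ltnP n N.
  rewrite (bigD1 (Ordinal nN)) //= addrCA lerDl addr_ge0 // sumr_ge0 // => i _.
  exact: normc_ge0.
apply: (@le_trans _ _ 2); last first.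
  by rewrite lerDl sumr_ge0 // => i _; exact: normc_ge0.
have -> : a n = (series a n.+1 - l) - (series a n - l).
  by rewrite /series /= big_nat_recr //=; ring.
have h1 := hN n.+1 (leqW Nn); have h2 := hN n Nn.
apply: le_trans (le_normcD _ _) _; rewrite normcN; rewrite /= in h1 h2.
by rewrite -[2]/(1 + 1) lerD // ltW.
Qed.

(** Second-order Taylor bound for powers. The factor [r ^+ 2] stands on the left
because the exponent [n - 2] would be truncated. *)
Lemma exprn_diff2 x y r n : 0 <= r -> normc x <= r -> normc y <= r ->
  normc (x ^+ n - y ^+ n - n%:R * y ^+ n.-1 * (x - y)) * r ^+ 2 <=
  n%:R ^+ 2 * r ^+ n * normc (x - y) ^+ 2.
Proof.
move=> r0 xr yr; elim: n => [|n IH].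
  by rewrite !expr0 subrr !mul0r subrr normc0 expr0n !mul0r.
have -> : x ^+ n.+1 - y ^+ n.+1 - n.+1%:R * y ^+ n.+1.-1 * (x - y) =
   x * (x ^+ n - y ^+ n - n%:R * y ^+ n.-1 * (x - y)) + n%:R * y ^+ n.-1 * (x - y) ^+ 2.
  case: n {IH} => [|n] /=; first by rewrite !expr0 !expr1; ring.
  by rewrite -!natr1 !exprS; ring.
apply: (@le_trans _ _ ((normc x * normc (x ^+ n - y ^+ n - n%:R * y ^+ n.-1 * (x - y)) +
   normc (n%:R * y ^+ n.-1 * (x - y) ^+ 2)) * r ^+ 2)).
  by rewrite ler_wpM2r ?sqr_ge0 // -normcM le_normcD.
rewrite mulrDl.
have h1 : normc x * normc (x ^+ n - y ^+ n - n%:R * y ^+ n.-1 * (x - y)) * r ^+ 2 <=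
   n%:R ^+ 2 * r ^+ n.+1 * normc (x - y) ^+ 2.
  have -> : n%:R ^+ 2 * r ^+ n.+1 * normc (x - y) ^+ 2 =
    r * (n%:R ^+ 2 * r ^+ n * normc (x - y) ^+ 2) by rewrite (exprS r n); ring.
  rewrite -[leLHS]mulrA; apply: ler_pM => //; first exact: normc_ge0.
  by rewrite mulr_ge0 ?normc_ge0 ?sqr_ge0.
have h2 : normc (n%:R * y ^+ n.-1 * (x - y) ^+ 2) * r ^+ 2 <=
   n%:R * r ^+ n.+1 * normc (x - y) ^+ 2.
  rewrite !normcM !normcX.
  rewrite normc_nat mulrAC; apply: ler_wpM2r; first exact: sqr_ge0.
  case: n {IH h1} => [|n] /=; first by rewrite !mul0r.
  rewrite -[leLHS]mulrA; apply: ler_wpM2l; first exact: ler0n.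
  rewrite -(addn2 n) exprD ler_wpM2r ?sqr_ge0 //.
  by apply: lerXn2r => //; rewrite nnegrE ?normc_ge0.
apply: le_trans (lerD h1 h2) _.
have X0 : 0 <= r ^+ n.+1 * normc (x - y) ^+ 2.
  by apply: mulr_ge0; [exact: exprn_ge0|exact: sqr_ge0].
have n0 : 0 <= n%:R :> R := ler0n _ _.
have -> : n.+1%:R = n%:R + 1 :> R by rewrite natr1.
rewrite -!mulrA; move: X0 n0; set X := r ^+ n.+1 * _; set N := n%:R.
by move=> X0 n0; nra.
Qed.

Lemma expr2n_le n : n%:R ^+ 2 * (8^-1) ^+ n <= (2^-1) ^+ n :> R.
Proof.
have h : n%:R <= 2 ^+ n :> R by rewrite -natrX ler_nat ltnW // ltn_expl.
have -> : (2^-1 : R) ^+ n = (2 ^+ n) ^+ 2 * (8^-1) ^+ n.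
  by rewrite -exprM mulnC exprM -exprMn; congr (_ ^+ _); field.
by rewrite ler_wpM2r ?exprn_ge0 ?invr_ge0 // lerXn2r // nnegrE ?exprn_ge0.
Qed.

Lemma cvg_half_series M : series (fun n => M * (2^-1) ^+ n) @ \oo --> M * 2.
Proof.
have := @cvg_geometric_series R M 2^-1; rewrite ger0_norm ?invr_ge0 // invf_lt1 // ltr1n.
have -> : M / (1 - 2^-1) = M * 2 by field.
by move=> /(_ isT).
Qed.

(** The remainders of order two of the terms are dominated by a geometric series
once the radius is divided by a constant. *)
Lemma pseries_cder a z r (f : C -> C) : 0 < r ->
  (forall w, normc (w - z) < r -> series (fun k => a k * (w - z) ^+ k) @ \oo --> f w) ->
  let b k := k.+1%:R * a k.+1 in
  exists2 f' : C -> C, forall w, normc (w - z) < r / 16 -> cder f w (f' w) &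
   forall w, normc (w - z) < r / 16 -> series (fun k => b k * (w - z) ^+ k) @ \oo --> f' w.
Proof.
move=> r0 fa b; pose s := r / 2; pose p := r / 16.
have s0 : 0 < s by rewrite divr_gt0.
have p0 : 0 < p by rewrite divr_gt0.
have [M M0 hM] : exists2 M, 0 < M & forall n, normc (a n) * s ^+ n <= M.
  have /cseries_bounded[M M0 hM] : series (fun k => a k * (s%:C) ^+ k) @ \oo --> f (z + s%:C).
    have := fa (z + s%:C); rewrite addrC addKr; apply.
    by rewrite normc_real gtr0_norm // /s ltr_pdivrMr // ltr_pMr // ltr1n.
  exists M => // n; apply: le_trans (hM n).
  by rewrite normcM normcX normc_real gtr0_norm.
have ap n : n%:R ^+ 2 * (normc (a n) * p ^+ n) <= M * 2^-1 ^+ n.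
  have -> : n%:R ^+ 2 * (normc (a n) * p ^+ n) =
    (normc (a n) * s ^+ n) * (n%:R ^+ 2 * 8^-1 ^+ n).
    have -> : p = s * 8^-1 by rewrite /p /s; field.
    by rewrite exprMn; ring.
  apply: ler_pM (hM n) (expr2n_le n); rewrite mulr_ge0 ?normc_ge0 ?sqr_ge0 ?exprn_ge0 //.
  exact: ltW.
have cb w : normc (w - z) < p ->
    exists l : C, series (fun k => b k * (w - z) ^+ k) @ \oo --> l.
  move=> wp.
  have cv : cvgn (series (fun k => (M / p) * 2^-1 ^+ k)).
    by apply/cvg_ex; exists (M / p * 2); exact: cvg_half_series.
  suff bnd n : normc (b n * (w - z) ^+ n) <= (M / p) * 2^-1 ^+ n.
    by have [l hl _] := cseries_dom bnd cv; exists l.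
  rewrite !normcM normc_nat normcX mulrAC -[leRHS]mulrAC ler_pdivlMr //.
  apply: (@le_trans _ _ (n.+1%:R ^+ 2 * (normc (a n.+1) * p ^+ n.+1))).
    have -> : n.+1%:R * normc (w - z) ^+ n * normc (a n.+1) * p =
       (n.+1%:R * (normc (a n.+1) * p)) * normc (w - z) ^+ n by ring.
    have -> : n.+1%:R ^+ 2 * (normc (a n.+1) * p ^+ n.+1) =
       (n.+1%:R ^+ 2 * (normc (a n.+1) * p)) * p ^+ n by rewrite (exprS p n); ring.
    have Ap : 0 <= normc (a n.+1) * p by rewrite mulr_ge0 ?normc_ge0 // ltW.
    apply: ler_pM.
    + by rewrite mulr_ge0.
    + by rewrite exprn_ge0 // normc_ge0.
    + by rewrite ler_wpM2r // expr2 ler_peMr // ler1n.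
    + by rewrite lerXn2r ?nnegrE ?normc_ge0 // ltW.
  apply: le_trans (ap n.+1) _; rewrite ler_wpM2l ?(ltW M0) // exprS.
  by rewrite ger_pMl ?exprn_gt0 ?invr_gt0 // invf_le1 // ler1n.
pose f' w := xget 0 [set l | series (fun k => b k * (w - z) ^+ k) @ \oo --> l].
have cf' w : normc (w - z) < p -> series (fun k => b k * (w - z) ^+ k) @ \oo --> f' w.
  by move=> /cb h; exact: (xgetPex 0 h).
exists f'; last exact: cf'.
move=> w wp; apply/carP; first exact: cder_pI.
pose K := M / p ^+ 2 * 2.
have K0 : 0 < K by rewrite mulr_gt0 // divr_gt0 // exprn_gt0.
have quad v : normc (v - z) < p -> normc (f v - f w - (v - w) * f' w) <= K * normc (v - w) ^+ 2.
  move=> vp; set d := normc (v - w).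
  have pr : p < r by rewrite /p ltr_pdivrMr // ltr_pMr // ltr1n.
  pose t k := a k * ((v - z) ^+ k - (w - z) ^+ k - k%:R * (w - z) ^+ k.-1 * ((v - z) - (w - z))).
  have cv : cvgn (series (fun k => (M / p ^+ 2 * d ^+ 2) * 2^-1 ^+ k)).
    by apply/cvg_ex; eexists; exact: cvg_half_series.
  have bnd n : normc (t n) <= (M / p ^+ 2 * d ^+ 2) * 2^-1 ^+ n.
    rewrite normcM.
    have -> : M / p ^+ 2 * d ^+ 2 * 2^-1 ^+ n = (M * 2^-1 ^+ n * d ^+ 2) / p ^+ 2.
      by field; rewrite gt_eqF.
    rewrite ler_pdivlMr ?exprn_gt0 // -[leLHS]mulrA.
    apply: (@le_trans _ _ (normc (a n) * (n%:R ^+ 2 * p ^+ n * d ^+ 2))).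
      rewrite ler_wpM2l ?normc_ge0 //.
      have -> : d = normc ((v - z) - (w - z)) by rewrite /d; congr normc; ring.
      by apply: exprn_diff2; exact: ltW.
    have -> : normc (a n) * (n%:R ^+ 2 * p ^+ n * d ^+ 2) =
      n%:R ^+ 2 * (normc (a n) * p ^+ n) * d ^+ 2 by ring.
    by rewrite ler_wpM2r ?sqr_ge0.
  have [l tl hl] := cseries_dom bnd cv.
  have tE : series t @ \oo --> f v - f w - (v - w) * f' w.
    have hb : series (fun k => k%:R * a k * (w - z) ^+ k.-1) @ \oo --> f' w.
      have E : (fun n => series (fun k => k%:R * a k * (w - z) ^+ k.-1) n.+1) =
          series (fun k => b k * (w - z) ^+ k).
        by apply/funext => n; rewrite /series /= big_nat_recl //= !mul0r add0r.
      by rewrite -cvg_shiftS /= E; exact: cf'.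
    have E : series t = (fun n => series (fun k => a k * (v - z) ^+ k) n -
        series (fun k => a k * (w - z) ^+ k) n -
        (v - w) * series (fun k => k%:R * a k * (w - z) ^+ k.-1) n).
      apply/funext => n; rewrite /series /= mulr_sumr -!sumrB; apply: eq_bigr => k _.
      by rewrite /t; ring.
    rewrite E; apply: (@cvgcB R nat \oo _); last first.
      by apply: (@cvgcM R nat \oo _) hb; exact: (@cvgc_cst R nat \oo _).
    apply: (@cvgcB R nat \oo _); apply: fa; exact: lt_trans pr.
  have <- : l = f v - f w - (v - w) * f' w by exact: (@cvgc_uniq R nat \oo (series t) _ _ _ tl tE).
  apply: le_trans hl _; rewrite le_eqVlt; apply/orP; left; apply/eqP.
  have -> : limn (series (fun k => M / p ^+ 2 * d ^+ 2 * 2^-1 ^+ k)) = M / p ^+ 2 * d ^+ 2 * 2.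
    by apply: cvg_lim => //; exact: cvg_half_series.
  by rewrite /K; ring.
move=> e e0; apply/nbhscP; exists (Num.min (p - normc (w - z)) (e / K)).
  by rewrite lt_min subr_gt0 wp divr_gt0.
move=> v; rewrite lt_min => /andP[v1 v2].
apply: le_trans (quad v _) _.
  by have := ler_normcB (v - z) (w - z); rewrite opprB addrA subrK; lra.
rewrite expr2 mulrA ler_wpM2r ?normc_ge0 // mulrC -ler_pdivlMr //.
exact: ltW.
Qed.

Lemma analytic_cder (f : C -> C) z : analytic_at f z ->
  exists2 f' : C -> C, (\forall w \near z, cder f w (f' w)) & analytic_at f' z.
Proof.
move=> [a /nbhscP[r r0 ha]].
have [f' f1 f2] := pseries_cder r0 ha.
have r16 : 0 < r / 16 by rewrite divr_gt0.
exists f'; first by apply/nbhscP; exists (r / 16).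
by exists (fun k => k.+1%:R * a k.+1); apply/nbhscP; exists (r / 16).
Qed.

Lemma analytic_cvg (f : C -> C) z : analytic_at f z -> f @ z --> f z.
Proof. by move=> /analytic_cder[f' /nbhs_singleton/cder_cvg]. Qed.

End PowerSeries.

(** * Holomorphic functions, poles and discrete sets *)

Section Holomorphic.
Variable R : realType.
Local Notation C := R[i].
Implicit Types (f g h : C -> C) (z w : C) (r : R) (D S : set C).

Definition cball z r : set C := [set w | normc (w - z) < r].

Lemma cball_center z r : 0 < r -> cball z r z.
Proof. by rewrite /cball /= subrr normc0. Qed.

Lemma cball_open z r w : cball z r w -> \forall v \near w, cball z r v.
Proof.
rewrite /cball /= => wr; apply/nbhscP; exists (r - normc (w - z)).
  by rewrite subr_gt0.
by move=> v vw; rewrite /cball /=; have := ler_normcB (v - z) (w - z); rewrite opprB addrA subrK; lra.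
Qed.

Lemma cvgc_eq (f g : C -> C) z (l : C) :
  (\forall w \near z, f w = g w) -> f @ z --> l -> g @ z --> l.
Proof.
move=> fg /(@cvgcP R C (nbhs z) _) fl; apply/(@cvgcP R C (nbhs z) _) => e e0.
by apply: filterS (filterI fg (fl e e0)) => w [<-].
Qed.

(** Derivatives are exhibited rather than computed, so that the closure
properties follow from the rules for [cder] by induction on [k]. *)
Fixpoint hol k D f : Prop :=
  match k with
  | 0 => forall z, D z -> f @ z --> f z
  | k'.+1 => exists2 f', (forall z, D z -> cder f z (f' z)) & hol k' D f'
  end.

Lemma hol_sub k D D' f : D' `<=` D -> hol k D f -> hol k D' f.
Proof.
move=> DD; elim: k f => [|k IH] f /=; first by move=> h z /DD/h.
by move=> [f' ff' /IH hf']; exists f' => // z /DD/ff'.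
Qed.

Lemma holS k D f : hol k.+1 D f -> hol k D f.
Proof.
elim: k f => [|k IH] f /= [f' ff'].
  by move=> _ z /ff'/cder_cvg.
by move=> hf'; exists f' => //; exact: (IH _ hf').
Qed.

Lemma hol_cvg k D f z : hol k D f -> D z -> f @ z --> f z.
Proof. by elim: k => [|k IH]; [move=> h /h | move=> /holS]. Qed.

Lemma hol_cst k D (a : C) : hol k D (fun=> a).
Proof.
elim: k a => [|k IH] a /=; last by exists (fun=> 0) => // z _; exact: cder_cst.
by move=> z _; exact: (@cvgc_cst R C (nbhs z) _ a).
Qed.

Lemma hol_subr k D (a : C) : hol k D (fun w => w - a).
Proof.
case: k => [|k] /=; last first.
  exists (fun=> 1); last exact: hol_cst.
  by move=> z _; have := cderB (cder_id z) (cder_cst a z); rewrite subr0.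
by move=> z _; have := cderB (cder_id z) (cder_cst a z) => /cder_cvg.
Qed.

Lemma holD k D f g : hol k D f -> hol k D g -> hol k D (fun w => f w + g w).
Proof.
elim: k f g => [|k IH] f g /=.
  by move=> hf hg z Dz; exact: (@cvgcD R C (nbhs z) _ _ _ _ _ (hf z Dz) (hg z Dz)).
move=> [f' ff' hf'] [g' gg' hg']; exists (fun w => f' w + g' w); last exact: (IH _ _ hf' hg').
by move=> z Dz; exact: (cderD (ff' z Dz) (gg' z Dz)).
Qed.

Lemma holN k D f : hol k D f -> hol k D (fun w => - f w).
Proof.
elim: k f => [|k IH] f /=.
  by move=> hf z Dz; exact: (@cvgcN R C (nbhs z) _ _ _ (hf z Dz)).
move=> [f' ff' /IH hf']; exists (fun w => - f' w); last exact: hf'.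
by move=> z Dz; exact: (cderN (ff' z Dz)).
Qed.

Lemma holM k D f g : hol k D f -> hol k D g -> hol k D (fun w => f w * g w).
Proof.
elim: k f g => [|k IH] f g.
  by move=> hf hg z Dz; exact: (@cvgcM R C (nbhs z) _ _ _ _ _ (hf z Dz) (hg z Dz)).
move=> hf hg; have hfk := holS hf; have hgk := holS hg.
move: hf hg => [f' ff' hf'] [g' gg' hg'] /=.
exists (fun w => f' w * g w + f w * g' w); last first.
  exact: (holD (IH _ _ hf' hgk) (IH _ _ hfk hg')).
by move=> z Dz; exact: (cderM (ff' z Dz) (gg' z Dz)).
Qed.

Lemma holX k D f n : hol k D f -> hol k D (fun w => f w ^+ n).
Proof.
move=> hf; elim: n => [|n IH].
  have -> : (fun w => f w ^+ 0) = fun=> 1 by apply/funext => w; rewrite expr0.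
  exact: hol_cst.
have -> : (fun w => f w ^+ n.+1) = fun w => f w * f w ^+ n by apply/funext => w; rewrite exprS.
exact: (holM hf IH).
Qed.

Lemma holV k D f : (forall z, D z -> f z != 0) -> hol k D f -> hol k D (fun w => (f w)^-1).
Proof.
move=> f0; elim: k => [|k IH].
  by move=> hf z Dz; exact: (@cvgcV R C (nbhs z) _ _ _ (hf z Dz) (f0 z Dz)).
move=> hf; have hfk := IH (holS hf); move: hf => [f' ff' hf'] /=.
exists (fun w => - f' w * (f w)^-1 ^+ 2).
  by move=> z Dz; exact: (cderV (f0 z Dz) (ff' z Dz)).
exact: (holM (holN hf') (holX 2 hfk)).
Qed.

Lemma analytic_hol f z k : analytic_at f z -> exists2 r, 0 < r & hol k (cball z r) f.
Proof.
elim: k f => [|k IH] f /analytic_cder[f' /nbhscP[r r0 ff']].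
  by move=> _; exists r => // w /ff'/cder_cvg.
move=> /IH[s s0 hf']; exists (Num.min r s); first by rewrite lt_min r0.
exists f'; first by move=> w; rewrite /cball /= lt_min => /andP[/ff'].
by apply: hol_sub hf' => w; rewrite /cball /= lt_min => /andP[].
Qed.

(** Reduces poles to zeros of holomorphic functions. *)
Lemma pole_inv h p k : pole_at h p -> exists r (g : C -> C),
  [/\ 0 < r, hol k (cball p r) g, g p = 0 &
   forall w, cball p r w -> w != p -> h w != 0 /\ g w = (h w)^-1].
Proof.
move=> [n [G [n0 aG G0 hG]]].
have [r r0 hr] := analytic_hol k aG.
have /nbhscP[r1 r10 hr1] : \forall w \near p, G w != 0.
  have a0 : 0 < normc (G p) by rewrite normc_gt0.
  have H : \forall w \near p, normc (G w - G p) < normc (G p).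
    exact: ((@cvgcP R C (nbhs p) _ _ _).1 (analytic_cvg aG) _ a0).
  by apply: filterS H => w; apply: contraTneq => ->; rewrite sub0r normcN ltxx.
move/dnbhscP: hG => [r2 r20 hr2].
pose s := Num.min r (Num.min r1 r2).
have sP w : cball p s w -> [/\ normc (w - p) < r, normc (w - p) < r1 & normc (w - p) < r2].
  by rewrite /cball /= !lt_min => /and3P[].
exists s, (fun w => (w - p) ^+ n * (G w)^-1); split.
- by rewrite /s !lt_min r0 r10 r20.
- apply: holM; first by apply: holX; exact: hol_subr.
  apply: holV; first by move=> w /sP[_ /hr1].
  by apply: hol_sub hr => w /sP[].
- by rewrite subrr expr0n gtn_eqF // mul0r.
- move=> w /sP[_ /hr1 Gw /hr2 E] wp; rewrite E //.
  have wp0 : (w - p) ^+ n != 0 by rewrite expf_neq0 // subr_eq0.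
  by rewrite mulf_neq0 ?invr_neq0 // invfM invrK mulrC.
Qed.

Lemma pole_not_cvg h p : pole_at h p -> ~ (h @ p --> h p).
Proof.
move=> /(pole_inv 0)[r [g [r0 hg gp0 hgE]]] hc.
have gc := hol_cvg hg (cball_center p r0).
have c1 : (fun w => h w * g w) @ p --> h p * g p.
  exact: (@cvgcM R C (nbhs p) _ _ _ _ _ hc gc).
have : \forall w \near p, normc (h w * g w - h p * g p) < 1.
  exact: ((@cvgcP R C (nbhs p) _ _ _).1 c1 1 ltr01).
rewrite gp0 mulr0 => /nbhs_dnbhs c2.
have c3 : \forall w \near p^', cball p r w /\ w != p by apply/dnbhscP; exists r.
have [w [+ [w1 w2]]] := @filter_ex _ (p^') _ _ (filterI c2 c3).
by have [hw ->] := hgE w w1 w2; rewrite divff // subr0 ComplexField.Normc.normc1 ltxx.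
Qed.

Lemma pole_not_analytic h p : pole_at h p -> ~ analytic_at h p.
Proof. by move=> /pole_not_cvg hp /analytic_cvg. Qed.

Lemma discreteU S S' : discrete S -> discrete S' -> discrete (S `|` S').
Proof.
by move=> dS dS' z; apply: filterS (filterI (dS z) (dS' z)) => w [h1 h2] [].
Qed.

Lemma discrete_preim S (f : C -> C) :
  (forall z w, normc (f w - f z) = normc (w - z)) -> discrete S -> discrete (f @^-1` S).
Proof.
move=> fi dS z; have /dnbhscP[r r0 hr] := dS (f z); apply/dnbhscP; exists r => // w.
rewrite -fi => wr wz; apply: hr => //; apply: contraNneq wz => fwz.
by have := fi z w; rewrite fwz subrr normc0 => /esym/eqP;
  rewrite normc_eq0 subr_eq0.
Qed.

Lemma discrete_near_ex S z (P : C -> Prop) : discrete S -> (\forall w \near z, P w) ->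
  exists w, [/\ ~ S w, w != z & P w].
Proof.
move=> dS zP.
have c3 : \forall w \near z^', w != z by apply/dnbhscP; exists 1.
have [w [[h1 h2] h3]] := @filter_ex _ (z^') _ _ (filterI (filterI (dS z) (nbhs_dnbhs zP)) c3).
by exists w.
Qed.

(** At a pole [h] is not continuous, while near any given point it is continuous
except possibly at that point. *)
Lemma meromorphic_discrete h : meromorphic h -> discrete [set z | ~ analytic_at h z].
Proof.
move=> mh z.
suff : \forall w \near z^', h @ w --> h w.
  by apply: filterS => w hw /= nw; have [//|/pole_not_cvg] := mh w.
have [/analytic_cder[h' + _]|/(pole_inv 0)[r [g [r0 hg gp0 hgE]]]] := mh z.
  by move=> /nbhs_dnbhs; apply: filterS => w /cder_cvg.
apply/dnbhscP; exists r => // w wr wz.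
have [hw gw] := hgE w wr wz.
have gw0 : g w != 0 by rewrite gw invr_neq0.
have c : (fun v => (g v)^-1) @ w --> (g w)^-1.
  exact: (@cvgcV R C (nbhs w) _ _ _ (hol_cvg hg wr) gw0).
have vz : \forall v \near w, v != z.
  apply/nbhscP; exists (normc (w - z)); first by rewrite normc_gt0 subr_eq0.
  by move=> v; apply: contraTneq => ->; rewrite normcB ltxx.
have E : \forall v \near w, (g v)^-1 = h v.
  apply: filterS (filterI (cball_open wr) vz) => v [v1 v2].
  by have [_ ->] := hgE v v1 v2; rewrite invrK.
by rewrite gw invrK in c; exact: (cvgc_eq E c).
Qed.

End Holomorphic.

(** * Wirtinger derivatives *)

Section Wirtinger.
Variable R : realType.
Local Notation C := R[i].
Implicit Types (F G : C -> C) (u v : C -> R) (a b d e z w : C) (r s t : R).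

Definition pd e F z d := rder (fun s => F (z + s%:C * e)) 0 d.

(** [a] and [b] are the Wirtinger derivatives of [F] with respect to the
variable and to its conjugate, read off along the two coordinate axes. *)
Definition wd F z a b := pd 1 F z (a + b) /\ pd 'i F z ('i * (a - b)).

Lemma pdE e F z : F (z + (0 : R)%:C * e) = F z.
Proof. by rewrite mul0r addr0. Qed.

Lemma pd_cder e F z d : cder F z d -> pd e F z (e * d).
Proof.
by move=> fd; apply: (rder_comp (rder_line z e 0)); rewrite mul0r addr0.
Qed.

Lemma pd_eq e F G z d : (\forall w \near z, F w = G w) -> pd e F z d -> pd e G z d.
Proof.
move=> FG; apply: car_eq; first exact: rder_pI.
have H : \forall w \near z + (0 : R)%:C * e, F w = G w by rewrite mul0r addr0.
exact: (near_line H).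
Qed.

Lemma wd_eq F G z a b : (\forall w \near z, F w = G w) -> wd F z a b -> wd G z a b.
Proof. by move=> FG [h1 h2]; split; [exact: (pd_eq FG h1)|exact: (pd_eq FG h2)]. Qed.

Lemma wd_cder F z d : cder F z d -> wd F z d 0.
Proof.
move=> fd; split; first by rewrite addr0 -[d]mul1r; exact: pd_cder.
by rewrite subr0; exact: pd_cder.
Qed.

Lemma wd_cst a z : wd (fun=> a) z 0 0.
Proof. exact: wd_cder (cder_cst a z). Qed.

Lemma wdD F G z a b a' b' : wd F z a b -> wd G z a' b' ->
  wd (fun w => F w + G w) z (a + a') (b + b').
Proof.
move=> [f1 f2] [g1 g2]; split.
  by rewrite addrACA; exact: (rderD f1 g1).
by rewrite opprD addrACA mulrDr; exact: (rderD f2 g2).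
Qed.

Lemma wdM F G z a b a' b' : wd F z a b -> wd G z a' b' ->
  wd (fun w => F w * G w) z (a * G z + F z * a') (b * G z + F z * b').
Proof.
move=> [f1 f2] [g1 g2]; split.
  have := rderM f1 g1; rewrite !pdE; congr (rder _ _ _); ring.
have := rderM f2 g2; rewrite !pdE; congr (rder _ _ _); ring.
Qed.

Lemma wdN F z a b : wd F z a b -> wd (fun w => - F w) z (- a) (- b).
Proof.
move=> [f1 f2]; split.
  have := carN f1; congr (car _ _ _ _); ring.
have := carN f2; congr (car _ _ _ _); ring.
Qed.

Lemma wdB F G z a b a' b' : wd F z a b -> wd G z a' b' ->
  wd (fun w => F w - G w) z (a - a') (b - b').
Proof. by move=> hF hG; exact: (wdD hF (wdN hG)). Qed.

Lemma wdV F z a b : F z != 0 -> wd F z a b ->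
  wd (fun w => (F w)^-1) z (- a * (F z)^-1 ^+ 2) (- b * (F z)^-1 ^+ 2).
Proof.
move=> F0 [f1 f2].
have F01 e : F (z + (0 : R)%:C * e) != 0 by rewrite pdE.
split.
  have := rderV (F01 1) f1; rewrite !pdE; congr (rder _ _ _); ring.
have := rderV (F01 'i) f2; rewrite !pdE; congr (rder _ _ _); ring.
Qed.

Lemma wdJ F z a b : wd F z a b -> wd (fun w => (F w)^*) z b^* a^*.
Proof.
move=> [f1 f2]; split.
  by have := rder_conj f1; rewrite rmorphD addrC.
have -> : 'i * (b^* - a^*) = ('i * (a - b))^*.
  by case: a b {f1 f2} => [? ?] [? ?]; apply/eqP; rewrite eq_complex /=;
    apply/andP; split; apply/eqP; ring.
exact: (rder_conj f2).
Qed.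

Lemma rder_real_ln (x : R -> R) s d : 0 < x s ->
  rder (fun t => (x t)%:C) s d -> rder (fun t => (ln (x t))%:C) s (d / (x s)%:C).
Proof.
move=> x0 /rder_ReIm[/= h1 h2].
have d0 : complex.Im d = 0.
  by rewrite -(@derive_val _ _ _ _ _ _ _ h2) derive_cst.
have dE : d = (complex.Re d)%:C by case: d d0 {h1 h2} => ? ? /= ->.
rewrite dE -fmorphV -rmorphM; apply/rder_ReIm => /=; split; last exact: is_derive_cst.
rewrite mulrC.
have hl : is_derive (x s) 1 (@ln R) (x s)^-1 by exact: is_derive1_ln.
exact: (is_derive1_comp hl h1).
Qed.

Lemma wd_ln u z a b : 0 < u z -> wd (fun w => (u w)%:C) z a b ->
  wd (fun w => (ln (u w))%:C) z (a / (u z)%:C) (b / (u z)%:C).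
Proof.
move=> u0 [h1 h2].
have u01 e : 0 < u (z + (0 : R)%:C * e) by rewrite mul0r addr0.
split.
  have := rder_real_ln (u01 1) h1; rewrite mul0r addr0; congr (rder _ _ _); ring.
have := rder_real_ln (u01 'i) h2; rewrite mul0r addr0; congr (rder _ _ _); ring.
Qed.

Lemma is_derive_derive1 (x : R -> R) s r : is_derive s 1 x r -> derive1 x s = r.
Proof. by move=> h; rewrite derive1E; exact: derive_val. Qed.

Lemma wd_ddir F z a b : wd F z a b ->
  [/\ has_ddir 1 (fun w => complex.Re (F w)) z, has_ddir 'i (fun w => complex.Re (F w)) z,
   dx (fun w => complex.Re (F w)) z = complex.Re (a + b) &
   dy (fun w => complex.Re (F w)) z = complex.Re ('i * (a - b))].
Proof.
move=> [/rder_ReIm[h1 _] /rder_ReIm[h2 _]].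
by split; [exact: (@ex_derive _ _ _ _ _ _ _ h1)|exact: (@ex_derive _ _ _ _ _ _ _ h2)|exact: is_derive_derive1 h1|
  exact: is_derive_derive1 h2].
Qed.

Lemma dz_wd F z a b : wd F z a b -> dz F z = a.
Proof.
move=> [/rder_ReIm[h1 h2] /rder_ReIm[h3 h4]].
rewrite /dz /dx /dy /ddir (is_derive_derive1 h1) (is_derive_derive1 h2)
  (is_derive_derive1 h3) (is_derive_derive1 h4).
case: a b {h1 h2 h3 h4} => [a1 a2] [b1 b2] /=.
by congr (_ +i* _); field.
Qed.

Lemma ddir_eq e u v z : (\forall w \near z, u w = v w) -> ddir e u z = ddir e v z.
Proof.
move=> uv; rewrite /ddir !derive1E; apply: near_eq_derive.
have H : \forall w \near z + (0 : R)%:C * e, u w = v w by rewrite mul0r addr0.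
exact: (near_line H).
Qed.

Lemma has_ddir_eq e u v z : (\forall w \near z, u w = v w) -> has_ddir e u z -> has_ddir e v z.
Proof.
move=> uv; rewrite /has_ddir; apply: near_eq_derivable.
have H : \forall w \near z + (0 : R)%:C * e, u w = v w by rewrite mul0r addr0.
exact: (near_line H).
Qed.

Lemma laplacian_wd u z (a b : C -> C) aa ab ba bb :
  (\forall w \near z, wd (fun w => (u w)%:C) w (a w) (b w)) ->
  wd a z aa ab -> wd b z ba bb ->
  laplacian u z = 2 * complex.Re (ab + ba).
Proof.
move=> hu ha hb; rewrite /laplacian.
have E1 : \forall w \near z, dx u w = complex.Re (a w + b w).
  by apply: filterS hu => w /wd_ddir[_ _].
have E2 : \forall w \near z, dy u w = complex.Re ('i * (a w - b w)).
  by apply: filterS hu => w /wd_ddir[_ _].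
have [_ _ D1 _] := wd_ddir (wdD ha hb).
have [_ _ _ D2] := wd_ddir (wdM (wd_cst 'i z) (wdB ha hb)).
rewrite [X in X + _](ddir_eq 1 E1) [X in _ + X](ddir_eq 'i E2).
rewrite -/(dx _) -/(dy _) D1 D2 !mul0r !add0r.
case: aa ab ba bb {ha hb D1 D2} => [? ?] [? ?] [? ?] [? ?] /=; ring.
Qed.

(** * Classes of smooth functions *)

Implicit Types (D : set C) (k : nat).

Lemma cvgc_Re_at F z : F @ z --> F z ->
  (fun w => complex.Re (F w)) @ z --> complex.Re (F z).
Proof. by move=> /(@cvgc_ReIm R C (nbhs z) _)[]. Qed.

(** Smoothness of complex-valued functions in terms of Wirtinger derivatives,
which obey simpler product and conjugation rules than the real partial
derivatives. *)
Fixpoint sm k D F : Prop :=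
  (forall z, D z -> F @ z --> F z) /\
  match k with
  | 0 => True
  | k'.+1 => exists A B : C -> C,
      [/\ forall z, D z -> wd F z (A z) (B z), sm k' D A & sm k' D B]
  end.

Lemma sm_cvg k D F z : sm k D F -> D z -> F @ z --> F z.
Proof. by case: k => [|k] [h _]; exact: h. Qed.

Lemma smW k D F : sm k.+1 D F -> sm k D F.
Proof.
elim: k F => [|k IH] F [cF [A [B [h hA hB]]]]; first by split.
by split=> //; exists A, B; split=> //; exact: IH.
Qed.

Lemma sm_hol k D F : hol k D F -> sm k D F.
Proof.
elim: k F => [|k IH] F; first by move=> h; split.
move=> hF; have cF z : D z -> F @ z --> F z := @hol_cvg R k.+1 D F z hF.
split; first exact: cF.
have [F' FF' hF'] := hF; exists F', (fun=> 0); split.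
- by move=> z Dz; exact: (wd_cder (FF' z Dz)).
- exact: (IH _ hF').
- exact: (IH _ (hol_cst k D 0)).
Qed.

Lemma sm_cst k D (a : C) : sm k D (fun=> a).
Proof. by apply: sm_hol; exact: hol_cst. Qed.

Lemma smD k D F G : sm k D F -> sm k D G -> sm k D (fun w => F w + G w).
Proof.
elim: k F G => [|k IH] F G hF hG; (split; first by move=> z Dz;
  exact: (@cvgcD R C (nbhs z) _ _ _ _ _ (sm_cvg hF Dz) (sm_cvg hG Dz))).
  by [].
move: hF hG => [_ [A [B [h hA hB]]]] [_ [A' [B' [h' hA' hB']]]].
exists (fun w => A w + A' w), (fun w => B w + B' w); split.
- by move=> z Dz; exact: (wdD (h z Dz) (h' z Dz)).
- exact: (IH _ _ hA hA').
- exact: (IH _ _ hB hB').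
Qed.

Lemma smM k D F G : sm k D F -> sm k D G -> sm k D (fun w => F w * G w).
Proof.
elim: k F G => [|k IH] F G hF hG; (split; first by move=> z Dz;
  exact: (@cvgcM R C (nbhs z) _ _ _ _ _ (sm_cvg hF Dz) (sm_cvg hG Dz))).
  by [].
have hFk := smW hF; have hGk := smW hG.
move: hF hG => [_ [A [B [h hA hB]]]] [_ [A' [B' [h' hA' hB']]]].
exists (fun w => A w * G w + F w * A' w), (fun w => B w * G w + F w * B' w); split.
- by move=> z Dz; exact: (wdM (h z Dz) (h' z Dz)).
- exact: (smD (IH _ _ hA hGk) (IH _ _ hFk hA')).
- exact: (smD (IH _ _ hB hGk) (IH _ _ hFk hB')).
Qed.

Lemma smV k D F : (forall z, D z -> F z != 0) -> sm k D F -> sm k D (fun w => (F w)^-1).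
Proof.
move=> F0; elim: k => [|k IH] hF; (split; first by move=> z Dz;
  exact: (@cvgcV R C (nbhs z) _ _ _ (sm_cvg hF Dz) (F0 z Dz))).
  by [].
have hV := IH (smW hF).
move: hF => [_ [A [B [h hA hB]]]].
exists (fun w => (-1 * A w) * ((F w)^-1 * (F w)^-1)),
       (fun w => (-1 * B w) * ((F w)^-1 * (F w)^-1)); split.
- by move=> z Dz; rewrite !mulN1r -!expr2; exact: (wdV (F0 z Dz) (h z Dz)).
- exact: (smM (smM (sm_cst k D _) hA) (smM hV hV)).
- exact: (smM (smM (sm_cst k D _) hB) (smM hV hV)).
Qed.

Lemma smJ k D F : sm k D F -> sm k D (fun w => (F w)^*).
Proof.
elim: k F => [|k IH] F hF; (split; first by move=> z Dz;
  exact: (@cvgcJ R C (nbhs z) _ _ _ (sm_cvg hF Dz))).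
  by [].
move: hF => [_ [A [B [h hA hB]]]].
exists (fun w => (B w)^*), (fun w => (A w)^*); split.
- by move=> z Dz; exact: (wdJ (h z Dz)).
- exact: (IH _ hB).
- exact: (IH _ hA).
Qed.

Lemma sm_ln k D u : (forall z, D z -> 0 < u z) -> sm k D (fun w => (u w)%:C) ->
  sm k D (fun w => (ln (u w))%:C).
Proof.
move=> u0 hu.
have cl z : D z -> (fun w => (ln (u w))%:C) @ z --> (ln (u z))%:C.
  move=> Dz; have cu : u @ z --> u z := cvgc_Re_at (sm_cvg hu Dz).
  have cl : (fun w => ln (u w)) @ z --> ln (u z).
    by apply: (@cvg_comp _ _ _ u (@ln R) _ _ _ cu); apply: continuous_ln; exact: u0.
  exact: (@cvgc_real R C (nbhs z) _ _ _ cl).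
case: k hu => [|k] hu; first by split.
have hV : sm k D (fun w => (u w)%:C^-1).
  apply: smV (smW hu) => z Dz.
  by rewrite real_complex_eq0 gt_eqF // u0.
split; first exact: cl.
move: hu => [_ [A [B [h hA hB]]]].
exists (fun w => A w * (u w)%:C^-1), (fun w => B w * (u w)%:C^-1); split.
- by move=> z Dz; exact: (wd_ln (u0 z Dz) (h z Dz)).
- exact: (smM hA hV).
- exact: (smM hB hV).
Qed.

Definition opened D := forall z, D z -> \forall w \near z, D w.

Lemma cvgr_eq u v z (l : R) : (\forall w \near z, u w = v w) -> u @ z --> l -> v @ z --> l.
Proof.
move=> uv ul A /ul hA.
have H : \forall w \near z, u w = v w /\ A (u w) by exact: (filterI uv hA).
by apply: filterS H => w [uw Au]; rewrite /= -uw.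
Qed.

Lemma Ck_eq k D u v : opened D -> (forall z, D z -> u z = v z) -> Ck k D u -> Ck k D v.
Proof.
move=> oD.
have nD u' v' z : (forall z, D z -> u' z = v' z) -> D z -> \forall w \near z, u' w = v' w.
  by move=> uv /oD; apply: filterS => w /uv.
have cD u' v' : (forall z, D z -> u' z = v' z) ->
    (forall z, D z -> {for z, continuous u'}) -> forall z, D z -> {for z, continuous v'}.
  move=> uv cu z Dz.
  have h : v' @ z --> u' z := cvgr_eq (nD _ _ _ uv Dz) (cu z Dz).
  by rewrite (uv z Dz) in h; exact: h.
elim: k u v => [|k IH] u v uv [cu hu]; split; try exact: cD cu.
  by [].
move: hu => [hd hx hy]; split.
- move=> z Dz; have [h1 h2] := hd z Dz.
  by split; [exact: (has_ddir_eq (nD _ _ _ uv Dz) h1)|exact: (has_ddir_eq (nD _ _ _ uv Dz) h2)].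
- by apply: IH hx => z Dz; apply: ddir_eq; exact: nD.
- by apply: IH hy => z Dz; apply: ddir_eq; exact: nD.
Qed.

Lemma sm_Ck k D F : opened D -> sm k D F -> Ck k D (fun w => complex.Re (F w)).
Proof.
move=> oD; elim: k F => [|k IH] F hF.
  by split=> // z Dz; exact: (cvgc_Re_at (sm_cvg hF Dz)).
split.
  by move=> z Dz; exact: (cvgc_Re_at (sm_cvg hF Dz)).
move: hF => [_ [A [B [h hA hB]]]]; split.
- by move=> z Dz; have [h1 h2 _ _] := wd_ddir (h z Dz).
- apply: (Ck_eq oD _ (IH _ (smD hA hB))) => z Dz.
  by have [_ _ -> _] := wd_ddir (h z Dz).
- have := IH _ (smM (sm_cst k D 'i) (smD hA (smM (sm_cst k D (-1)) hB))).
  apply: (Ck_eq oD) => z Dz.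
  by have [_ _ _ ->] := wd_ddir (h z Dz); rewrite mulN1r.
Qed.

Lemma Ck_sub k D D' u : D' `<=` D -> Ck k D u -> Ck k D' u.
Proof.
move=> DD; elim: k u => [|k IH] u [cu hu]; split; try by move=> z /DD/cu.
  by [].
by move: hu => [hd hx hy]; split; [move=> z /DD/hd|exact: IH|exact: IH].
Qed.

(** Continuity and the existence of directional derivatives at a point do not
depend on the set on which smoothness is asserted. *)
Lemma Ck_local k D u : (forall z, D z -> exists2 D' : set C, D' z & Ck k D' u) -> Ck k D u.
Proof.
elim: k u => [|k IH] u h.
  by split=> // z /h[D' D'z [cu _]]; exact: cu.
split; first by move=> z /h[D' D'z [cu _]]; exact: cu.
split.
- by move=> z /h[D' D'z [_ [hd _ _]]]; exact: hd.
- by apply: IH => z /h[D' D'z [_ [_ hx _]]]; exists D'.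
- by apply: IH => z /h[D' D'z [_ [_ _ hy]]]; exists D'.
Qed.

Lemma Ck_sm k D u : Ck k D u -> sm k D (fun w => (u w)%:C).
Proof.
have cl u' z : {for z, continuous u'} -> (fun w => (u' w)%:C) @ z --> (u' z)%:C.
  by move=> cu; exact: (@cvgc_real R C (nbhs z) _ _ _ cu).
elim: k u => [|k IH] u [cu hu].
  by split=> // z Dz; exact: cl (cu z Dz).
split; first by move=> z Dz; exact: cl (cu z Dz).
move: hu => [hd hx hy].
exists (fun w => (1 / 2) * ((dx u w)%:C + - 'i * (dy u w)%:C)),
       (fun w => (1 / 2) * ((dx u w)%:C + 'i * (dy u w)%:C)); split.
- move=> z Dz; have [h1 h2] := hd z Dz.
  have E1 : 1 / 2 * ((dx u z)%:C + - 'i * (dy u z)%:C) +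
    1 / 2 * ((dx u z)%:C + 'i * (dy u z)%:C) = (dx u z)%:C by field.
  have E2 : 'i * (1 / 2 * ((dx u z)%:C + - 'i * (dy u z)%:C) -
    1 / 2 * ((dx u z)%:C + 'i * (dy u z)%:C)) = (dy u z)%:C.
    have i2 : 'i * 'i = -1 :> C by rewrite -expr2 sqr_i.
    by rewrite -[RHS]mul1r -[1 in RHS]opprK -i2; field.
  split; rewrite ?E1 ?E2; apply/rder_ReIm => /=; split; try exact: is_derive_cst.
    by rewrite /dx /ddir derive1E; apply: derivableP; exact: h1.
  by rewrite /dy /ddir derive1E; apply: derivableP; exact: h2.
- exact: (smM (sm_cst k D _) (smD (IH _ hx) (smM (sm_cst k D _) (IH _ hy)))).
- exact: (smM (sm_cst k D _) (smD (IH _ hx) (smM (sm_cst k D _) (IH _ hy)))).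
Qed.

Lemma CkD k D u v : opened D -> Ck k D u -> Ck k D v -> Ck k D (fun w => u w + v w).
Proof. by move=> oD /Ck_sm hu /Ck_sm hv; exact: (sm_Ck oD (smD hu hv)). Qed.

Lemma CkM k D u v : opened D -> Ck k D u -> Ck k D v -> Ck k D (fun w => u w * v w).
Proof.
move=> oD /Ck_sm hu /Ck_sm hv; have := sm_Ck oD (smM hu hv).
by apply: (Ck_eq oD) => z _ /=; rewrite mulr0 subr0.
Qed.

End Wirtinger.

(** * Continuous functions on the unit square *)

Section Square.
Variable R : realType.
Implicit Types (F g : R * R -> R).
Local Notation mu2 := ((@lebesgue_measure R) \x (@lebesgue_measure R))%E.
Local Notation R2 := (measurableTypeR R * measurableTypeR R)%type.

Lemma measurable_square : measurable (@unit_square R : set R2).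
Proof. by apply: measurableX; exact: measurable_itv. Qed.

Lemma cvg_truncn_div (x : R) : 0 <= x ->
  (fun n : nat => (Num.truncn (n.+1%:R * x))%:R / n.+1%:R : R) @ \oo --> x.
Proof.
move=> x0; apply: (@squeeze_cvgr _ _ _ _ (fun n => x - harmonic n) (fun=> x)).
- apply: nearW => n; have nx : 0 <= n.+1%:R * x by rewrite mulr_ge0.
  have /andP[h1 h2] := truncn_itv nx; rewrite ler_pdivrMr ?ltr0n // [x * _]mulrC h1 andbT.
  rewrite ler_pdivlMr ?ltr0n // mulrBl /= mulVf ?pnatr_eq0 // [x * _]mulrC lerBlDr natr1.
  exact: ltW.
- rewrite -[X in _ --> X]subr0; apply: cvgB; first exact: cvg_cst.
  exact: cvg_harmonic.
- exact: cvg_cst.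
Qed.

(** A continuous function of two variables is a limit of functions that are
step functions in the first variable. *)
Lemma continuous_measurable_square F : continuous F ->
  measurable_fun (@unit_square R : set R2) (F : R2 -> R).
Proof.
move=> cF.
pose Fn (n : nat) (p : R * R) := F ((Num.truncn (n.+1%:R * p.1))%:R / n.+1%:R, p.2).
apply: (@measurable_fun_cvg _ _ _ _ Fn).
  move=> n _ B mB.
  have -> : @unit_square R `&` Fn n @^-1` B = @unit_square R `&`
      \bigcup_k ([set` `[k%:R / n.+1%:R, k.+1%:R / n.+1%:R[ ] `*`
         ((fun y => F (k%:R / n.+1%:R, y)) @^-1` B)).
    apply/seteqP; split=> [[x y] [sq] /= h|[x y] [sq] /= [k _] /= [hk h]]; split => //.
    - exists (Num.truncn (n.+1%:R * x)) => //; split => //=.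
      have x0 : 0 <= x by case: sq => /=; rewrite in_itv /= => /andP[].
      have /andP[h1 h2] : _ := @truncn_itv _ (n.+1%:R * x) (mulr_ge0 (ler0n _ _) x0).
      by rewrite in_itv /= ler_pdivrMr ?ltr0n // ltr_pdivlMr ?ltr0n // [x * _]mulrC h1.
    - have x0 : 0 <= x by case: sq => /=; rewrite in_itv /= => /andP[].
      rewrite /Fn /= (_ : Num.truncn _ = k) //; apply: truncn_def.
      by move: hk; rewrite in_itv /= ler_pdivrMr ?ltr0n // ltr_pdivlMr ?ltr0n // [x * _]mulrC.
  apply: measurableI; first exact: measurable_square.
  apply: bigcupT_measurable => k; apply: measurableX; first exact: measurable_itv.
  rewrite -[X in measurable X]setTI; apply: continuous_measurable_fun => //.
  move=> y; apply: (@cvg_comp _ _ _ (fun y => (k%:R / n.+1%:R, y)) F); last exact: cF.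
  exact: (@cvg_pair R R R (nbhs y) (nbhs (k%:R / n.+1%:R : R)) (nbhs y) _ _ _
    (fun=> k%:R / n.+1%:R) (fun y => y) (cvg_cst _) cvg_id).
move=> [x y] [/= hx hy]; apply: (@cvg_comp _ _ _ (fun n : nat => ((Num.truncn (n.+1%:R * x))%:R / n.+1%:R, y)) F); last exact: cF.
have x0 : 0 <= x by move: hx; rewrite in_itv /= => /andP[].
exact: (@cvg_pair nat R R \oo (nbhs x) (nbhs y) _ _ _ _ (fun=> y) (cvg_truncn_div x0) (cvg_cst y)).
Qed.

Lemma continuous_bounded_square F : continuous F ->
  exists M : R, forall p, unit_square p -> `|F p| <= M.
Proof.
move=> cF; have cN : continuous (fun p => `|F p|).
  by move=> p; apply: cvg_norm; exact: cF.
have [|||c _ hc] := @compact_EVT_max _ R (fun p => `|F p|) (@unit_square R).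
- by exists (0, 0); split; rewrite /= in_itv /= lexx ler01.
- by apply: compact_setX; exact: segment_compact.
- exact: continuous_subspaceT.
- by exists `|F c| => p hp; apply: hc; rewrite inE.
Qed.

Lemma square_finite : (mu2 (@unit_square R) < +oo)%E.
Proof.
rewrite product_measure1E; try exact: measurable_itv.
have E : lebesgue_measure (`[0%R, 1%R]%classic : set R) = 1%:E.
  by rewrite lebesgue_measure_itv /= lte_fin ltr01 -EFinB subr0.
apply: (@le_lt_trans _ _ (1%:E * 1%:E)%E); last by rewrite -EFinM ltry.
by rewrite le_eqVlt; apply/orP; left; apply/eqP; congr (_ * _)%E; exact: E.
Qed.

Lemma continuous_integrable_square F : continuous F ->
  mu2.-integrable (@unit_square R) (EFin \o F).
Proof.
move=> cF; apply: measurable_bounded_integrable.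
- exact: measurable_square.
- exact: square_finite.
- exact: continuous_measurable_square.
- have [M hM] := continuous_bounded_square cF.
  exists M; split; first exact: num_real.
  by move=> x Mx p /hM h; apply: le_trans h _; exact: ltW.
Qed.
End Square.

(** * Derivatives along a line *)

Section Torus.
Variable R : realType.
Local Notation C := R[i].
Implicit Types (u v V phi : C -> R) (z w e tau : C) (s t r : R).
Local Notation mu := (@lebesgue_measure R).
Local Notation mu2 := (mu \x mu)%E.

Lemma is_derive_ddir e V z t : has_ddir e V (z + t%:C * e) ->
  is_derive t 1 (fun s => V (z + s%:C * e)) (ddir e V (z + t%:C * e)).
Proof.
move=> h; apply/is_deriveP.
have := (is_deriveP _ _ _).1 (derivableP h); rewrite -derive1E -/(ddir e V _).
have -> : (fun x => x^-1 * (V (z + t%:C * e + (x + 0)%:C * e) -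
      V (z + t%:C * e + (0 : R)%:C * e))) =
    (fun x => x^-1 * (V (z + (x + t)%:C * e) - V (z + t%:C * e))).
  apply/funext => x; rewrite addr0 mul0r addr0 rmorphD mulrDl.
  by rewrite [x%:C * e + _]addrC addrA.
by move=> c; exact: c.
Qed.

(** The mean value theorem with a free intermediate point, for both signs of
the increment. *)
Lemma ddir_mvt e V z r : (forall w, has_ddir e V w) ->
  exists2 s, `|s| <= `|r| & V (z + r%:C * e) - V z = r * ddir e V (z + s%:C * e).
Proof.
move=> h.
have d t : is_derive t 1 (fun s => V (z + (s * r)%:C * e)) (r * ddir e V (z + (t * r)%:C * e)).
  have d1 : is_derive t 1 (fun s : R => s * r) r.
    apply/is_derive_slope.
    have -> : (fun s => if s == t then r else (s * r - t * r) / (s - t)) = fun=> r.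
      apply/funext => s; case: eqP => // /eqP st.
      by rewrite -mulrBl mulrAC divff ?mul1r // subr_eq0.
    exact: cvg_cst.
  have d2 := is_derive_ddir (h (z + (t * r)%:C * e)).
  rewrite [r * ddir _ _ _]mulrC; exact: (@is_derive1_comp R (fun s : R => V (z + s%:C * e)) (fun s => s * r) t _ _ d2 d1).
have cont : {within `[0, 1], continuous (fun s => V (z + (s * r)%:C * e))}.
  by apply: derivable_within_continuous => x _; exact: (@ex_derive _ _ _ _ _ _ _ (d x)).
have [c c01] := MVT_segment ler01 (fun x _ => d x) cont.
rewrite mul1r mul0r mul0r addr0 subr0 mulr1 => ->; exists (c * r) => //.
move: c01; rewrite in_itv /= => /andP[c0 c1].
by rewrite normrM ger0_norm // ler_piMl.
Qed.

(** The increment along [e] is split into a vertical and a horizontal one; the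
mean value theorem reduces each of them to the continuity of a partial
derivative. *)
Lemma C1_chain V z e t : Ck 1 setT V ->
  is_derive t 1 (fun s => V (z + s%:C * e))
    (complex.Re e * dx V (z + t%:C * e) + complex.Im e * dy V (z + t%:C * e)).
Proof.
move=> [_ [hd [cx _] [cy _]]].
set p := z + t%:C * e; set D := _ + _.
suff : rder (fun s => (V (z + s%:C * e))%:C) t D%:C by move=> /rder_ReIm[].
apply/carP; first exact: rder_pI.
move=> eps eps0.
set K := `|complex.Re e| + `|complex.Im e| + 1.
have K0 : 0 < K by rewrite ltr_wpDl // addr_ge0.
have e1 : 0 < eps / K by rewrite divr_gt0.
have ball_of (f : C -> R) : {for p, continuous f} -> exists2 r, 0 < r &
    forall w, normc (w - p) < r -> `|f p - f w| < eps / K.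
  move=> cf; have H : \forall w \near p, ball (f p) (eps / K) (f w).
    by apply: cf; exact: nbhsx_ballx.
  by move/nbhscP: H => [q q0 hq]; exists q => // w wq; have := hq w wq; rewrite -ball_normE.
have [r1 r10 h1] := ball_of _ (cx p I).
have [r2 r20 h2] := ball_of _ (cy p I).
pose r := Num.min r1 r2 / K.
have r0 : 0 < r by rewrite divr_gt0 // lt_min r10.
have : \forall s \near t, `|s - t| < r.
  by near=> s; rewrite distrC; near: s; exact: nbhsx_ballx.
apply: filterS => s sr.
rewrite -!rmorphB -rmorphM -rmorphB !normc_real.
set y := (s - t) * complex.Im e; set x := (s - t) * complex.Re e.
have -> : z + s%:C * e = (p + y%:C * 'i) + x%:C * 1.
  have -> : z + s%:C * e = p + (s - t)%:C * e by rewrite /p rmorphB /=; ring.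
  have -> : (s - t)%:C * e = y%:C * 'i + x%:C * 1.
    rewrite {1}(complexE e) complexiE /x /y !(rmorphM (real_complex R)); ring.
  by rewrite addrA.
have [a ax aE] := @ddir_mvt 1 V (p + y%:C * 'i) x (fun w => (hd w I).1).
have [b bx bE] := @ddir_mvt 'i V p y (fun w => (hd w I).2).
have -> : V (p + y%:C * 'i + x%:C * 1) - V p - (s - t) * D =
  x * (dx V (p + y%:C * 'i + a%:C * 1) - dx V p) + y * (dy V (p + b%:C * 'i) - dy V p).
  rewrite !mulrBr; move: aE bE; rewrite -/(dx V _) -/(dy V _) => <- <-.
  by rewrite /D /x /y; ring.
have xst : `|x| + `|y| <= K * `|s - t|.
  rewrite /x /y !normrM -mulrDr mulrC ler_wpM2r //.
  by rewrite /K lerDl ler01.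
have xyr : `|x| + `|y| < Num.min r1 r2.
  by apply: le_lt_trans xst _; rewrite mulrC -ltr_pdivlMr.
have h1' : `|dx V p - dx V (p + y%:C * 'i + a%:C * 1)| < eps / K.
  apply: h1; rewrite -[p + _ + _]addrA [p + (_ + _)]addrC addrK.
  apply: le_lt_trans (le_normcD _ _) _; rewrite !normcM !normc_real normr1 mulr1.
  rewrite normc_i mulr1; move: xyr; rewrite lt_min => /andP[+ _].
  by apply: le_lt_trans; rewrite addrC lerD2r.
have h2' : `|dy V p - dy V (p + b%:C * 'i)| < eps / K.
  apply: h2; rewrite [p + _]addrC addrK.
  rewrite normcM normc_real.
  rewrite normc_i mulr1; move: xyr; rewrite lt_min => /andP[_].
  apply: le_lt_trans; apply: le_trans bx _.
  by rewrite lerDr.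
apply: le_trans (ler_normD _ _) _; rewrite (normrM x) (normrM y).
rewrite [`|_ - dx V p|]distrC [`|_ - dy V p|]distrC.
apply: (@le_trans _ _ ((`|x| + `|y|) * (eps / K))).
  by rewrite mulrDl; apply: lerD; apply: ler_wpM2l => //; exact: ltW.
apply: (@le_trans _ _ (K * `|s - t| * (eps / K))).
  by rewrite ler_wpM2r // ltW.
by rewrite le_eqVlt; apply/orP; left; apply/eqP; field; rewrite gt_eqF.
Unshelve. all: by end_near. Qed.

Lemma is_derive_const_ends_integral (G g : R -> R) :
  (forall t, is_derive t 1 G (g t)) -> continuous g -> G 1 = G 0 ->
  (\int[mu]_(t in `[0%R, 1%R]) (g t)%:E = 0)%E.
Proof.
move=> Gg cg G10.
have cG : continuous G.
  by move=> t; apply/differentiable_continuous/derivable1_diffP; exact: (@ex_derive _ _ _ _ _ _ _ (Gg t)).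
rewrite (@continuous_FTC2 R g G 0 1 ltr01).
- by rewrite G10 subee.
- exact: continuous_subspaceT.
- split.
  + by move=> t _; exact: (@ex_derive _ _ _ _ _ _ _ (Gg t)).
  + by apply: cvg_at_right_filter; exact: cG.
  + by apply: cvg_at_left_filter; exact: cG.
- by move=> t _; rewrite derive1E; exact: derive_val.
Qed.

(** * Integrals of derivatives of periodic functions *)

Lemma torus_param_cvg tau (p : R * R) : torus_param tau @ p --> torus_param tau p.
Proof.
have c1 : (fun q : R * R => q.1%:C) @ p --> p.1%:C.
  exact: (@cvgc_real R _ (nbhs p) _ _ _ (@cvg_fst _ _ (nbhs p.1) (nbhs p.2) _)).
have c2 : (fun q : R * R => q.2%:C) @ p --> p.2%:C.
  exact: (@cvgc_real R _ (nbhs p) _ _ _ (@cvg_snd _ _ (nbhs p.1) (nbhs p.2) _)).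
exact: (cvgcD c1 (cvgcM c2 (@cvgc_cst R _ (nbhs p) _ tau))).
Qed.

Lemma continuous_torus tau V : (forall z, {for z, continuous V}) ->
  continuous (fun p => V (torus_param tau p)).
Proof.
move=> cV p; move=> A hA; have h1 := cV (torus_param tau p) A hA.
exact: (torus_param_cvg h1).
Qed.

Lemma fubini0_l (F : R * R -> R) : continuous F ->
  (forall x, \int[mu]_(y in `[0%R, 1%R]) (F (x, y))%:E = 0)%E ->
  (\int[mu2]_(p in @unit_square R) (F p)%:E = 0)%E.
Proof.
move=> cF h; have iF := continuous_integrable_square cF.
rewrite integral_mkcond -integral12_prod_meas1; last first.
  by move: iF => /integrable_mkcond iF; have := iF (@measurable_square R).
apply: integral0_eq => x _; rewrite /fubini_F.
have [xI|xI] := boolP (x \in `[0%R, 1%R]%classic).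
  rewrite -[RHS](h x) [RHS]integral_mkcond; apply: eq_integral => y _.
  rewrite /patch /unit_square.
  suff -> : ((x, y) \in `[0, 1] `*` `[0, 1]) = (y \in `[0, 1]%classic) by [].
  by apply/idP/idP; rewrite !inE; [by case|by move=> yI; split => //; rewrite inE in xI].
apply: integral0_eq => y _; rewrite /patch ifF //; apply/negbTE.
by apply: contra xI; rewrite !inE => -[].
Qed.

Lemma fubini0_r (F : R * R -> R) : continuous F ->
  (forall y, \int[mu]_(x in `[0%R, 1%R]) (F (x, y))%:E = 0)%E ->
  (\int[mu2]_(p in @unit_square R) (F p)%:E = 0)%E.
Proof.
move=> cF h; have iF := continuous_integrable_square cF.
rewrite integral_mkcond -integral21_prod_meas1; last first.
  by move: iF => /integrable_mkcond iF; have := iF (@measurable_square R).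
apply: integral0_eq => y _; rewrite /fubini_G.
have [yI|yI] := boolP (y \in `[0%R, 1%R]%classic).
  rewrite -[RHS](h y) [RHS]integral_mkcond; apply: eq_integral => x _.
  rewrite /patch /unit_square.
  suff -> : ((x, y) \in `[0, 1] `*` `[0, 1]) = (x \in `[0, 1]%classic) by [].
  by apply/idP/idP; rewrite !inE; [by case|by move=> xI; split => //; rewrite inE in yI].
apply: integral0_eq => x _; rewrite /patch ifF //; apply/negbTE.
by apply: contra yI; rewrite !inE => -[].
Qed.

(** On each horizontal side [dx V] is the derivative of a function with equal
values at the ends, so Fubini's theorem applies. *)
Lemma periodic_dx_integral tau V : periodic_off tau set0 V -> Ck 1 setT V ->
  torus_int tau (dx V) = 0.
Proof.
move=> pV hV; have [_ [_ [cx _] _]] := hV.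
have cF : continuous (fun p => dx V (torus_param tau p)).
  by apply: continuous_torus => z; exact: cx.
rewrite /torus_int /Rintegral fubini0_r // ?mulr0 //.
move=> y.
have d s : is_derive s 1 (fun x => V (y%:C * tau + x%:C * 1)) (dx V (torus_param tau (s, y))).
  have := C1_chain (y%:C * tau) 1 s hV; rewrite /= mul1r mul0r addr0 /torus_param /=.
  by rewrite mulr1 [_ + s%:C]addrC.
apply: (is_derive_const_ends_integral d).
- move=> s; apply: (@cvg_comp _ _ _ (fun s : R => (s, y)) (fun p => dx V (torus_param tau p))); last exact: cF.
  exact: (@cvg_pair R R R (nbhs s) (nbhs s) (nbhs y) _ _ _ (fun s => s) (fun=> y) cvg_id (cvg_cst _)).
- by rewrite mul1r mul0r addr0; have [-> _] := pV (y%:C * tau) (fun x => x).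
Qed.

(** The same on the sides parallel to [tau], along which the derivative combines
both partial derivatives. *)
Lemma periodic_dtau_integral tau V : periodic_off tau set0 V -> Ck 1 setT V ->
  torus_int tau (fun z => complex.Re tau * dx V z + complex.Im tau * dy V z) = 0.
Proof.
move=> pV hV; have [_ [_ [cx _] [cy _]]] := hV.
have cF : continuous (fun p => (fun z => complex.Re tau * dx V z + complex.Im tau * dy V z) (torus_param tau p)).
  apply: (@continuous_torus tau (fun z => complex.Re tau * dx V z + complex.Im tau * dy V z)) => z.
  have c1 : (fun w => complex.Re tau * dx V w) @ z --> complex.Re tau * dx V z.
    exact: (@cvgM R C (nbhs z) _ _ _ _ _ (@cvg_cst _ _ C (nbhs z) _) (cx z I)).
  have c2 : (fun w => complex.Im tau * dy V w) @ z --> complex.Im tau * dy V z.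
    exact: (@cvgM R C (nbhs z) _ _ _ _ _ (@cvg_cst _ _ C (nbhs z) _) (cy z I)).
  exact: (@cvgD R R C (nbhs z) _ _ _ _ _ c1 c2).
rewrite /torus_int /Rintegral fubini0_l // ?mulr0 //.
move=> x.
have d s : is_derive s 1 (fun y => V (x%:C + y%:C * tau)) _ := C1_chain x%:C tau s hV.
apply: (is_derive_const_ends_integral d).
- move=> s A hA.
  have cp : (fun s : R => (x, s)) @ s --> (x, s).
    exact: (@cvg_pair R R R (nbhs s) (nbhs x) (nbhs s) _ _ _ (fun=> x) (fun s => s) (cvg_cst _) cvg_id).
  exact: (cp _ (cF (x, s) A hA)).
- by rewrite mul1r mul0r addr0; have [_ ->] := pV x%:C (fun x => x).
Qed.

End Torus.

(** * Green's identity on the torus *)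

Section Green.
Variable R : realType.
Local Notation C := R[i].
Implicit Types (u v w V phi : C -> R) (z tau : C) (s t r : R).
Local Notation mu := (@lebesgue_measure R).
Local Notation mu2 := (mu \x mu)%E.
Local Notation R2 := (measurableTypeR R * measurableTypeR R)%type.

Lemma torus_integrableD tau u v : torus_integrable tau u -> torus_integrable tau v ->
  torus_integrable tau (fun z => u z + v z).
Proof.
by move=> iu iv; have := integrableD (@measurable_square R) iu iv.
Qed.

Lemma torus_integrable_cont tau V : (forall z, {for z, continuous V}) -> torus_integrable tau V.
Proof.
move=> cV; have cF : continuous (fun p => V (torus_param tau p)) by exact: continuous_torus.
by have := continuous_integrable_square cF.
Qed.

Lemma torus_integrableM tau u V : torus_integrable tau u -> (forall z, {for z, continuous V}) ->
  torus_integrable tau (fun z => u z * V z).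
Proof.
move=> iu cV; have cF : continuous (fun p => V (torus_param tau p)) by exact: continuous_torus.
have [M hM] := continuous_bounded_square cF.
have bF : [bounded V (torus_param tau p) | p in @unit_square R].
  exists M; split; first exact: num_real.
  by move=> x Mx p /hM h; apply: le_trans h _; exact: ltW.
by have := integrableMl (@measurable_square R) iu (continuous_measurable_square cF) bF.
Qed.

Lemma torus_intD tau u v : torus_integrable tau u -> torus_integrable tau v ->
  torus_int tau (fun z => u z + v z) = torus_int tau u + torus_int tau v.
Proof.
move=> iu iv; rewrite /torus_int -mulrDr; congr (_ * _).
by have := RintegralD (@measurable_square R) iu iv.
Qed.

Lemma torus_intZ tau r u : torus_integrable tau u ->
  torus_int tau (fun z => r * u z) = r * torus_int tau u.
Proof.
move=> iu; rewrite /torus_int mulrCA; congr (_ * _).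
by have := RintegralZl r (@measurable_square R) iu.
Qed.

Lemma half_lattice_square tau (p : R * R) : 0 < complex.Im tau -> unit_square p ->
  half_lattice tau (torus_param tau p) -> [\/ p.1 = 0, p.1 = 2^-1 | p.1 = 1].
Proof.
move=> t0 [/= p1 _] [m [n]]; rewrite /torus_param => E.
have E2 : complex.Im (2 * (p.1%:C + p.2%:C * tau)) = complex.Im (m%:~R + n%:~R * tau).
  by rewrite E.
have E1 : complex.Re (2 * (p.1%:C + p.2%:C * tau)) = complex.Re (m%:~R + n%:~R * tau).
  by rewrite E.
have intC (k : int) : k%:~R = (k%:~R : R)%:C :> C by rewrite rmorph_int.
have natC : (2 : C) = (2 : R)%:C by rewrite rmorph_nat.
move: E1 E2; rewrite !intC natC; case: tau t0 {E} => a b /= b0.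
move=> E1 E2.
have n2 : 2 * p.2 = n%:~R.
  by apply: (mulIf (lt0r_neq0 b0)); lra.
have m2 : 2 * p.1 = m%:~R by rewrite -n2 in E1; lra.
have : 0 <= m <= 2.
  by move: p1; rewrite in_itv /= => /andP[h0 h1]; rewrite -!(ler_int R) -m2; lra.
have p1E : p.1 = m%:~R / 2 by rewrite -m2; field.
case: m m2 {E1} p1E => [[|[|[|m]]]|m] // _ p1E _.
- by constructor 1; rewrite p1E mul0r.
- by constructor 2; rewrite p1E -pmulrn; field.
- by constructor 3; rewrite p1E -pmulrn; field.
Qed.

(** Half-periods lie over a null set of the square, so they are invisible to
torus integrals. *)
Lemma torus_int_off tau u v : 0 < complex.Im tau ->
  torus_integrable tau u -> torus_integrable tau v ->
  eq_off (half_lattice tau) u v -> torus_int tau u = torus_int tau v.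
Proof.
move=> t0 iu iv uv; rewrite /torus_int /Rintegral; congr (_ * fine _).
pose N1 : set (measurableTypeR R) := [set` [:: 0; 2^-1; 1] ].
pose N : set R2 := N1 `*` setT.
have cN1 : countable N1 by apply: finite_set_countable; exact: finite_seq.
have mN1 : measurable N1.
  by apply: countable_measurable cN1 => t; exact: measurable_set1.
have mN : measurable N by apply: measurableX.
have N0 : mu2 N = 0%E.
  rewrite product_measure1E //.
  have E : mu N1 = 0%E by exact: countable_lebesgue_measure0.
  by rewrite [X in (X * _)%E]E mul0e.
rewrite (negligible_integral mN (@measurable_square R) iu N0).
rewrite (negligible_integral mN (@measurable_square R) iv N0).
apply: eq_integral => p; rewrite inE => -[sq Np].
congr EFin; apply: uv => hl; apply: Np; split => //.
by have [e|e|e] := half_lattice_square t0 sq hl; rewrite /N1 /= !inE e eqxx ?orbT.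
Qed.

(** The second partial derivative is a linear combination of the derivatives
along the two periods. *)
Lemma periodic_dy_integral tau V : 0 < complex.Im tau ->
  periodic_off tau set0 V -> Ck 1 setT V -> torus_int tau (dy V) = 0.
Proof.
move=> t0 pV hV; have [_ [_ [cx _] [cy _]]] := hV.
have ix : torus_integrable tau (dx V) by apply: torus_integrable_cont => z; exact: cx.
have iy : torus_integrable tau (dy V) by apply: torus_integrable_cont => z; exact: cy.
have cst_c (r : R) (z : C) : {for z, continuous (fun _ : C => r)}.
  exact: (@cvg_cst _ r C (nbhs z) _).
have H := periodic_dtau_integral pV hV.
have E V' r : (fun z => r * V' z) = (fun z : C => V' z * r) by apply/funext => z; rewrite mulrC.
rewrite torus_intD in H; first last.
- by rewrite E; apply: torus_integrableM.
- by rewrite E; apply: torus_integrableM.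
rewrite !torus_intZ // (periodic_dx_integral pV hV) mulr0 add0r in H.
by move/eqP: H; rewrite mulf_eq0 gt_eqF // => /eqP.
Qed.

Lemma ddirM e u v z : has_ddir e u z -> has_ddir e v z ->
  ddir e (fun y => u y * v y) z = ddir e u z * v z + u z * ddir e v z.
Proof.
move=> /derivableP hu /derivableP hv.
have := is_deriveM hu hv; rewrite /ddir !derive1E => /(@derive_val _ _ _ _ _ _ _).
by move=> ->; rewrite mul0r addr0 addrC mulrC; congr (_ + _); rewrite mulrC.
Qed.

Lemma ddirD e u v z : has_ddir e u z -> has_ddir e v z ->
  ddir e (fun y => u y + v y) z = ddir e u z + ddir e v z.
Proof.
move=> /derivableP hu /derivableP hv.
by have := is_deriveD hu hv; rewrite /ddir !derive1E => /(@derive_val _ _ _ _ _ _ _).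
Qed.

Lemma ddirN e u z : has_ddir e u z -> ddir e (fun y => - u y) z = - ddir e u z.
Proof.
move=> /derivableP hu.
by have := is_deriveN hu; rewrite /ddir !derive1E => /(@derive_val _ _ _ _ _ _ _).
Qed.

Lemma periodic_ddir tau e V : periodic_off tau set0 V -> periodic_off tau set0 (ddir e V).
Proof.
move=> pV z _; rewrite /ddir.
have E (x : C) : V (x + 1) = V x /\ V (x + tau) = V x by exact: pV.
split; congr (derive1 _ 0); apply/funext => s; rewrite addrAC; first by rewrite (E _).1.
by rewrite (E _).2.
Qed.

Lemma CkN k D u : opened D -> Ck k D u -> Ck k D (fun y => - u y).
Proof.
move=> oD hu; have := CkM oD (sm_Ck oD (sm_cst k D (-1)%:C)) hu.
by apply: (Ck_eq oD) => z _ /=; rewrite mulN1r.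
Qed.

(** The integrand is the divergence of a periodic field. *)
Lemma green tau w phi : 0 < complex.Im tau ->
  periodic_off tau set0 w -> periodic_off tau set0 phi ->
  Ck 2 setT w -> Ck 2 setT phi ->
  torus_int tau (fun z => w z * laplacian phi z - phi z * laplacian w z) = 0.
Proof.
move=> t0 pw pp hw hp.
have oT : opened (@setT C) by move=> z _; exact: filterT.
have C1 u : Ck 2 setT u -> Ck 1 setT u.
  by move=> [cu [hd [cx [hx _ _]] [cy [hy _ _]]]]; split.
have hd u : Ck 2 setT u -> [/\ forall z, has_ddir 1 u z /\ has_ddir 'i u z,
    forall z, has_ddir 1 (dx u) z & forall z, has_ddir 'i (dy u) z].
  move=> [_ [h [_ [h1 _ _]] [_ [h2 _ _]]]]; split=> z; first exact: h.
    by have [] := h1 z I.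
  by have [] := h2 z I.
have Cx u : Ck 2 setT u -> Ck 1 setT (dx u) by move=> [_ [_ h _]]; exact: h.
have Cy u : Ck 2 setT u -> Ck 1 setT (dy u) by move=> [_ [_ _ h]]; exact: h.
have [hw1 hw2 hw3] := hd w hw; have [hp1 hp2 hp3] := hd phi hp.
have hasM e u v z : has_ddir e u z -> has_ddir e v z -> has_ddir e (fun y => u y * v y) z.
  exact: derivableM.
have hasN e u z : has_ddir e u z -> has_ddir e (fun y => - u y) z.
  exact: derivableN.
pose V1 z := w z * dx phi z + - (phi z * dx w z).
pose V2 z := w z * dy phi z + - (phi z * dy w z).
have CV1 : Ck 1 setT V1.
  exact: (CkD oT (CkM oT (C1 _ hw) (Cx _ hp)) (CkN oT (CkM oT (C1 _ hp) (Cx _ hw)))).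
have CV2 : Ck 1 setT V2.
  exact: (CkD oT (CkM oT (C1 _ hw) (Cy _ hp)) (CkN oT (CkM oT (C1 _ hp) (Cy _ hw)))).
have pV (a b : C -> R) : periodic_off tau set0 a -> periodic_off tau set0 b ->
    periodic_off tau set0 (fun z => w z * a z + - (phi z * b z)).
  move=> pa pb z n; have [-> ->] := pw z n; have [-> ->] := pp z n.
  by have [-> ->] := pa z n; have [-> ->] := pb z n.
have pV1 : periodic_off tau set0 V1 by apply: pV; exact: periodic_ddir.
have pV2 : periodic_off tau set0 V2 by apply: pV; exact: periodic_ddir.
have E1 z : dx V1 z = w z * dx (dx phi) z - phi z * dx (dx w) z.
  rewrite {1}/dx /V1 ddirD; first last.
  - by apply: hasN; apply: hasM; [exact: (hp1 z).1|exact: hw2].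
  - by apply: hasM; [exact: (hw1 z).1|exact: hp2].
  rewrite ddirN; last by apply: hasM; [exact: (hp1 z).1|exact: hw2].
  rewrite !ddirM; [|exact: (hp1 z).1|exact: hw2|exact: (hw1 z).1|exact: hp2].
  rewrite -!/(dx _); move: (w z) (phi z) (dx w z) (dx phi z) (dx (dx phi) z) (dx (dx w) z).
  by move=> *; ring.
have E2 z : dy V2 z = w z * dy (dy phi) z - phi z * dy (dy w) z.
  rewrite {1}/dy /V2 ddirD; first last.
  - by apply: hasN; apply: hasM; [exact: (hp1 z).2|exact: hw3].
  - by apply: hasM; [exact: (hw1 z).2|exact: hp3].
  rewrite ddirN; last by apply: hasM; [exact: (hp1 z).2|exact: hw3].
  rewrite !ddirM; [|exact: (hp1 z).2|exact: hw3|exact: (hw1 z).2|exact: hp3].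
  rewrite -!/(dy _); move: (w z) (phi z) (dy w z) (dy phi z) (dy (dy phi) z) (dy (dy w) z).
  by move=> *; ring.
have -> : (fun z => w z * laplacian phi z - phi z * laplacian w z) =
    (fun z => dx V1 z + dy V2 z).
  apply/funext => z; rewrite E1 E2 /laplacian.
  move: (w z) (phi z) (dx (dx phi) z) (dx (dx w) z) (dy (dy phi) z) (dy (dy w) z).
  by move=> *; ring.
have [_ [_ [cx _] _]] := CV1; have [_ [_ _ [cy _]]] := CV2.
have ix : torus_integrable tau (dx V1) by apply: torus_integrable_cont => z; exact: cx.
have iy : torus_integrable tau (dy V2) by apply: torus_integrable_cont => z; exact: cy.
have I1 := periodic_dx_integral pV1 CV1; have I2 := periodic_dy_integral t0 pV2 CV2.
apply: etrans (torus_intD ix iy) _; apply: etrans (congr2 +%R I1 I2) _.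
exact: addr0.
Qed.

Lemma discrete_opened (S : set C) : discrete S -> opened (~` S).
Proof.
move=> dS z Sz; have /dnbhscP[r r0 hr] := dS z; apply/nbhscP; exists r => // y yr.
by have [->|yz] := eqVneq y z; [exact: Sz|exact: hr].
Qed.

Lemma C2_laplacian_cvg u z : Ck 2 setT u -> {for z, continuous (laplacian u)}.
Proof.
move=> [_ [_ [_ [_ [c1 _] _]] [_ [_ _ [c2 _]]]]].
exact: (@cvgD R R C (nbhs z) _ _ _ _ _ (c1 z I) (c2 z I)).
Qed.

(** Green's identity moves the Laplacian from the test function to the correction
[w], which has no singularities and so leaves the point masses unchanged. *)
Lemma is_solution_add tau u w : 0 < complex.Im tau -> discrete (half_lattice tau) ->
  is_solution tau u -> periodic_off tau set0 w -> Ck 2 setT w ->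
  (forall z, ~ half_lattice tau z -> expR (u z + w z) = expR (u z) - laplacian w z) ->
  is_solution tau (fun z => u z + w z).
Proof.
move=> t0 dH [pu hu iu ieu du] pw hw E.
have cw z : {for z, continuous w} by have [cw _] := hw; exact: cw.
have cew z : {for z, continuous (fun y => expR (w y))}.
  by apply: (@cvg_comp _ _ _ w expR _ _ _ (cw z)); exact: continuous_expR.
have iv : torus_integrable tau (fun z => u z + w z).
  exact: (torus_integrableD iu (torus_integrable_cont _ cw)).
have iev : torus_integrable tau (fun z => expR (u z + w z)).
  have -> : (fun z => expR (u z + w z)) = (fun z => expR (u z) * expR (w z)).
    by apply/funext => z; rewrite expRD.
  exact: (torus_integrableM ieu cew).
split; first by move=> z hz; have [-> ->] := pu z hz; have [-> ->] := pw z (fun x => x).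
- exact: (CkD (discrete_opened dH) hu (Ck_sub (@subsetT _ _) hw)).
- exact: iv.
- exact: iev.
move=> phi [pphi sphi]; rewrite -(du phi (conj pphi sphi)).
have cphi z : {for z, continuous phi} by have [c _] := sphi 0%N; exact: c.
have clp z : {for z, continuous (laplacian phi)} := C2_laplacian_cvg (sphi 2%N).
have clw z : {for z, continuous (laplacian w)} := C2_laplacian_cvg hw.
have i1 : torus_integrable tau (fun z => (u z + w z) * laplacian phi z + expR (u z + w z) * phi z).
  exact: (torus_integrableD (torus_integrableM iv clp) (torus_integrableM iev cphi)).
have i2 : torus_integrable tau (fun z => u z * laplacian phi z + expR (u z) * phi z).
  exact: (torus_integrableD (torus_integrableM iu clp) (torus_integrableM ieu cphi)).
have i3 : torus_integrable tau (fun z => w z * laplacian phi z - phi z * laplacian w z).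
  apply: torus_integrable_cont => z.
  have c1 : (fun y => w y * laplacian phi y) @ z --> w z * laplacian phi z.
    exact: (@cvgM R C (nbhs z) _ _ _ _ _ (cw z) (clp z)).
  have c2 : (fun y => phi y * laplacian w y) @ z --> phi z * laplacian w z.
    exact: (@cvgM R C (nbhs z) _ _ _ _ _ (cphi z) (clw z)).
  exact: (@cvgB R R C (nbhs z) _ _ _ _ _ c1 c2).
have I3 := green t0 pw pphi hw (sphi 2%N).
apply: etrans (torus_int_off t0 i1 (torus_integrableD i2 i3) _) _.
  move=> z /E ->; move: (expR (u z)) (laplacian w z) (laplacian phi z) (phi z) (u z) (w z).
  by move=> *; ring.
apply: etrans (torus_intD i2 i3) _; apply: etrans (congr1 (fun x => _ + x) I3) _.
exact: addr0.
Qed.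

End Green.

(** * Sums over large squares of the lattice *)

Section Lattice.
Variable R : realType.
Local Notation C := R[i].
Variable tau : C.
Hypothesis tau0 : 0 < complex.Im tau.
Implicit Types (z w : C) (N m n : nat).
Local Notation lp := (lattice_point tau).

Definition lattK : R := 1 + (1 + `|complex.Re tau|) / complex.Im tau.

Lemma lattK_gt0 : 0 < lattK.
Proof. by rewrite /lattK ltr_pwDl // divr_ge0 ?addr_ge0 // ltW. Qed.

(** Since [tau] is not real, the modulus controls both coordinates, uniformly in
the point; discreteness of the lattice and the size of its distant points both
follow. *)
Lemma latt_coord (x y : R) : `|x| <= lattK * normc (x%:C + y%:C * tau) /\
  `|y| <= lattK * normc (x%:C + y%:C * tau).
Proof.
set w := x%:C + y%:C * tau.
have hI : complex.Im w = y * complex.Im tau.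
  by rewrite /w; case: tau => a b /=; ring.
have hR : complex.Re w = x + y * complex.Re tau.
  by rewrite /w; case: tau => a b /=; ring.
have nw : 0 <= normc w := normc_ge0 w.
have yb : `|y| <= normc w / complex.Im tau.
  by rewrite ler_pdivlMr // -[X in _ * X]gtr0_norm // -normrM -hI normc_geIm.
have xb : `|x| <= normc w + normc w / complex.Im tau * `|complex.Re tau|.
  have -> : x = complex.Re w - y * complex.Re tau by rewrite hR addrK.
  apply: le_trans (ler_normB _ _) _; rewrite lerD ?normc_geRe // normrM.
  by rewrite ler_wpM2r.
have i0 : 0 <= normc w / complex.Im tau by rewrite divr_ge0 // ltW.
have r0 : 0 <= normc w / complex.Im tau * `|complex.Re tau| by rewrite mulr_ge0.
have -> : lattK * normc w = normc w + (normc w / complex.Im tau +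
    normc w / complex.Im tau * `|complex.Re tau|).
  by rewrite /lattK; field; rewrite gt_eqF.
split; first by apply: le_trans xb _; rewrite lerD2l lerDr.
by apply: le_trans yb _; rewrite addrCA lerDl addr_ge0.
Qed.

Lemma half_lattice_sep z w : half_lattice tau z -> half_lattice tau w ->
  normc (z - w) < (2 * lattK)^-1 -> z = w.
Proof.
move=> [m [n E]] [m' [n' E']] zw.
have intC (k : int) : k%:~R = (k%:~R : R)%:C :> C by rewrite rmorph_int.
have D : ((m - m')%:~R : R)%:C + ((n - n')%:~R : R)%:C * tau = 2 * (z - w).
  by rewrite mulrBr E E' -!intC !intrB; ring.
have lt1 : lattK * normc (2 * (z - w)) < 1.
  rewrite normcM (normc_nat R 2); move: zw.
  by rewrite mulrA -ltr_pdivlMl ?mulr_gt0 ?lattK_gt0 // mulr1 [lattK * _]mulrC.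
have [h1 h2] := latt_coord (m - m')%:~R (n - n')%:~R.
have Z (k : int) : `|(k%:~R : R)| < 1 -> k = 0.
  rewrite -intr_norm -[1]/(1%:~R) ltr_int => h; apply/eqP; rewrite -normr_eq0.
  by rewrite -[_ == 0]/(`|k| == 0) eq_le normr_ge0 andbT -ltzD1.
rewrite D in h1 h2.
have /Z m0 := le_lt_trans h1 lt1; have /Z n0 := le_lt_trans h2 lt1.
move: D; rewrite m0 n0 mul0r addr0 => /esym/eqP.
by rewrite mulf_eq0 pnatr_eq0 /= subr_eq0 => /eqP.
Qed.

Lemma discrete_half_lattice : discrete (half_lattice tau).
Proof.
move=> z; set r := (4 * lattK)^-1.
have r0 : 0 < r by rewrite invr_gt0 mulr_gt0 // lattK_gt0.
have r2 : r + r = (2 * lattK)^-1.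
  by rewrite /r; field; rewrite gt_eqF // lattK_gt0.
have [[w [hw wz wr]]|no] := pselect (exists w, [/\ half_lattice tau w, w != z & normc (w - z) < r]).
  apply/dnbhscP; exists (normc (w - z)); first by rewrite normc_gt0 subr_eq0.
  move=> v vw vz hv; suff E : v = w by rewrite E ltxx in vw.
  apply: half_lattice_sep => //; rewrite -r2.
  have -> : v - w = (v - z) + - (w - z) by ring.
  by apply: le_lt_trans (le_normcD _ _) _; rewrite normcN ltrD // (lt_trans vw).
apply/dnbhscP; exists r => // w wr wz hw; apply: no; by exists w.
Qed.

Definition square_sum (f : C -> C) N : C := \sum_(m < (2 * N).+1) \sum_(n < (2 * N).+1) f (lp N m n).

Lemma square_sumB f g N : square_sum f N - square_sum g N = square_sum (fun w => f w - g w) N.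
Proof. by rewrite /square_sum -sumrB; apply: eq_bigr => m _; rewrite -sumrB. Qed.

Lemma eq_square_sum f g N : (forall w, f w = g w) -> square_sum f N = square_sum g N.
Proof. by move=> fg; apply: eq_bigr => m _; apply: eq_bigr => n _. Qed.

Lemma square_sumN f N : square_sum (fun w => - f w) N = - square_sum f N.
Proof. by rewrite /square_sum -sumrN; apply: eq_bigr => m _; rewrite -sumrN. Qed.

(** The squares are centred at the origin. *)
Lemma square_sum_opp f N : square_sum (fun w => f (- w)) N = square_sum f N.
Proof.
have H (k : nat) (i : 'I_(2 * k).+1) : (rev_ord i)%:R - k%:R = - (i%:R - k%:R) :> C.
  rewrite /= subSS natrB; last by rewrite -ltnS.
  by rewrite natrM; ring.
rewrite /square_sum [RHS](reindex_inj rev_ord_inj); apply: eq_bigr => m _.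
rewrite [RHS](reindex_inj rev_ord_inj); apply: eq_bigr => n _.
by congr f; rewrite /lattice_point !H; ring.
Qed.

Lemma lpE N m n : lp N m n = (m%:R - N%:R : R)%:C + (n%:R - N%:R : R)%:C * tau.
Proof. by rewrite /lattice_point !rmorphB !rmorph_nat. Qed.

Lemma lp_eq0 N m n : (lp N m n == 0) = (m == N) && (n == N).
Proof.
apply/eqP/andP => [|[/eqP -> /eqP ->]]; last by rewrite /lattice_point !subrr mul0r addr0.
rewrite lpE => E.
have [] := latt_coord (m%:R - N%:R) (n%:R - N%:R).
rewrite E normc0 mulr0 !normr_le0 !subr_eq0 !eqr_nat.
by [].
Qed.

(** The term at the origin, which the Weierstrass series treat apart, is absorbed
into the summand. *)
Lemma square_sum_origin f (c : C) N : square_sum (fun w => if w != 0 then f w else c) N =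
  c + square_sum (fun w => if w != 0 then f w else 0) N.
Proof.
apply/eqP; rewrite -subr_eq square_sumB; apply/eqP; rewrite /square_sum.
have Nlt : (N < (2 * N).+1)%N by rewrite ltnS leq_pmull.
rewrite (bigD1 (Ordinal Nlt)) //= (bigD1 (Ordinal Nlt)) //= lp_eq0 !eqxx /= subr0.
rewrite [X in _ + X + _]big1 ?addr0; last first.
  move=> i iN; rewrite lp_eq0 eqxx /=.
  by rewrite -val_eqE /= in iN; rewrite (negbTE iN) /= subrr.
rewrite big1 ?addr0 // => i iN; apply: big1 => j _; rewrite lp_eq0.
by rewrite -val_eqE /= in iN; rewrite (negbTE iN) /= subrr.
Qed.

Lemma square_sum_telescope_tau a N : square_sum (fun w => a (w - tau) - a w) N =
  \sum_(m < (2 * N).+1) (a (lp N m 0%N - tau) - a (lp N m (2 * N)%N)).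
Proof.
apply: eq_bigr => m _; pose A n := - a (lp N m n - tau).
have lpS n : lp N m n.+1 - tau = lp N m n by rewrite /lattice_point -natr1; ring.
rewrite -(big_mkord xpredT (fun n => a (lp N m n - tau) - a (lp N m n))).
rewrite (eq_bigr (fun n => A n.+1 - A n)); last by move=> n _; rewrite /A lpS; ring.
by rewrite telescope_sumr // /A lpS opprK addrC.
Qed.

Lemma square_sum_telescope_1 a N : square_sum (fun w => a (w - 1) - a w) N =
  \sum_(n < (2 * N).+1) (a (lp N 0%N n - 1) - a (lp N (2 * N)%N n)).
Proof.
rewrite /square_sum exchange_big /=; apply: eq_bigr => n _; pose A m := - a (lp N m n - 1).
have lpS m : lp N m.+1 n - 1 = lp N m n by rewrite /lattice_point -natr1; ring.
rewrite -(big_mkord xpredT (fun m => a (lp N m n - 1) - a (lp N m n))).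
rewrite (eq_bigr (fun m => A m.+1 - A m)); last by move=> m _; rewrite /A lpS; ring.
by rewrite telescope_sumr // /A lpS opprK addrC.
Qed.

Lemma latt_far (x y : R) N : N%:R <= `|x| \/ N%:R <= `|y| ->
  N%:R / lattK <= normc (x%:C + y%:C * tau).
Proof.
have [h1 h2] := latt_coord x y; rewrite ler_pdivrMr ?lattK_gt0 // mulrC.
by case=> h; [exact: le_trans h1|exact: le_trans h2].
Qed.

(** Translating a summand that decays quadratically changes the sum over a large
square only along two sides, whose contribution is of order [1 / N]. *)
Lemma square_sum_shift_cvg0 (e : C) a (B r : R) : (e = 1 \/ e = tau) -> 0 <= B ->
  (forall w, r <= normc w -> normc (a w) <= B / normc w ^+ 2) ->
  square_sum (fun w => a (w - e) - a w) @ \oo --> (0 : C).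
Proof.
move=> eE B0 ha.
have K0 := lattK_gt0.
have bnd w N : (0 < N)%N -> r <= N%:R / lattK -> N%:R / lattK <= normc w ->
    normc (a w) <= B * lattK ^+ 2 / N%:R ^+ 2.
  move=> N0 rN Nw; have Np : 0 < N%:R :> R by rewrite ltr0n.
  apply: le_trans (ha w (le_trans rN Nw)) _.
  have -> : B * lattK ^+ 2 / N%:R ^+ 2 = B / (N%:R / lattK) ^+ 2.
    by field; rewrite !gt_eqF.
  have q0 : 0 < N%:R / lattK by rewrite divr_gt0.
  rewrite ler_wpM2l // lef_pV2 ?posrE ?exprn_gt0 //; last exact: lt_le_trans Nw.
  by rewrite lerXn2r // nnegrE ltW // (lt_le_trans q0).
have sumb (F : nat -> C) N : (0 < N)%N -> (forall i, normc (F i) <= 2 * (B * lattK ^+ 2 / N%:R ^+ 2)) ->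
    normc (\sum_(i < (2 * N).+1) F i) <= 6 * B * lattK ^+ 2 / N%:R.
  move=> N0 hF; have Np : 0 < N%:R :> R by rewrite ltr0n.
  apply: le_trans (normc_sum _ _ _) _.
  apply: (@le_trans _ _ (\sum_(i < (2 * N).+1) 2 * (B * lattK ^+ 2 / N%:R ^+ 2))).
    by apply: ler_sum => i _.
  rewrite sumr_const card_ord -[leLHS]mulr_natr.
  have -> : 6 * B * lattK ^+ 2 / N%:R = 2 * (B * lattK ^+ 2 / N%:R ^+ 2) * (3 * N%:R).
    by field; rewrite gt_eqF.
  rewrite ler_wpM2l // ?mulr_ge0 ?divr_ge0 ?sqr_ge0 ?(ltW K0) //.
  have -> : 3 * N%:R = (3 * N)%:R :> R by rewrite natrM.
  by rewrite ler_nat; lia.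
have key N : (0 < N)%N -> r <= N%:R / lattK ->
    normc (square_sum (fun w => a (w - e) - a w) N) <= 6 * B * lattK ^+ 2 / N%:R.
  move=> N0 rN.
  have bnd2 w1 w2 : N%:R / lattK <= normc w1 -> N%:R / lattK <= normc w2 ->
      normc (a w1 - a w2) <= 2 * (B * lattK ^+ 2 / N%:R ^+ 2).
    move=> h1 h2; apply: le_trans (le_normcD _ _) _; rewrite normcN.
    have := bnd w1 N N0 rN h1; have := bnd w2 N N0 rN h2; lra.
  have far1 : N%:R <= `|(2 * N)%:R - N%:R : R|.
    by rewrite natrM mulr_natl mulr2n addrK normr_nat.
  have far0 : N%:R <= `|0%:R - N%:R - 1 : R|.
    have -> : 0%:R - N%:R - 1 = - (N%:R + 1) :> R by ring.
    by rewrite normrN ger0_norm ?addr_ge0 // lerDl.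
  case: eE => ->.
    rewrite square_sum_telescope_1.
    apply: (sumb (fun n => a (lp N 0%N n - 1) - a (lp N (2 * N)%N n)) N N0) => i; apply: bnd2.
      have -> : lp N 0 i - 1 = (0%:R - N%:R - 1 : R)%:C + (i%:R - N%:R : R)%:C * tau.
        by rewrite lpE !rmorphB /=; ring.
      by apply: latt_far; left.
    by rewrite lpE; apply: latt_far; left.
  rewrite square_sum_telescope_tau.
  apply: (sumb (fun m => a (lp N m 0%N - tau) - a (lp N m (2 * N)%N)) N N0) => i; apply: bnd2.
    have -> : lp N i 0 - tau = (i%:R - N%:R : R)%:C + (0%:R - N%:R - 1 : R)%:C * tau.
      by rewrite lpE !rmorphB /=; ring.
    by apply: latt_far; right.
  by rewrite lpE; apply: latt_far; right.
apply/(@cvgcP R nat \oo _) => eps eps0.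
pose c := 6 * B * lattK ^+ 2.
have c0 : 0 <= c by rewrite /c mulr_ge0 ?sqr_ge0 // mulr_ge0.
pose M := `|lattK * r| + c / eps.
have M0 : 0 <= M by rewrite addr_ge0 // divr_ge0 // ltW.
exists (Num.bound M) => // N /= MN; rewrite subr0.
have MN' : M < N%:R by apply: lt_le_trans (archi_boundP M0) _; rewrite ler_nat.
have Np : 0 < N%:R :> R by exact: le_lt_trans M0 MN'.
have N0 : (0 < N)%N by rewrite ltr0n in Np.
apply: le_lt_trans (key N N0 _) _.
  rewrite ler_pdivlMr // mulrC; apply: le_trans (ler_norm _) _; apply: ltW.
  by apply: le_lt_trans MN'; rewrite lerDl divr_ge0 // ltW.
rewrite -/c ltr_pdivrMr // mulrC -ltr_pdivrMr //.
by apply: le_lt_trans MN'; rewrite lerDr.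
Qed.

End Lattice.

(** * Weierstrass functions and the reflection of the potential *)

Section Weierstrass.
Variable R : realType.
Local Notation C := R[i].
Variable tau : C.
Hypothesis tau0 : 0 < complex.Im tau.
Implicit Types (z w e : C) (N m n : nat).
Local Notation lp := (lattice_point tau).
Local Notation Sq := (square_sum tau).
Local Notation K := (lattK tau).

(** Also for divergent sequences, since the limit operator then takes the same
default value on both sides. Hence the symmetries of [wp] need no convergence
proof, whereas those of [zeta], which involve sums of several values, do. *)
Lemma lim_eq (u v : nat -> C) : (fun N => u N - v N) @ \oo --> (0 : C) -> limn u = limn v.
Proof.
move=> uv; have E (f g : nat -> C) : (fun N => f N - g N) @ \oo --> (0 : C) ->
    forall l : C, g @ \oo --> l -> f @ \oo --> l.
  move=> fg l gl.
  have -> : f = (fun N => (f N - g N) + g N) by apply/funext => N; rewrite subrK.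
  by rewrite -[l]add0r; exact: (@cvgcD R nat \oo _ _ _ _ _ fg gl).
have vu : (fun N => v N - u N) @ \oo --> (0 : C).
  have := @cvgcN R nat \oo _ _ _ uv; rewrite oppr0.
  have -> : (fun t => - (u t - v t)) = (fun N => v N - u N).
    by apply/funext => N; rewrite opprB.
  by move=> h; exact: h.
rewrite /lim; congr (get _); apply/funext => l; apply/propext; split => h.
  exact: (E _ _ vu l h).
exact: (E _ _ uv l h).
Qed.

Definition wp_term z w : C := ((z - w) ^+ 2)^-1 - (w ^+ 2)^-1.
Definition zeta_term z w : C := (z - w)^-1 + w^-1 + z / w ^+ 2.
Definition wpN z N : C := Sq (fun w => if w != 0 then wp_term z w else (z ^+ 2)^-1) N.
Definition zetaN z N : C := Sq (fun w => if w != 0 then zeta_term z w else z^-1) N.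

Lemma wpNE z : wp tau z = limn (wpN z).
Proof.
rewrite /wp; congr (limn _); apply/funext => N; rewrite /wpN square_sum_origin //; congr (_ + _).
by apply: eq_bigr => m _; rewrite big_mkcond.
Qed.

Lemma zetaNE z : zeta tau z = limn (zetaN z).
Proof.
rewrite /zeta; congr (limn _); apply/funext => N; rewrite /zetaN square_sum_origin //; congr (_ + _).
by apply: eq_bigr => m _; rewrite big_mkcond.
Qed.

Lemma wp_even z : wp tau (- z) = wp tau z.
Proof.
rewrite !wpNE; congr (limn _); apply/funext => N; rewrite /wpN -square_sum_opp.
apply: eq_square_sum => w; rewrite oppr_eq0 sqrrN; case: ifP => // _.
rewrite /wp_term; have -> : - z - - w = - (z - w) by ring.
by rewrite !sqrrN.
Qed.

Lemma zetaN_odd z N : zetaN (- z) N = - zetaN z N.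
Proof.
rewrite /zetaN -square_sum_opp -square_sumN; apply: eq_square_sum => w; rewrite oppr_eq0.
case: ifP => // w0; last by rewrite invrN.
rewrite /zeta_term sqrrN opprK mulNr invrN.
have -> : - z + w = - (z - w) by ring.
by rewrite invrN; ring.
Qed.

Lemma far_half z w : 2 * normc z <= normc w -> normc w / 2 <= normc (z - w).
Proof. by move=> h; have := ler_normcB w z; rewrite (normcB w z); lra. Qed.

(** Translating [z] by a period translates the summation index. *)
Lemma wp_periodic e z : e = 1 \/ e = tau -> wp tau (z + e) = wp tau z.
Proof.
move=> eE; rewrite !wpNE; apply: lim_eq.
pose a w := ((z - w) ^+ 2)^-1.
have -> : (fun N => wpN (z + e) N - wpN z N) = Sq (fun w => a (w - e) - a w).
  apply/funext => N; rewrite /wpN square_sumB; apply: eq_square_sum => w; rewrite /a /wp_term.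
  have -> : z - (w - e) = z + e - w by ring.
  by case: eqP => [->|_] /=; [rewrite !subr0|ring].
apply: (square_sum_shift_cvg0 tau0 (B := 4) (r := 2 * normc z + 1)) eE _ _ => //.
move=> w hw; have w0 : 0 < normc w.
  by apply: lt_le_trans hw; rewrite ltr_wpDl // mulr_ge0 // normc_ge0.
have := @far_half z w; rewrite /a normcV normcX => h.
have {}h : normc w / 2 <= normc (z - w) by apply: h; lra.
have -> : 4 / normc w ^+ 2 = ((normc w / 2) ^+ 2)^-1 by field; rewrite gt_eqF.
rewrite lef_pV2 ?posrE ?exprn_gt0 ?divr_gt0 //; last by apply: lt_le_trans h; rewrite divr_gt0.
by rewrite lerXn2r ?nnegrE ?normc_ge0 // divr_ge0 // ltW.
Qed.

Lemma big_square_shell (G : nat -> nat -> C) k :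
  \sum_(m < k.+2) \sum_(n < k.+2) G m n = \sum_(m < k) \sum_(n < k) G m.+1 n.+1 +
   (\sum_(n < k.+2) G 0%N n + \sum_(n < k.+2) G k.+1 n +
    \sum_(m < k) (G m.+1 0%N + G m.+1 k.+1)).
Proof.
have row (H : nat -> C) : \sum_(n < k.+2) H n = H 0%N + \sum_(n < k) H n.+1 + H k.+1.
  by rewrite big_ord_recl big_ord_recr /= addrA.
rewrite (row (fun m => \sum_(n < k.+2) G m n)).
have -> : \sum_(m < k) \sum_(n < k.+2) G m.+1 n =
    \sum_(m < k) \sum_(n < k) G m.+1 n.+1 + \sum_(m < k) (G m.+1 0%N + G m.+1 k.+1).
  by rewrite -big_split; apply: eq_bigr => m _ /=; rewrite row; ring.
by ring.
Qed.

Lemma zeta_term_bound z w : 2 * normc z + 1 <= normc w ->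
  normc (zeta_term z w) <= 2 * normc z ^+ 2 / normc w ^+ 3.
Proof.
move=> hw; have w0 : 0 < normc w.
  by apply: lt_le_trans hw; rewrite ltr_wpDl // mulr_ge0 // normc_ge0.
have h : normc w / 2 <= normc (z - w) by apply: far_half; lra.
have wn0 : w != 0 by rewrite -normc_gt0.
have zw0 : 0 < normc (z - w) by apply: lt_le_trans h; rewrite divr_gt0.
have zwn0 : z - w != 0 by rewrite -normc_gt0.
have -> : zeta_term z w = z ^+ 2 / (w ^+ 2 * (z - w)).
  by rewrite /zeta_term; field; rewrite wn0 zwn0.
rewrite normcM normcV normcM !normcX.
have -> : 2 * normc z ^+ 2 / normc w ^+ 3 = normc z ^+ 2 / (normc w ^+ 2 * (normc w / 2)).
  by field; rewrite gt_eqF.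
rewrite ler_wpM2l ?sqr_ge0 // lef_pV2 ?posrE ?mulr_gt0 ?exprn_gt0 ?divr_gt0 //.
by rewrite ler_wpM2l // sqr_ge0.
Qed.

Lemma cvg_inv_sqr_series : cvgn (series (fun n => (n.+1%:R ^+ 2)^-1 : R)).
Proof.
pose v n : R := 2 * (n.+1%:R^-1 - n.+2%:R^-1).
apply: (@series_le_cvg _ _ v).
- by move=> n; rewrite invr_ge0 sqr_ge0.
- move=> n; rewrite mulr_ge0 // subr_ge0 lef_pV2 ?posrE ?ltr0n // ler_nat //.
- move=> n; have p1 : 0 < n.+1%:R :> R by rewrite ltr0n.
  have -> : v n = 2 / (n.+1%:R * n.+2%:R).
    have -> : n.+2%:R = n.+1%:R + 1 :> R by rewrite natr1.
    rewrite /v -[n.+2%:R]natr1; move: n.+1%:R p1 => x x0; field.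
    by rewrite !gt_eqF // addr_gt0.
  rewrite ler_pdivlMr ?mulr_gt0 ?ltr0n // mulrC ler_pdivrMr ?exprn_gt0 //.
  have x1 : 1 <= n.+1%:R :> R by rewrite ler1n.
  have -> : n.+2%:R = n.+1%:R + 1 :> R by rewrite natr1.
  by move: n.+1%:R x1 => x x1; nra.
have -> : series v = (fun n => 2 * (1 - n.+1%:R^-1)).
  apply/funext => n; rewrite /series /=; elim: n => [|n IH].
    by rewrite big_nil invr1 subrr mulr0.
  by rewrite big_nat_recr //= IH /v; ring.
apply/cvg_ex; exists (2 * (1 - 0)); apply: cvgM; first exact: cvg_cst.
apply: cvgB; first exact: cvg_cst.
exact: cvg_harmonic.
Qed.

(** The shell of index [N] contains a number of points of order [N], each with a
term of order [N ^- 3]; the increments are therefore summable. *)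
Lemma zetaN_cvg z : exists l : C, zetaN z @ \oo --> l.
Proof.
have K0 := lattK_gt0 tau0.
pose f w := if w != 0 then zeta_term z w else z^-1.
pose D N := zetaN z N.+1 - zetaN z N.
(* The shell has 8 (N + 1) points at distance at least (N + 1) / K, and the
   bound on a term carries a factor 2. *)
pose A := 16 * normc z ^+ 2 * K ^+ 3.
have A0 : 0 <= A by apply: mulr_ge0; [rewrite mulr_ge0 ?sqr_ge0|rewrite exprn_ge0 // ltW].
have bnd N : 2 * normc z + 1 <= N.+1%:R / K -> normc (D N) <= A / N.+1%:R ^+ 2.
  move=> hN; have Np : 0 < N.+1%:R :> R by rewrite ltr0n.
  pose beta := 2 * normc z ^+ 2 * K ^+ 3 / N.+1%:R ^+ 3.
  have far w : N.+1%:R / K <= normc w -> normc (f w) <= beta.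
    move=> hw; have w1 : 2 * normc z + 1 <= normc w := le_trans hN hw.
    have q0 : 0 < N.+1%:R / K by rewrite divr_gt0.
    have w0 : 0 < normc w := lt_le_trans q0 hw.
    rewrite /f -normc_gt0 w0; apply: le_trans (zeta_term_bound w1) _.
    have -> : beta = 2 * normc z ^+ 2 / (N.+1%:R / K) ^+ 3.
      by rewrite /beta; field; rewrite !gt_eqF.
    rewrite ler_wpM2l ?mulr_ge0 ?normc_ge0 // lef_pV2 ?posrE ?exprn_gt0 //.
    by rewrite lerXn2r // nnegrE ltW.
  have sumb (F : nat -> C) (k : nat) (b : R) : (forall i, normc (F i) <= b) ->
      normc (\sum_(i < k) F i) <= k%:R * b.
    move=> hF; apply: le_trans (normc_sum _ _ _) _.
    apply: (@le_trans _ _ (\sum_(i < k) b)); first by apply: ler_sum => i _.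
    by rewrite sumr_const card_ord mulr_natl.
  have far0 : N.+1%:R <= `|0%:R - N.+1%:R : R| by rewrite sub0r normrN normr_nat.
  have far1 : N.+1%:R <= `|(2 * N).+2%:R - N.+1%:R : R|.
    have -> : (2 * N).+2%:R - N.+1%:R = N.+1%:R :> R.
      by rewrite -natrB; [congr (_%:R)|]; lia.
    by rewrite normr_nat.
  have DE : D N = \sum_(n < (2 * N).+3) f (lp N.+1 0%N n) +
       \sum_(n < (2 * N).+3) f (lp N.+1 (2 * N).+2 n) +
       \sum_(m < (2 * N).+1) (f (lp N.+1 m.+1 0%N) + f (lp N.+1 m.+1 (2 * N).+2)).
    rewrite /D /zetaN /square_sum -/f (_ : (2 * N.+1).+1 = (2 * N).+3); last by lia.
    rewrite (big_square_shell (fun m n => f (lp N.+1 m n))).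
    have -> : \sum_(m < (2 * N).+1) \sum_(n < (2 * N).+1) f (lp N.+1 m.+1 n.+1) =
       \sum_(m < (2 * N).+1) \sum_(n < (2 * N).+1) f (lp N m n).
      apply: eq_bigr => m _; apply: eq_bigr => n _; congr f.
      by rewrite /lattice_point -!natr1; ring.
    by rewrite addrC addKr.
  have h1 : normc (\sum_(n < (2 * N).+3) f (lp N.+1 0%N n)) <= (2 * N).+3%:R * beta.
    apply: (sumb (fun n => f (lp N.+1 0%N n))) => n; apply: far; rewrite lpE.
    by apply: latt_far => //; left.
  have h2 : normc (\sum_(n < (2 * N).+3) f (lp N.+1 (2 * N).+2 n)) <= (2 * N).+3%:R * beta.
    apply: (sumb (fun n => f (lp N.+1 (2 * N).+2 n))) => n; apply: far; rewrite lpE.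
    by apply: latt_far => //; left.
  have h3 : normc (\sum_(m < (2 * N).+1) (f (lp N.+1 m.+1 0%N) + f (lp N.+1 m.+1 (2 * N).+2)))
      <= (2 * N).+1%:R * (beta + beta).
    apply: (sumb (fun m => f (lp N.+1 m.+1 0%N) + f (lp N.+1 m.+1 (2 * N).+2))) => m.
    apply: le_trans (le_normcD _ _) _; apply: lerD; apply: far; rewrite lpE.
      by apply: latt_far => //; right.
    by apply: latt_far => //; right.
  rewrite DE; apply: le_trans (le_normcD _ _) _.
  apply: le_trans (lerD (le_trans (le_normcD _ _) (lerD h1 h2)) h3) _.
  have -> : A / N.+1%:R ^+ 2 = 8 * N.+1%:R * beta.
    by rewrite /A /beta; field; rewrite gt_eqF.
  rewrite le_eqVlt; apply/orP; left; apply/eqP.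
  by rewrite -!natr1 natrM; ring.
pose N0 := Num.bound ((2 * normc z + 1) * K).
have N0P N : (N0 <= N)%N -> 2 * normc z + 1 <= N.+1%:R / K.
  move=> h; rewrite ler_pdivlMr //; apply: ltW.
  have p0 : 0 <= (2 * normc z + 1) * K.
    by apply: mulr_ge0; [rewrite addr_ge0 // mulr_ge0 // normc_ge0|exact: ltW].
  apply: lt_le_trans (archi_boundP p0) _; rewrite ler_nat; exact: leqW.
pose B := A + \sum_(i < N0) normc (D i) * i.+1%:R ^+ 2.
have Bi (i : 'I_N0) : 0 <= normc (D i) * i.+1%:R ^+ 2 by apply: mulr_ge0; [exact: normc_ge0|exact: sqr_ge0].
have bnd' N : normc (D N) <= B * (N.+1%:R ^+ 2)^-1.
  rewrite ler_pdivlMr ?exprn_gt0 ?ltr0n //.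
  have [NN0|N0N] := ltnP N N0.
    by rewrite /B (bigD1 (Ordinal NN0)) //= addrCA lerDl addr_ge0 // sumr_ge0.
  rewrite -ler_pdivlMr ?exprn_gt0 ?ltr0n //; apply: le_trans (bnd N (N0P N N0N)) _.
  by rewrite ler_wpM2r ?invr_ge0 ?sqr_ge0 // /B lerDl sumr_ge0.
have cv : cvgn (series (fun n => B * (n.+1%:R ^+ 2)^-1)).
  by apply: is_cvg_seriesZ; exact: cvg_inv_sqr_series.
have [l hl _] := cseries_dom bnd' cv.
have gen (c : C) (v : nat -> C) : v @ \oo --> l -> (fun N => c + v N) @ \oo --> c + l.
  by move=> vl; exact: (@cvgcD R nat \oo _ _ _ _ _ (@cvgc_cst R nat \oo _ c) vl).
have E (c : C) : c = zetaN z 0%N -> zetaN z = (fun N => c + series D N).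
  by move=> ->; apply/funext => N; rewrite /series /= /D telescope_sumr // addrC subrK.
exists (zetaN z 0%N + l); move: (E _ erefl); move: (zetaN z 0%N) => c ->.
exact: gen hl.
Qed.

Lemma zeta_cvg z : zetaN z @ \oo --> zeta tau z.
Proof.
have [l hl] := zetaN_cvg z; rewrite zetaNE.
suff -> : limn (zetaN z) = l by exact: hl.
by apply: cvg_lim => //; exact: norm_hausdorff.
Qed.

Lemma zeta_odd z : zeta tau (- z) = - zeta tau z.
Proof.
have h1 := @zeta_cvg (- z).
have h2 : zetaN (- z) @ \oo --> - zeta tau z.
  have -> : zetaN (- z) = (fun N => - zetaN z N) by apply/funext => N; exact: zetaN_odd.
  exact: (@cvgcN R nat \oo _ _ _ (@zeta_cvg z)).
exact: (@cvgc_uniq R nat \oo (zetaN (- z)) _ _ _ h1 h2).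
Qed.

(** The difference of the two sides is the effect of a translation on the sum of
[(z - w)^-1 - (z' - w)^-1], which decays quadratically. *)
Lemma zeta_quasi e z z' : e = 1 \/ e = tau ->
  zeta tau (z + e) - zeta tau z = zeta tau (z' + e) - zeta tau z'.
Proof.
move=> eE; apply/eqP; rewrite -subr_eq0; apply/eqP.
pose a w := (z - w)^-1 - (z' - w)^-1.
have E : (fun N => (zetaN (z + e) N - zetaN z N) - (zetaN (z' + e) N - zetaN z' N)) =
    Sq (fun w => a (w - e) - a w).
  apply/funext => N; rewrite /zetaN !square_sumB; apply: eq_square_sum => w; rewrite /a /zeta_term.
  have -> : z - (w - e) = z + e - w by ring.
  have -> : z' - (w - e) = z' + e - w by ring.
  by case: eqP => [->|_] /=; [rewrite !subr0; ring|ring].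
have h1 : Sq (fun w => a (w - e) - a w) @ \oo -->
    (zeta tau (z + e) - zeta tau z) - (zeta tau (z' + e) - zeta tau z').
  rewrite -E; apply: (@cvgcB R nat \oo _); apply: (@cvgcB R nat \oo _); exact: zeta_cvg.
apply: (@cvgc_uniq R nat \oo _ _ _ _ h1).
apply: (square_sum_shift_cvg0 tau0 (B := 4 * normc (z' - z)) (r := 2 * normc z + 2 * normc z' + 1)) eE _ _.
  by rewrite mulr_ge0 // normc_ge0.
move=> w hw.
have nz := normc_ge0 z; have nz' := normc_ge0 z'.
have w0 : 0 < normc w by apply: lt_le_trans hw; rewrite ltr_wpDl // addr_ge0 ?mulr_ge0.
have h : normc w / 2 <= normc (z - w) by apply: far_half; lra.
have h' : normc w / 2 <= normc (z' - w) by apply: far_half; lra.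
have zw0 : 0 < normc (z - w) by apply: lt_le_trans h; rewrite divr_gt0.
have zw0' : 0 < normc (z' - w) by apply: lt_le_trans h'; rewrite divr_gt0.
have -> : a w = (z' - z) / ((z - w) * (z' - w)).
  by rewrite /a; field; rewrite -!normc_gt0 zw0 zw0'.
rewrite normcM normcV normcM.
have -> : 4 * normc (z' - z) / normc w ^+ 2 = normc (z' - z) / ((normc w / 2) * (normc w / 2)).
  by field; rewrite gt_eqF.
rewrite ler_wpM2l ?normc_ge0 // lef_pV2 ?posrE ?mulr_gt0 ?divr_gt0 //.
by apply: ler_pM => //; rewrite divr_ge0 // ltW.
Qed.

Lemma q_expand l T z : q tau l T z =
  3 / 4 * (wp tau (z - 0 / 2) + wp tau (z - 1 / 2) + wp tau (z - tau / 2) +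
           wp tau (z - (1 + tau) / 2)) +
  T * (eps R l 0 * zeta tau (z - 0 / 2) + eps R l 1 * zeta tau (z - 1 / 2) +
       eps R l 2 * zeta tau (z - tau / 2) + eps R l 3 * zeta tau (z - (1 + tau) / 2)) +
  T ^+ 2 - Defs.eta tau (3 - l)%N * T.
Proof. by rewrite /q !big_ord_recr !big_ord0 /= !add0r. Qed.

(** The reflection exchanges the half-periods in two pairs. As [j <> l], each pair
consists of half-periods of opposite signs, which compensates for the oddness of
[zeta]; the quasi-periods that appear cancel. *)
Lemma q_reflect j l T z : (1 <= j <= 3)%N -> (1 <= l <= 3)%N -> j <> l ->
  q tau l T (omega tau j / 2 - z) = q tau l T z.
Proof.
have [e1 et] : (1 = 1 :> C \/ 1 = tau) /\ (tau = 1 \/ tau = tau) by split; [left|right].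
have [h1 h1E] : exists h1, forall w, zeta tau (w + 1) = zeta tau w + h1.
  exists (zeta tau (0 + 1) - zeta tau 0) => w.
  by rewrite -(zeta_quasi w 0 e1) [zeta tau w + _]addrC subrK.
have [ht htE] : exists ht, forall w, zeta tau (w + tau) = zeta tau w + ht.
  exists (zeta tau (0 + tau) - zeta tau 0) => w.
  by rewrite -(zeta_quasi w 0 et) [zeta tau w + _]addrC subrK.
have p1 w : wp tau (w + 1) = wp tau w by exact: wp_periodic.
have pt w : wp tau (w + tau) = wp tau w by exact: wp_periodic.
have refl (a b c : C) : a - b = - (z - c) ->
    zeta tau (a - b) = - zeta tau (z - c) /\ wp tau (a - b) = wp tau (z - c).
  by move=> ->; rewrite zeta_odd wp_even.
have refl1 (a b c : C) : a - b = - (z - c + 1) ->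
    zeta tau (a - b) = - (zeta tau (z - c) + h1) /\ wp tau (a - b) = wp tau (z - c).
  by move=> ->; rewrite zeta_odd wp_even h1E p1.
have reflt (a b c : C) : a - b = - (z - c + tau) ->
    zeta tau (a - b) = - (zeta tau (z - c) + ht) /\ wp tau (a - b) = wp tau (z - c).
  by move=> ->; rewrite zeta_odd wp_even htE pt.
have j1 : [/\ zeta tau (1 / 2 - z - 0 / 2) = - zeta tau (z - 1 / 2) /\
     wp tau (1 / 2 - z - 0 / 2) = wp tau (z - 1 / 2),
   zeta tau (1 / 2 - z - 1 / 2) = - zeta tau (z - 0 / 2) /\
     wp tau (1 / 2 - z - 1 / 2) = wp tau (z - 0 / 2),
   zeta tau (1 / 2 - z - tau / 2) = - (zeta tau (z - (1 + tau) / 2) + ht) /\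
     wp tau (1 / 2 - z - tau / 2) = wp tau (z - (1 + tau) / 2) &
   zeta tau (1 / 2 - z - (1 + tau) / 2) = - (zeta tau (z - tau / 2) + ht) /\
     wp tau (1 / 2 - z - (1 + tau) / 2) = wp tau (z - tau / 2)].
  by split; [apply: refl|apply: refl|apply: reflt|apply: reflt]; field.
have j2 : [/\ zeta tau (tau / 2 - z - 0 / 2) = - zeta tau (z - tau / 2) /\
     wp tau (tau / 2 - z - 0 / 2) = wp tau (z - tau / 2),
   zeta tau (tau / 2 - z - 1 / 2) = - (zeta tau (z - (1 + tau) / 2) + h1) /\
     wp tau (tau / 2 - z - 1 / 2) = wp tau (z - (1 + tau) / 2),
   zeta tau (tau / 2 - z - tau / 2) = - zeta tau (z - 0 / 2) /\
     wp tau (tau / 2 - z - tau / 2) = wp tau (z - 0 / 2) &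
   zeta tau (tau / 2 - z - (1 + tau) / 2) = - (zeta tau (z - 1 / 2) + h1) /\
     wp tau (tau / 2 - z - (1 + tau) / 2) = wp tau (z - 1 / 2)].
  by split; [apply: refl|apply: refl1|apply: refl|apply: refl1]; field.
have j3 : [/\ zeta tau ((1 + tau) / 2 - z - 0 / 2) = - zeta tau (z - (1 + tau) / 2) /\
     wp tau ((1 + tau) / 2 - z - 0 / 2) = wp tau (z - (1 + tau) / 2),
   zeta tau ((1 + tau) / 2 - z - 1 / 2) = - zeta tau (z - tau / 2) /\
     wp tau ((1 + tau) / 2 - z - 1 / 2) = wp tau (z - tau / 2),
   zeta tau ((1 + tau) / 2 - z - tau / 2) = - zeta tau (z - 1 / 2) /\
     wp tau ((1 + tau) / 2 - z - tau / 2) = wp tau (z - 1 / 2) &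
   zeta tau ((1 + tau) / 2 - z - (1 + tau) / 2) = - zeta tau (z - 0 / 2) /\
     wp tau ((1 + tau) / 2 - z - (1 + tau) / 2) = wp tau (z - 0 / 2)].
  by split; apply: refl; field.
move=> jr lr jl; rewrite !q_expand.
have e0 : eps R l 0 = 1 by [].
case: j jr jl => [|[|[|[|j]]]] // _ jl.
- have [ej ek] : eps R l 1 = -1 /\ eps R l 3 = - eps R l 2.
    by case: l lr jl {e0} => [|[|[|[|l]]]] //; rewrite /eps /= opprK.
  rewrite e0 ej ek; case: j1 => [[-> ->] [-> ->] [-> ->] [-> ->]].
  by move: (Defs.eta _ _) (eps _ _ _) => *; ring.
- have [ej ek] : eps R l 2 = -1 /\ eps R l 3 = - eps R l 1.
    by case: l lr jl {e0} => [|[|[|[|l]]]] //; rewrite /eps /= opprK.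
  rewrite e0 ej ek; case: j2 => [[-> ->] [-> ->] [-> ->] [-> ->]].
  by move: (Defs.eta _ _) (eps _ _ _) => *; ring.
- have [ej ek] : eps R l 3 = -1 /\ eps R l 2 = - eps R l 1.
    by case: l lr jl {e0} => [|[|[|[|l]]]] //; rewrite /eps /= opprK.
  rewrite e0 ej ek; case: j3 => [[-> ->] [-> ->] [-> ->] [-> ->]].
  by move: (Defs.eta _ _) (eps _ _ _) => *; ring.
Qed.

End Weierstrass.

(** * Liouville's formula and the Schwarzian derivative *)

Section Schwarzian.
Variable R : realType.
Local Notation C := R[i].
Implicit Types (f g h : C -> C) (z w : C) (S : set C).

Lemma analytic_eq f g z : (\forall w \near z, f w = g w) -> analytic_at f z -> analytic_at g z.
Proof.
move=> fg [a fa]; exists a.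
have H : \forall w \near z, f w = g w /\ series (fun k => a k * (w - z) ^+ k) @ \oo --> f w.
  exact: (filterI fg fa).
by apply: filterS H => w [<-].
Qed.

Lemma analytic_derive1 f z : analytic_at f z ->
  cder f z (derive1 f z) /\ analytic_at (derive1 f) z.
Proof.
move=> /analytic_cder[f' ff' af'].
have E : \forall w \near z, f' w = derive1 f w.
  by apply: filterS ff' => w /cder_derive1.
by split; [rewrite -(nbhs_singleton E); exact: (nbhs_singleton ff')|exact: analytic_eq E af'].
Qed.

Definition schwarzian (h1 h2 h3 : C) : C := h3 / h1 - 3 / 2 * (h2 / h1) ^+ 2.

Lemma normc2_gt0 z : 0 < 1 + normc z ^+ 2.
Proof. by rewrite ltr_wpDr // sqr_ge0. Qed.

Lemma one_add_normc2 z : 1 + z * z^* != 0 :> C.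
Proof.
rewrite -sqr_normcE -(rmorph1 (real_complex R)) -rmorphD.
by rewrite real_complex_eq0 gt_eqF // normc2_gt0.
Qed.

Lemma conj_neq0 z : z != 0 -> z^* != 0.
Proof. by rewrite conjc_eq0. Qed.

Lemma dz_eq f g z : (\forall w \near z, f w = g w) -> dz f z = dz g z.
Proof.
move=> fg; rewrite /dz /dx /dy.
have E1 : \forall w \near z, complex.Re (f w) = complex.Re (g w).
  by apply: filterS fg => w ->.
have E2 : \forall w \near z, complex.Im (f w) = complex.Im (g w).
  by apply: filterS fg => w ->.
by rewrite !(ddir_eq _ E1) !(ddir_eq _ E2).
Qed.

Lemma wd_normc2 k (d : C) z : cder k z d ->
  wd (fun w => k w * (k w)^*) z (d * (k z)^*) (k z * d^*).
Proof.
move=> kd; have := wdM (wd_cder kd) (wdJ (wd_cder kd)).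
by rewrite rmorph0 !mulr0 mul0r addr0 add0r.
Qed.

Lemma wd_one_add_normc2 h (d : C) z : cder h z d ->
  wd (fun w => 1 + h w * (h w)^*) z (d * (h z)^*) (h z * d^*).
Proof. by move=> hd; have := wdD (wd_cst 1 z) (wd_normc2 hd); rewrite !add0r. Qed.

Definition liouville (h1 h : C) : R := ln (8 * normc h1 ^+ 2 / (1 + normc h ^+ 2) ^+ 2).

(** The two derivatives are conjugate, as those of a real function. *)
Lemma wd_liouville h h1 h2 z : cder h z (h1 z) -> cder h1 z (h2 z) -> h1 z != 0 ->
  let A := h2 z / h1 z - 2 * (h z)^* * h1 z / (1 + h z * (h z)^*) in
  let B := (h2 z)^* / (h1 z)^* - 2 * h z * (h1 z)^* / (1 + h z * (h z)^*) in
  wd (fun w => (liouville (h1 w) (h w))%:C) z A B.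
Proof.
move=> dh dh1 h10 A B.
have N0 := one_add_normc2 (h z).
have wN := wd_one_add_normc2 dh.
have X0 : 0 < 8 * normc (h1 z) ^+ 2 / (1 + normc (h z) ^+ 2) ^+ 2.
  have p1 : 0 < normc (h1 z) by rewrite normc_gt0.
  have p2 := normc2_gt0 (h z).
  by rewrite divr_gt0 // ?mulr_gt0 // exprn_gt0.
have XE w : (8 * normc (h1 w) ^+ 2 / (1 + normc (h w) ^+ 2) ^+ 2)%:C =
    8 * (h1 w * (h1 w)^*) * ((1 + h w * (h w)^*)^-1 * (1 + h w * (h w)^*)^-1).
  rewrite -!sqr_normcE (expr2 (1 + normc (h w) ^+ 2)) invfM.
  move: (normc (h1 w) ^+ 2) (normc (h w) ^+ 2) => x y.
  have e8 : (8 : R)%:C = 8 :> C by rewrite rmorph_nat.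
  have e1 : (1 + y)%:C = 1 + y%:C :> C by rewrite rmorphD rmorph1.
  by rewrite -e8 -e1 !(rmorphM (real_complex R)) !(fmorphV (real_complex R)).
have wV := @wdV R (fun w => 1 + h w * (h w)^*) z _ _ N0 wN.
have wX := wdM (wdM (wd_cst 8 z) (wdM (wd_cder dh1) (wdJ (wd_cder dh1)))) (wdM wV wV).
have E : (fun w => 8 * (h1 w * (h1 w)^*) * ((1 + h w * (h w)^*)^-1 * (1 + h w * (h w)^*)^-1)) =
    (fun w => (8 * normc (h1 w) ^+ 2 / (1 + normc (h w) ^+ 2) ^+ 2)%:C).
  by apply/funext => w; rewrite XE.
have wX' := wX; rewrite E in wX'.
have := wd_ln X0 wX'; rewrite XE /A /B.
have c10 := conj_neq0 h10.
rewrite !rmorph0 !mul0r !mulr0 !add0r !addr0.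
have key (F : C -> C) a b a' b' : a = a' -> b = b' -> wd F z a b -> wd F z a' b' by move=> -> ->.
apply: key.
all: move: h10 c10 N0 {A B wN wX wV wX' E XE X0 dh dh1}; move: (h z)^* (h1 z)^* (h2 z)^* (h z) (h1 z) (h2 z).
all: by move=> a b c a' b' c' *; field; apply/and3P.
Qed.

(** The terms that involve the conjugate of [h] cancel in the potential. *)
Lemma potential_schwarzian u h h1 h2 (s3 : C) z :
  (\forall w \near z, [/\ cder h w (h1 w), cder h1 w (h2 w), h1 w != 0 &
     u w = liouville (h1 w) (h w)]) -> cder h2 z s3 ->
  potential u z = - (1 / 2) * schwarzian (h1 z) (h2 z) s3.
Proof.
move=> hyp dh2; have [dh dh1 h10 uz] := nbhs_singleton hyp.
pose A w := h2 w / h1 w - 2 * (h w)^* * h1 w / (1 + h w * (h w)^*).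
have E : \forall w \near z, dz (fun w => (u w)%:C) w = A w.
  have H : \forall w \near z, \forall v \near w, u v = liouville (h1 v) (h v).
    have H1 : \forall w \near z, u w = liouville (h1 w) (h w).
      by apply: filterS hyp => w [].
    move/nbhscP: H1 => [r r0 hr]; apply/nbhscP; exists r => // w wr.
    by apply: filterS (cball_open wr) => v /hr.
  have H2 : \forall w \near z, [/\ cder h w (h1 w), cder h1 w (h2 w), h1 w != 0 &
     u w = liouville (h1 w) (h w)] /\ \forall v \near w, u v = liouville (h1 v) (h v).
    exact: (filterI hyp H).
  apply: filterS H2 => w [[a1 a2 a3 _] a4].
  have a5 : \forall v \near w, (u v)%:C = (liouville (h1 v) (h v))%:C.
    by apply: filterS a4 => v ->.
  by rewrite (dz_eq a5) (dz_wd (wd_liouville a1 a2 a3)).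
rewrite /potential (dz_eq E) (nbhs_singleton E).
have N0 := one_add_normc2 (h z).
have wN := wd_one_add_normc2 dh.
have wV := @wdV R (fun w => 1 + h w * (h w)^*) z _ _ N0 wN.
have wA := wdB (wdM (wd_cder dh2) (wd_cder (cderV h10 dh1)))
  (wdM (wdM (wdM (wd_cst 2 z) (wdJ (wd_cder dh))) (wd_cder dh1)) wV).
rewrite (dz_wd wA) /A /schwarzian !rmorph0 !mul0r !mulr0 !add0r.
move: h10 N0 {A E hyp uz dh dh1 dh2 wA wV wN}; move: (h z)^* (h1 z)^* (h z) (h1 z) (h2 z).
by move=> a b a' b' c' *; field; apply/andP.
Qed.

(** * Functions with the same Schwarzian derivative *)

Lemma exp_liouville (h1 h : C) : h1 != 0 ->
  expR (liouville h1 h) = 8 * normc h1 ^+ 2 / (1 + normc h ^+ 2) ^+ 2.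
Proof.
move=> h10; rewrite /liouville lnK // posrE.
have p1 : 0 < normc h1 by rewrite normc_gt0.
have p2 := normc2_gt0 h.
by rewrite divr_gt0 // ?mulr_gt0 // exprn_gt0.
Qed.

(** Liouville's formula solves the equation. The derivatives of second order are
kept, rather than the Laplacian, so that two such functions can be subtracted. *)
Lemma liouville_second h h1 h2 (s3 : C) z :
  (\forall w \near z, [/\ cder h w (h1 w), cder h1 w (h2 w) & h1 w != 0]) -> cder h2 z s3 ->
  exists (A B : C -> C) (aa ab ba bb : C),
  [/\ \forall w \near z, wd (fun w => (liouville (h1 w) (h w))%:C) w (A w) (B w),
      wd A z aa ab, wd B z ba bb &
      2 * complex.Re (ab + ba) = - expR (liouville (h1 z) (h z))].
Proof.
move=> hyp dh2; have [dh dh1 h10] := nbhs_singleton hyp.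
pose A w := h2 w / h1 w - 2 * (h w)^* * h1 w / (1 + h w * (h w)^*).
pose B w := (h2 w)^* / (h1 w)^* - 2 * h w * (h1 w)^* / (1 + h w * (h w)^*).
have N0 := one_add_normc2 (h z).
have wN := wd_one_add_normc2 dh.
have wV := @wdV R (fun w => 1 + h w * (h w)^*) z _ _ N0 wN.
have wA := wdB (wdM (wd_cder dh2) (wd_cder (cderV h10 dh1)))
  (wdM (wdM (wdM (wd_cst 2 z) (wdJ (wd_cder dh))) (wd_cder dh1)) wV).
have c10 := conj_neq0 h10.
have wJ1 : wd (fun w => (h1 w)^*) z 0 (h2 z)^*.
  by have := wdJ (wd_cder dh1); rewrite rmorph0.
have wB := wdB (wdM (wdJ (wd_cder dh2)) (@wdV R (fun w => (h1 w)^*) z _ _ c10 wJ1))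
  (wdM (wdM (wdM (wd_cst 2 z) (wd_cder dh)) wJ1) wV).
exists A, B; do 4 eexists; split; [|exact: wA|exact: wB|].
  by apply: filterS hyp => w [d1 d2 d3]; exact: wd_liouville.
rewrite exp_liouville //.
set r := normc (h1 z) ^+ 2; set s := normc (h z) ^+ 2.
have cast : (- (4 * r * ((1 + s)^-1 * (1 + s)^-1)))%:C =
    - (4 * (h1 z * (h1 z)^*) * ((1 + h z * (h z)^*)^-1 * (1 + h z * (h z)^*)^-1)) :> C.
  have e4 : (4 : R)%:C = 4 :> C by rewrite rmorph_nat.
  have e1 : (1 + s)%:C = 1 + s%:C :> C by rewrite rmorphD rmorph1.
  rewrite -!sqr_normcE -/r -/s -e4 -e1.
  by rewrite (rmorphN (real_complex R)) !(rmorphM (real_complex R)) !(fmorphV (real_complex R)).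
have -> : - (8 * r / (1 + s) ^+ 2) =
    2 * complex.Re ((- (4 * r * ((1 + s)^-1 * (1 + s)^-1)))%:C : C).
  by rewrite /= expr2 invfM; ring.
rewrite cast; congr (2 * complex.Re _).
rewrite !rmorph0; move: h10 c10 N0.
move: (h z)^* (h1 z)^* (h2 z)^* (s3^*) (h z) (h1 z) (h2 z) => a b c d a' b' c' h10 c10 N0.
by field; apply/and3P.
Qed.

Lemma rder_uniq (c : R -> C) (s : R) (d e : C) : rder c s d -> rder c s e -> d = e.
Proof.
move=> /rder_ReIm[h1 h2] /rder_ReIm[k1 k2]; apply/eqP; rewrite eq_complex.
rewrite -(@derive_val _ _ _ _ _ _ _ h1) -(@derive_val _ _ _ _ _ _ _ h2).
by rewrite (@derive_val _ _ _ _ _ _ _ k1) (@derive_val _ _ _ _ _ _ _ k2) !eqxx.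
Qed.

Lemma wd_uniq f z (a b a' b' : C) : wd f z a b -> wd f z a' b' -> a = a' /\ b = b'.
Proof.
move=> [h1 h2] [k1 k2]; have e1 := rder_uniq h1 k1; have e2 := rder_uniq h2 k2.
have i0 : ('i : C) != 0 by exact: neq0Ci.
have {}e2 : a - b = a' - b' by exact: (mulfI i0 e2).
have n2 : (2 : C) != 0 by rewrite pnatr_eq0.
split; apply: (mulIf n2).
  have -> : a * 2 = (a + b) + (a - b) by ring.
  by rewrite e1 e2; ring.
have -> : b * 2 = (a + b) - (a - b) by ring.
by rewrite e1 e2; ring.
Qed.

(** Differentiate the product of [f] with its conjugate with respect to [z]. *)
Lemma const_normc_cder0 f (f' : C) (c : R) z :
  (\forall w \near z, normc (f w) ^+ 2 = c) -> c != 0 -> cder f z f' -> f' = 0.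
Proof.
move=> fc c0 ff'.
have w1 := wd_normc2 ff'.
have w2 : wd (fun w => f w * (f w)^*) z 0 0.
  apply: (wd_eq _ (wd_cst c%:C z)).
  by apply: filterS fc => w <-; rewrite sqr_normcE.
have [/eqP + _] := wd_uniq w1 w2.
rewrite mulf_eq0 conjc_eq0 => /orP[/eqP //|/eqP fz].
by move: c0; rewrite -(nbhs_singleton fc) fz normc0 expr0n eqxx.
Qed.

Lemma cder_shift f (a z d : C) : cder f (z + a) d -> cder (fun w => f (w + a)) z d.
Proof.
move=> fd; have := cder_comp (cderD (cder_id z) (cder_cst a z)) fd.
by rewrite addr0 mul1r.
Qed.

Lemma cder_reflect f (p z d : C) : cder f (p - z) d -> cder (fun w => f (p - w)) z (- d).
Proof.
move=> fd; have := cder_comp (cderB (cder_cst p z) (cder_id z)) fd.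
by rewrite sub0r mulN1r.
Qed.

(** At each point there is a unique Moebius transformation of [h] that agrees with
[g] up to order two. As the Schwarzian derivatives are equal, its suitably
normalised coefficients all satisfy the same linear first-order equation, so that
their ratios are locally constant. *)
Lemma schwarzian_moebius S h h1 h2 h3 g g1 g2 g3 : discrete S ->
  (forall z, ~ S z -> [/\ cder h z (h1 z), cder h1 z (h2 z), cder h2 z (h3 z) & h1 z != 0]) ->
  (forall z, ~ S z -> [/\ cder g z (g1 z), cder g1 z (g2 z), cder g2 z (g3 z) & g1 z != 0]) ->
  (forall z, ~ S z -> schwarzian (h1 z) (h2 z) (h3 z) = schwarzian (g1 z) (g2 z) (g3 z)) ->
  exists a b c d : C, a * d - b * c != 0 /\
    forall z, ~ S z -> c * h z + d != 0 /\ g z * (c * h z + d) = a * h z + b.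
Proof.
move=> dS hh hg hS.
(* The normalisation X 0 * h + X 1 = 1 fixes the scale of the transformation;
   the ratio al of first derivatives satisfies the equation of the coefficients
   with twice the rate, so that X i * X j / al is constant. *)
pose K z := (h2 z / h1 z - g2 z / g1 z) / (2 * h1 z).
pose al z := g1 z / h1 z.
pose v z := (1 / 2) * (g2 z / g1 z - h2 z / h1 z).
pose X (i : nat) z : C := match i with
  | 0 => K z | 1 => 1 - K z * h z
  | 2 => g z * K z + al z | _ => g z * (1 - K z * h z) - al z * h z end.
have dal z : ~ S z -> cder al z (2 * v z * al z).
  move=> nS; have [a1 a2 a3 a4] := hh z nS; have [b1 b2 b3 b4] := hg z nS.
  have := cderM b2 (cderV a4 a2); congr (cder _ _ _); rewrite /v /al.
  by move: (h1 z) (h2 z) (g1 z) (g2 z) a4 b4 => x y x' y' *; field; apply/andP.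
have dK z : ~ S z -> cder K z (v z * K z).
  move=> nS; have [a1 a2 a3 a4] := hh z nS; have [b1 b2 b3 b4] := hg z nS.
  have a5 : 2 * h1 z != 0 by rewrite mulf_neq0 // pnatr_eq0.
  have := cderM (cderB (cderM a3 (cderV a4 a2)) (cderM b3 (cderV b4 b2)))
    (@cderV R (fun w => 2 * h1 w) z _ a5 (cderM (cder_cst 2 z) a2)).
  congr (cder _ _ _).
  have := hS z nS; rewrite /schwarzian /v /K.
  move: (h1 z) (h2 z) (h3 z) (g1 z) (g2 z) (g3 z) a4 b4 => x y t x' y' t' x0 x0' E.
  have -> : t = x * (t' / x' - 3 / 2 * (y' / x') ^+ 2 + 3 / 2 * (y / x) ^+ 2).
    by rewrite -E; field.
  by field; apply/andP.
have dX i z : ~ S z -> cder (X i) z (v z * X i z).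
  move=> nS; have [a1 a2 a3 a4] := hh z nS; have [b1 b2 b3 b4] := hg z nS.
  have dKh := cderB (cder_cst 1 z) (cderM (dK z nS) a1).
  have E : h1 z * (2 * K z) = - (2 * v z).
    by rewrite /K /v; field; apply/andP.
  have E' : al z * h1 z = g1 z by rewrite /al divfK.
  have E1 : 0 - (v z * K z * h z + K z * h1 z) = v z * (1 - K z * h z).
    have n2 : (2 : C) != 0 by rewrite pnatr_eq0.
    apply: (mulfI n2).
    have -> : 2 * (0 - (v z * K z * h z + K z * h1 z)) =
      - (2 * v z * K z * h z) - h1 z * (2 * K z) by ring.
    by rewrite E; ring.
  have E2 : g1 z * K z = - v z * al z.
    rewrite -E'; have n2 : (2 : C) != 0 by rewrite pnatr_eq0.
    apply: (mulfI n2).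
    have -> : 2 * (al z * h1 z * K z) = al z * (h1 z * (2 * K z)) by ring.
    by rewrite E; ring.
  case: i => [|[|[|i]]] /=.
  - exact: dK.
  - by rewrite -E1; exact: dKh.
  - have := cderD (cderM b1 (dK z nS)) (dal z nS); rewrite E2.
    by congr (cder _ _ _); ring.
  - rewrite E1 in dKh.
    have := cderB (cderM b1 dKh) (cderM (dal z nS) a1); rewrite E'.
    congr (cder _ _ _).
    have -> : g1 z * (1 - K z * h z) = g1 z - (g1 z * K z) * h z by ring.
    by rewrite E2; ring.
have al0 z : ~ S z -> al z != 0.
  move=> nS; have [a1 a2 a3 a4] := hh z nS; have [b1 b2 b3 b4] := hg z nS.
  by rewrite /al mulf_neq0 // invr_neq0.
have cst i j z w : ~ S z -> ~ S w -> X i z * X j z / al z = X i w * X j w / al w.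
  move=> nz nw; apply: (loc_const_off (F := fun z => X i z * X j z / al z) dS) nz nw.
  move=> y ny; apply: cder0_loc_const.
  have oS : \forall x \near y, ~ S x.
    have /dnbhscP[r r0 hr] := dS y; apply/nbhscP; exists r => // x xr.
    by have [->|xy] := eqVneq x y; [exact: ny|exact: hr].
  apply: filterS oS => x nx.
  have := cderM (cderM (dX i x nx) (dX j x nx)) (cderV (al0 x nx) (dal x nx)).
  congr (cder _ _ _); have := al0 x nx.
  by move: (al x) (v x) (X i x) (X j x) => *; field.
have Xdet z : ~ S z -> [/\ X 0%N z * h z + X 1%N z = 1,
    g z = X 2%N z * h z + X 3%N z & X 2%N z * X 1%N z - X 3%N z * X 0%N z = al z].
  by move=> nS; split; rewrite /X; ring.
have [z0 [nz0 _ _]] := discrete_near_ex dS (@filterT _ (nbhs (0 : C)) _).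
have [_ _ det0] := Xdet z0 nz0.
exists (X 2%N z0), (X 3%N z0), (X 0%N z0), (X 1%N z0); split.
  by rewrite det0 al0.
move=> z nz; have [s1 s2 s3] := Xdet z nz; have az := al0 z nz; have az0 := al0 z0 nz0.
have [i Xi0] : exists i, X i z0 != 0.
  have [e|] := eqVneq (X 0%N z0) 0; last by exists 0%N.
  exists 1%N; have [+ _ _] := Xdet z0 nz0; rewrite e mul0r add0r => ->.
  exact: oner_neq0.
have Xi : X i z != 0.
  have := cst i i z0 z nz0 nz; apply: contra_eqN => /eqP ->.
  rewrite mul0r mul0r mulf_neq0 // ?invr_neq0 // mulf_neq0 //.
have prop j : X j z = X i z / X i z0 * X j z0.
  have h1' := cst i j z z0 nz nz0; have h2' := cst i i z z0 nz nz0.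
  have k1 : X i z * X j z = X i z0 * X j z0 * (al z / al z0).
    by apply: (mulIf (invr_neq0 az)); rewrite h1'; field; apply/andP.
  have k2 : X i z * X i z = X i z0 * X i z0 * (al z / al z0).
    by apply: (mulIf (invr_neq0 az)); rewrite h2'; field; apply/andP.
  apply: (mulfI Xi); rewrite k1.
  have -> : X i z * (X i z / X i z0 * X j z0) = (X i z * X i z) / X i z0 * X j z0 by ring.
  by rewrite k2; field; apply/andP.
have r0 : X i z / X i z0 != 0 by rewrite mulf_neq0 // invr_neq0.
move: s1 s2; rewrite (prop 0%N) (prop 1%N) (prop 2%N) (prop 3%N).
move: (X i z / X i z0) r0 => r r0 s1 s2.
have e1 : r * (X 0%N z0 * h z + X 1%N z0) = 1 by rewrite -[RHS]s1; ring.
split.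
  by apply: contra_eqN e1 => /eqP ->; rewrite mulr0 eq_sym oner_neq0.
by rewrite s2 -[RHS]mul1r -e1; ring.
Qed.

End Schwarzian.

(** * Developing maps *)

Section Nonspecial.
Variable R : realType.
Local Notation C := R[i].
Variable tau : C.
Hypothesis tau0 : 0 < complex.Im tau.
Local Notation HL := (half_lattice tau).
Implicit Types (z w e p : C) (S : set C) (t : R).

Definition singular (h : C -> C) : set C := HL `|` [set z | ~ analytic_at h z].

Lemma discrete_singular h : meromorphic h -> discrete (singular h).
Proof.
by move=> mh; apply: discreteU; [exact: discrete_half_lattice|exact: meromorphic_discrete].
Qed.

Lemma not_singular h z : ~ singular h z -> ~ HL z /\ analytic_at h z.
Proof. by move=> /not_orP[h1 /contrapT h2]. Qed.

Lemma discrete_near S z : discrete S -> ~ S z -> \forall w \near z, ~ S w.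
Proof. by move=> dS; exact: (discrete_opened dS). Qed.

Lemma continuous_eq (v1 v2 : C -> R) z : {for z, continuous v1} -> {for z, continuous v2} ->
  (\forall w \near z^', v1 w = v2 w) -> v1 z = v2 z.
Proof.
move=> c1 c2 /dnbhscP[r r0 hr]; apply/eqP/negPn/negP; rewrite -subr_eq0 => nE.
have d0 : 0 < `|v1 z - v2 z| / 2 by rewrite divr_gt0 // normr_gt0.
have n1 : \forall w \near z, `|v1 z - v1 w| < `|v1 z - v2 z| / 2.
  by move/cvgrPdist_lt : c1; apply.
have n2 : \forall w \near z, `|v2 z - v2 w| < `|v1 z - v2 z| / 2.
  by move/cvgrPdist_lt : c2; apply.
have d00 : discrete (@set0 C).
  move=> y; apply/dnbhscP; exists 1; first exact: ltr01.
  by move=> w _ _ [].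
have [w [_ wz [[w1 w2] wr]]] :=
  discrete_near_ex d00 (filterI (filterI n1 n2) (cball_open (cball_center z r0))).
have E := hr w wr wz.
have := ler_distD (v1 w) (v1 z) (v2 z); rewrite {2}E (distrC (v2 w)).
by rewrite leNgt [X in _ < X]splitr ltrD.
Qed.

Section DevelopingMap.
Variables (u : C -> R) (h : C -> C).
Hypothesis uh : developing_map tau u h.
Local Notation h1 := (derive1 h).
Local Notation h2 := (derive1 (derive1 h)).
Local Notation h3 := (derive1 (derive1 (derive1 h))).

Lemma dev_meromorphic : meromorphic h. Proof. by case: uh. Qed.

Lemma dev_regular z : ~ singular h z ->
  [/\ cder h z (h1 z), cder h1 z (h2 z), cder h2 z (h3 z), h1 z != 0 &
      u z = liouville (h1 z) (h z)].
Proof.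
move=> /not_singular[nz az]; have [_ /(_ z nz az)[d0 uz]] := uh.
have [a1 a2] := analytic_derive1 az; have [a3 a4] := analytic_derive1 a2.
by have [a5 _] := analytic_derive1 a4.
Qed.

Lemma near_regular z (P : C -> Prop) : ~ singular h z ->
  (forall w, ~ singular h w -> P w) -> \forall w \near z, P w.
Proof.
move=> nz hP.
by apply: filterS (discrete_near (discrete_singular dev_meromorphic) nz).
Qed.

(** The derivative of an even function vanishes at the centre. At a regular point
this contradicts the local injectivity of [h]; at a pole one passes to the
inverse [k] of [h], and the continuity of [u] at [c] forces the derivative of
[k] there to be nonzero. *)
Lemma dev_not_even S c : discrete S -> (forall z, {for z, continuous u} \/ HL z) ->
  ~ HL c -> (forall z, ~ S z -> h (c + c - z) = h z) -> False.
Proof.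
move=> dS cu nc ev.
have evc : \forall w \near c, h (c + c - w) = h w.
  have /dnbhscP[r r0 hr] := dS c; apply/nbhscP; exists r => // w wr.
  by have [->|wc] := eqVneq w c; [rewrite addrK|exact: ev (hr w wr wc)].
have cc : c + c - c = c by rewrite addrK.
have der0 (k : C -> C) (d : C) : cder k c d ->
    (\forall w \near c, k (c + c - w) = k w) -> d = 0.
  move=> kd kev; have kd' : cder k (c + c - c) d by rewrite cc.
  have := cder_uniq (cder_eq kev (cder_reflect kd')) kd => E.
  have n2 : (2 : C) != 0 by rewrite pnatr_eq0.
  apply: (mulfI n2); have -> : 2 * d = d - - d by ring.
  by rewrite E; ring.
have [ac|pc] := dev_meromorphic c.
  have nS : ~ singular h c by move=> [].
  have [dh _ _ /eqP h10 _] := dev_regular nS.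
  by apply: h10; exact: der0 dh evc.
have [r [k [r0 hk kc kE]]] := pole_inv 1 pc.
have [k' kk' ck'] := hk.
have k'c : k' c = 0.
  apply: (der0 k _ (kk' c (cball_center c r0))).
  have B1 : \forall w \near c, cball c r w by apply: cball_open; exact: cball_center.
  apply: filterS (filterI evc B1) => w [E wr].
  have [->|wc] := eqVneq w c; first by rewrite addrK.
  have refl : c + c - w - c = - (w - c) by ring.
  have wr' : cball c r (c + c - w) by rewrite /cball /= refl normcN.
  have wc' : c + c - w != c.
    by rewrite -subr_eq0 refl oppr_eq0 subr_eq0.
  by rewrite (kE w wr wc).2 (kE _ wr' wc').2 E.
have [cuc|//] := cu c.
(* Liouville's formula is invariant under inversion; it is written here without
   division. *)
pose X w := 8 * normc (k' w) ^+ 2.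
pose Y w := expR (u w) * ((1 + normc (k w) * normc (k w)) * (1 + normc (k w) * normc (k w))).
have XY : \forall w \near c^', X w = Y w.
  have B1 : \forall w \near c^', cball c r w /\ w != c by apply/dnbhscP; exists r.
  apply: filterS (filterI (discrete_singular dev_meromorphic c) B1) => w [ns [wr wc]].
  have [dh _ _ h10 uw] := dev_regular ns.
  have [hw kw] := kE w wr wc.
  have kder : k' w = - h1 w * (h w)^-1 ^+ 2.
    have E : \forall v \near w, (h v)^-1 = k v.
      have vc : \forall v \near w, v != c.
        apply/nbhscP; exists (normc (w - c)); first by rewrite normc_gt0 subr_eq0.
        by move=> v; apply: contraTneq => ->; rewrite normcB ltxx.
      by apply: filterS (filterI (cball_open wr) vc) => v [v1 v2]; rewrite (kE v v1 v2).2.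
    exact: (cder_uniq (kk' w wr) (cder_eq E (cderV hw dh))).
  rewrite /X /Y uw exp_liouville // kder kw normcM normcN normcX !normcV.
  have nh : 0 < normc (h w) by rewrite normc_gt0.
  have nh2 := normc2_gt0 (h w).
  move: (normc (h1 w)) (normc (h w)) nh nh2 => x y y0 y1.
  by field; rewrite !gt_eqF //=; nra.
have sq (v : C -> R) : v @ c --> v c -> (fun w => v w * v w) @ c --> v c * v c.
  by move=> cv; exact: (@cvgM R C (nbhs c) _ _ _ _ _ cv cv).
have m1 : (fun w => normc (k' w)) @ c --> normc (k' c).
  exact: (@cvgc_norm R C (nbhs c) _ _ _ (ck' c (cball_center c r0))).
have m0 : (fun w => normc (k w)) @ c --> normc (k c).
  exact: (@cvgc_norm R C (nbhs c) _ _ _ (hol_cvg hk (cball_center c r0))).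
have n1 : (fun w => normc (k' w) * normc (k' w)) @ c --> normc (k' c) * normc (k' c) := sq _ m1.
have n0 : (fun w => normc (k w) * normc (k w)) @ c --> normc (k c) * normc (k c) := sq _ m0.
have cX : (fun w => 8 * (normc (k' w) * normc (k' w))) @ c --> 8 * (normc (k' c) * normc (k' c)).
  exact: (@cvgM R C (nbhs c) _ _ _ _ _ (@cvg_cst R 8 C (nbhs c) _) n1).
have cd : (fun w => 1 + normc (k w) * normc (k w)) @ c --> 1 + normc (k c) * normc (k c).
  exact: (@cvgD R R C (nbhs c) _ _ _ _ _ (@cvg_cst R 1 C (nbhs c) _) n0).
have ce : (fun w => expR (u w)) @ c --> expR (u c).
  exact: (continuous_comp cuc (@continuous_expR R (u c))).
have cY : Y @ c --> Y c by exact: (@cvgM R C (nbhs c) _ _ _ _ _ ce (sq _ cd)).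
have := continuous_eq cX cY XY.
rewrite /Y k'c normc0 mul0r mulr0 => /esym/eqP.
by rewrite -expr2 gt_eqF // mulr_gt0 ?expR_gt0 // exprn_gt0 // normc2_gt0.
Qed.

End DevelopingMap.
End Nonspecial.

(** * Multipliers of a developing map *)

Section Multiplier.
Variable R : realType.
Local Notation C := R[i].
Variable tau : C.
Hypothesis tau0 : 0 < complex.Im tau.
Local Notation HL := (half_lattice tau).
Implicit Types (z w e p : C) (S : set C) (t : R).

Lemma discrete_shift S e : discrete S -> discrete [set z | S (z + e)].
Proof.
apply: (@discrete_preim R S (fun z => z + e)) => z w.
by congr normc; ring.
Qed.

Lemma discrete_reflect S e : discrete S -> discrete [set z | S (e - z)].
Proof.
apply: (@discrete_preim R S (fun z => e - z)) => z w.
by rewrite -normcN; congr normc; ring.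
Qed.

(** Differentiating the common squared modulus with respect to [z] leaves the
conjugates untouched. *)
Lemma equal_modulus f g (f' g' : C) z : (\forall w \near z, normc (f w) ^+ 2 = normc (g w) ^+ 2) ->
  cder f z f' -> cder g z g' -> f' * (f z)^* = g' * (g z)^*.
Proof.
move=> fg ff' gg'; have wf := wd_normc2 ff'; have wg := wd_normc2 gg'.
have E : \forall w \near z, g w * (g w)^* = f w * (f w)^*.
  by apply: filterS fg => w E; rewrite -!sqr_normcE E.
by have [] := wd_uniq wf (wd_eq E wg).
Qed.

(** As [h] is locally injective, the coefficients can be read off by
differentiating twice. *)
Lemma quadratic_relation_trivial h (h1 : C -> C) (A B D : C) z :
  (\forall w \near z, cder h w (h1 w) /\ h1 w != 0) ->
  (\forall w \near z, A * h w ^+ 2 + B * h w + D = 0) -> [/\ A = 0, B = 0 & D = 0].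
Proof.
move=> hh E0.
have dlin (a b w : C) : cder h w (h1 w) -> cder (fun w => a * h w + b) w (a * h1 w).
  move=> dh; have := cderD (cderM (cder_cst a w) dh) (cder_cst b w).
  by rewrite mul0r add0r addr0.
have zero (f : C -> C) w (d : C) : (\forall v \near w, f v = 0) -> cder f w d -> d = 0.
  by move=> f0 fd; exact: cder_uniq fd (cder_eq (filterS (fun v => @esym _ _ _) f0) (cder_cst 0 w)).
have E1 : \forall w \near z, 2 * A * h w + B = 0.
  have E0n : \forall w \near z, \forall v \near w, A * h v ^+ 2 + B * h v + D = 0.
    by apply/nbhs_interior.
  apply: filterS (filterI hh E0n) => w [[dh h10] Ew].
  have d : cder (fun w => h w * (A * h w + B) + D) w (h1 w * (2 * A * h w + B)).
    have := cderD (cderM dh (dlin A B w dh)) (cder_cst D w).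
    by congr (cder _ _ _); ring.
  have Ew' : \forall v \near w, h v * (A * h v + B) + D = 0.
    by apply: filterS Ew => v <-; ring.
  by have /eqP := zero _ _ _ Ew' d; rewrite mulf_eq0 (negPf h10) => /eqP.
have [dh h10] := nbhs_singleton hh.
have /eqP := zero _ _ _ E1 (dlin (2 * A) B z dh).
rewrite mulf_eq0 (negPf h10) orbF mulf_eq0 pnatr_eq0 /= => /eqP A0.
move: (nbhs_singleton E1) (nbhs_singleton E0); rewrite A0 mulr0 !mul0r !add0r => B0.
by rewrite B0 mul0r add0r.
Qed.

Lemma expR_double t : expR (2 * t) = expR t ^+ 2.
Proof. by rewrite mulrC expRM_natr. Qed.

Lemma ln_density_inj (a x a' x' : R) : 0 < a -> 0 < x -> 0 < a' -> 0 < x' ->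
  ln (8 * a ^+ 2 / x ^+ 2) = ln (8 * a' ^+ 2 / x' ^+ 2) -> a * x' = a' * x.
Proof.
move=> a0 x0 a0' x0' E.
have {}E : 8 * a ^+ 2 / x ^+ 2 = 8 * a' ^+ 2 / x' ^+ 2.
  by apply: ln_inj E; rewrite posrE divr_gt0 ?mulr_gt0 ?exprn_gt0.
apply/eqP; rewrite -(@eqrXn2 _ 2) ?mulr_ge0 ?ltW //; apply/eqP.
have n8 : (8 : R) != 0 by rewrite pnatr_eq0.
apply: (mulfI n8).
have -> : 8 * (a * x') ^+ 2 = (8 * a ^+ 2 / x ^+ 2) * (x ^+ 2 * x' ^+ 2).
  by field; rewrite gt_eqF.
by rewrite E; field; rewrite gt_eqF.
Qed.

(** After taking square roots the equality is linear in [a], [a'], [a * b' ^+ 2]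
and [a' * b ^+ 2]; two values of [t] suffice. *)
Lemma family_moduli (a b a' b' : R) : 0 < a -> 0 < a' -> 0 <= b -> 0 <= b' ->
  (forall t, ln (8 * expR (2 * t) * a ^+ 2 / (1 + expR (2 * t) * b ^+ 2) ^+ 2) =
             ln (8 * expR (2 * t) * a' ^+ 2 / (1 + expR (2 * t) * b' ^+ 2) ^+ 2)) ->
  a = a' /\ b = b'.
Proof.
move=> a0 a0' b0 b0' E.
have lin t : a * (1 + expR (2 * t) * b' ^+ 2) = a' * (1 + expR (2 * t) * b ^+ 2).
  have p c : 0 < 1 + expR (2 * t) * c ^+ 2.
    by rewrite ltr_wpDr // mulr_ge0 ?sqr_ge0 // expR_ge0.
  have s0 := expR_gt0 t; apply: (mulfI (lt0r_neq0 s0)).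
  rewrite [LHS]mulrA [RHS]mulrA.
  apply: ln_density_inj; [by rewrite mulr_gt0|exact: p|by rewrite mulr_gt0|exact: p|].
  by rewrite !exprMn -!expR_double ![8 * (_ * _)]mulrA; exact: E.
(* The weights expR (2 * t) are then 1 and 4. *)
have := lin 0; have := lin (ln 2); rewrite mulr0 expR0.
have -> : expR (2 * ln 2) = 4 :> R by rewrite mulrC expRM_natr lnK ?posrE //; ring.
move=> e1 e2; have aa : a = a' by lra.
split=> //; apply/eqP; rewrite -(@eqrXn2 _ 2) //; apply/eqP.
by move: e2; rewrite aa => /(mulfI (lt0r_neq0 a0')); lra.
Qed.
Lemma normc_div1 (a b : C) : b != 0 -> normc a = normc b -> normc (a / b) = 1.
Proof. by move=> b0 ab; rewrite normcM normcV ab divff // normc_eq0. Qed.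

Lemma rotation_conj (r a b : C) : normc r = 1 -> r * a^* = b^* -> a = r * b.
Proof.
move=> r1 E; have rr : r * r^* = 1 by rewrite -sqr_normcE r1 expr1n rmorph1.
apply: (can_inj (@conjCK _)); rewrite [RHS]rmorphM /= -E mulrA (mulrC _ r).
by rewrite rr mul1r.
Qed.

Section Family.
Variables (u : C -> R) (h : C -> C) (U : R -> C -> R).
Hypothesis uh : developing_map tau u h.
Hypothesis Uh : forall t z, ~ HL z -> analytic_at h z ->
  U t z = ln (8 * expR (2 * t) * normc (derive1 h z) ^+ 2 /
              (1 + expR (2 * t) * normc (h z) ^+ 2) ^+ 2).
Hypothesis Usol : forall t, is_solution tau (U t).
Local Notation h1 := (derive1 h).
Local Notation sing := (singular tau h).

(** All members of the family are periodic, so the moduli of [h] and of its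
derivative are. The quotient of the derivatives at [z + e] and [z] has modulus
one, hence is constant; the equality of the moduli of [h] then leaves no room
for an additive constant. *)
Lemma multiplier e : (e = 1 \/ e = tau) -> exists2 rho : C, normc rho = 1 &
  forall z, ~ sing z -> ~ sing (z + e) -> h (z + e) = rho * h z.
Proof.
move=> he; have mh := dev_meromorphic uh.
pose S := sing `|` [set z | sing (z + e)].
have dS : discrete S.
  by apply: discreteU; [|apply: discrete_shift]; exact: discrete_singular.
have nsing z : ~ S z -> ~ sing z /\ ~ sing (z + e).
  by move=> nS; split=> ns; apply: nS; [left|right].
have per z : ~ S z -> normc (h1 (z + e)) = normc (h1 z) /\ normc (h (z + e)) = normc (h z).
  move=> /nsing[nz nze]; have [_ _ _ h10 _] := dev_regular uh nz.
  have [_ _ _ h10' _] := dev_regular uh nze.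
  have [nHz az] := not_singular nz; have [nHze aze] := not_singular nze.
  have q1 : 0 < normc (h1 (z + e)) by rewrite normc_gt0; exact: h10'.
  have q2 : 0 < normc (h1 z) by rewrite normc_gt0; exact: h10.
  apply: (family_moduli q1 q2 (normc_ge0 _) (normc_ge0 _)) => t.
  rewrite -(Uh t nHz az) -(Uh t nHze aze); have [pU _ _ _ _] := Usol t.
  have [p1 p2] := pU z nHz; case: he => ->; [exact: p1|exact: p2].
have reg z : ~ S z -> cder (fun w => h (w + e)) z (h1 (z + e)) /\ cder h z (h1 z).
  move=> /nsing[nz nze]; have [dh _ _ _ _] := dev_regular uh nz.
  have [dhe _ _ _ _] := dev_regular uh nze.
  split; [exact: (cder_shift dhe)|exact: dh].
pose F z := h1 (z + e) / h1 z.
have Floc z : ~ S z -> \forall w \near z, F w = F z.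
  move=> nz; apply: cder0_loc_const; apply: filterS (discrete_near dS nz) => w nw.
  have F1 : \forall v \near w, normc (F v) ^+ 2 = 1.
    apply: filterS (discrete_near dS nw) => v nv.
    have [p1 _] := per v nv; have [nv' _] := nsing v nv.
    have [_ _ _ h10 _] := dev_regular uh nv'.
    by rewrite (normc_div1 h10 p1) expr1n.
  have [nw1 nw2] := nsing w nw; have [_ dh1 _ h10 _] := dev_regular uh nw1.
  have [_ dh1e _ _ _] := dev_regular uh nw2.
  have dF := cderM (cder_shift dh1e) (cderV h10 dh1).
  rewrite -(const_normc_cder0 F1 (oner_neq0 R) dF); exact: dF.
have [z0 [nz0 _ _]] := discrete_near_ex dS (@filterT _ (nbhs (0 : C)) _).
have rotate z : ~ S z -> h1 (z + e) = F z0 * h1 z.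
  move=> nz; have [nz' _] := nsing z nz; have [_ _ _ h10 _] := dev_regular uh nz'.
  rewrite -(loc_const_off dS Floc nz nz0) /F; exact: (esym (divfK h10 _)).
have n1 : normc (F z0) = 1.
  have [nz' _] := nsing z0 nz0; have [_ _ _ h10 _] := dev_regular uh nz'.
  exact: (normc_div1 h10 (per z0 nz0).1).
exists (F z0); first exact: n1.
move=> z nz nze; have nS : ~ S z by case; [exact: nz|exact: nze].
have [dhe dh] := reg z nS; have [nz' _] := nsing z nS; have [_ _ _ h10 _] := dev_regular uh nz'.
have H : \forall w \near z, normc (h (w + e)) ^+ 2 = normc (h w) ^+ 2.
  by apply: filterS (discrete_near dS nS) => w nw; congr (_ ^+ 2); have [_ ] := per w nw.
have := equal_modulus H dhe dh; rewrite (rotate z nS) mulrAC => E.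
have {}E : F z0 * (h (z + e))^* = (h z)^*.
  by apply: (mulIf h10); rewrite E mulrC.
exact: (rotation_conj n1 E).
Qed.
End Family.
End Multiplier.

(** * The change of a solution under a unipotent matrix *)

Section Correction.
Variable R : realType.
Local Notation C := R[i].
Implicit Types (f g h : C -> C) (z w e p : C) (S D : set C) (t : R).

(** For [n = 0] this adds a constant at a regular point; for the order [n] of a
pole it does the same to the numerator. *)
Lemma analytic_addX g z n : analytic_at g z -> analytic_at (fun w => g w + (w - z) ^+ n) z.
Proof.
move=> [a ga]; exists (fun k => a k + (k == n)%:R); apply: filterS ga => w gw.
have E : series (fun k => (a k + (k == n)%:R) * (w - z) ^+ k) =
    (fun m => series (fun k => a k * (w - z) ^+ k) m +
              series (fun k => (k == n)%:R * (w - z) ^+ k) m).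
  apply/funext => m; rewrite /series /= -big_split /=.
  by apply: eq_bigr => k _; rewrite mulrDl.
rewrite E; apply: (@cvgcD R nat \oo _ _ _ _ _ gw).
apply/cvgcP => r r0; exists n.+1 => // m /= nm.
rewrite /series /= (bigD1_seq n) ?mem_index_iota ?iota_uniq //= eqxx mul1r big1 ?addr0.
  by rewrite subrr normc0.
by move=> k /negPf ->; rewrite mul0r.
Qed.

(** The change of Liouville's formula when [a / b] is replaced by [a / b + 1]. The
homogeneous coordinates give it a meaning at the poles of [a / b]. *)
Definition unipotent_gap (a b : C) : R :=
  2 * ln ((normc a ^+ 2 + normc b ^+ 2) / (normc (a + b) ^+ 2 + normc b ^+ 2)).

Lemma energy_gt0 (a b : C) : a != 0 \/ b != 0 -> 0 < normc a ^+ 2 + normc b ^+ 2.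
Proof.
case=> h; [rewrite ltr_wpDr ?sqr_ge0 //|rewrite ltr_wpDl ?sqr_ge0 //];
  by rewrite exprn_gt0 // normc_gt0.
Qed.

Lemma energy_shift (a b : C) : a != 0 \/ b != 0 -> a + b != 0 \/ b != 0.
Proof.
have [->|b0 _] := eqVneq b 0; last by right.
by rewrite addr0.
Qed.

Lemma unipotent_gap_scale (c a b : C) : c != 0 -> unipotent_gap (c * a) (c * b) = unipotent_gap a b.
Proof.
move=> c0; rewrite /unipotent_gap -mulrDr !normcM !exprMn -!mulrDr.
by rewrite -mulf_div divff ?mul1r // expf_neq0 // normc_eq0.
Qed.

Lemma unipotent_gap_Ck k D f g : opened D -> hol k D f -> hol k D g ->
  (forall z, D z -> f z != 0 \/ g z != 0) -> Ck k D (fun z => unipotent_gap (f z) (g z)).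
Proof.
move=> oD hf hg fg0.
pose en a b : R := normc a ^+ 2 + normc b ^+ 2.
have sm_en f' g' : hol k D f' -> hol k D g' -> sm k D (fun z => (en (f' z) (g' z))%:C).
  move=> hf' hg'.
  have -> : (fun z => (en (f' z) (g' z))%:C) = (fun z => f' z * (f' z)^* + g' z * (g' z)^*).
    by apply/funext => z; rewrite rmorphD /= !sqr_normcE.
  by apply: smD; apply: smM; [exact: sm_hol|apply: smJ; exact: sm_hol|
    exact: sm_hol|apply: smJ; exact: sm_hol].
have p1 z : D z -> 0 < en (f z) (g z) by move=> /fg0; exact: energy_gt0.
have p2 z : D z -> 0 < en (f z + g z) (g z) by move=> /fg0/energy_shift; exact: energy_gt0.
have s : sm k D (fun z => (en (f z) (g z) / en (f z + g z) (g z))%:C).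
  have -> : (fun z => (en (f z) (g z) / en (f z + g z) (g z))%:C) =
      (fun z => (en (f z) (g z))%:C * ((en (f z + g z) (g z))%:C)^-1).
    by apply/funext => z; rewrite (rmorphM (real_complex R)) (fmorphV (real_complex R)).
  apply: smM; first exact: sm_en.
  apply: smV; last by apply: sm_en => //; exact: holD.
  by move=> z /p2 h; rewrite real_complex_eq0 gt_eqF.
have l := sm_ln (fun z Dz => divr_gt0 (p1 z Dz) (p2 z Dz)) s.
have := sm_Ck oD (smM (sm_cst k D (2%:C : C)) l).
apply: Ck_eq => // z _; rewrite /unipotent_gap /en /=; ring.
Qed.

(** At a pole the pair [(h, 1)] is replaced by [(1, 0)], for which the change
vanishes. *)
Definition gap h z : R := if `[< analytic_at h z >] then unipotent_gap (h z) 1 else 0.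

Lemma gap_regular h z : analytic_at h z -> gap h z = unipotent_gap (h z) 1.
Proof. by move=> az; rewrite /gap (asboolT az). Qed.

Lemma cball_opened z (r : R) : opened (cball z r).
Proof. by move=> w; exact: cball_open. Qed.

(** Near a pole the pair [(1, 1 / h)] has holomorphic components without common
zero. *)
Lemma gap_smooth h k : meromorphic h -> Ck k setT (gap h).
Proof.
move=> mh; apply: Ck_local => z _.
have dA := meromorphic_discrete mh.
suff [r [r0 [f [g [hf hg fg0 E]]]]] : exists r, 0 < r /\ exists f g : C -> C,
    [/\ hol k (cball z r) f, hol k (cball z r) g,
        forall w, cball z r w -> f w != 0 \/ g w != 0 &
        forall w, cball z r w -> gap h w = unipotent_gap (f w) (g w)].
  exists (cball z r); first exact: cball_center.
  apply: (Ck_eq (@cball_opened z r)) (unipotent_gap_Ck (@cball_opened z r) hf hg fg0).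
  by move=> w /E ->.
have [az|pz] := mh z.
  have [r1 r10 hf] := analytic_hol k az.
  have : \forall w \near z, ~ [set z | ~ analytic_at h z] w by exact: (discrete_near dA).
  move=> /nbhscP[r2 r20 an]; exists (Num.min r1 r2); rewrite lt_min r10 r20; split=> //.
  exists h, (fun=> 1); split; [|exact: hol_cst| |].
  - by apply: hol_sub hf => w; rewrite /cball /= lt_min => /andP[].
  - by move=> w _; right; exact: oner_neq0.
  by move=> w; rewrite /cball /= lt_min => /andP[_ /an/contrapT]; exact: gap_regular.
have [r1 [g [r10 hg gz gE]]] := pole_inv k pz.
have := dA z; move=> /dnbhscP[r2 r20 an]; exists (Num.min r1 r2); rewrite lt_min r10 r20; split=> //.
exists (fun=> 1), g; split; [exact: hol_cst| | |].
- by apply: hol_sub hg => w; rewrite /cball /= lt_min => /andP[].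
- by move=> w _; left; exact: oner_neq0.
move=> w; rewrite /cball /= lt_min => /andP[w1 w2].
have [wz|wz] := eqVneq w z.
  rewrite wz gz /gap asboolF; last exact: pole_not_analytic.
  by rewrite /unipotent_gap addr0 divff ?ln1 ?mulr0 // gt_eqF // energy_gt0 //; left; exact: oner_neq0.
have [hw ->] := gE w w1 wz; rewrite gap_regular; last by apply: contrapT; exact: (an w w2 wz).
by rewrite -(unipotent_gap_scale (h w) 1 (invr_neq0 hw)) mulVf // mulr1.
Qed.

Lemma gap_periodic h S e : meromorphic h -> discrete S ->
  (forall z, ~ S z -> [/\ analytic_at h z, analytic_at h (z + e) & h (z + e) = h z]) ->
  forall z, gap h (z + e) = gap h z.
Proof.
move=> mh dS hS z; have [cg _] := gap_smooth 0 mh.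
have ce : {for z, continuous (fun w => gap h (w + e))}.
  exact: (continuous_comp (@cvgcD R C (nbhs z) _ _ _ _ _ (@cvg_id C (nbhs z)) (@cvgc_cst R C (nbhs z) _ e)) (cg (z + e) I)).
apply: (continuous_eq ce (cg z I)); apply: filterS (dS z) => w /hS[a1 a2 E].
by rewrite !gap_regular // E.
Qed.

Lemma ln_density (a b c : R) : 0 < a -> 0 < b -> 0 < c ->
  ln (8 * a ^+ 2 / c ^+ 2) = ln (8 * a ^+ 2 / b ^+ 2) + 2 * ln (b / c).
Proof.
move=> a0 b0 c0; rewrite (mulr_natl (ln _) 2) -lnXn ?divr_gt0 // -lnM ?posrE.
- by congr ln; field; rewrite !gt_eqF.
- by rewrite divr_gt0 ?mulr_gt0 ?exprn_gt0.
- by rewrite exprn_gt0 // divr_gt0.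
Qed.

Lemma liouville_unipotent (h1 h : C) : h1 != 0 ->
  liouville h1 (h + 1) = liouville h1 h + unipotent_gap h 1.
Proof.
move=> h10; have n1 : normc (1 : C) = 1 by rewrite -(rmorph1 (real_complex R)) normc_real normr1.
rewrite /liouville /unipotent_gap n1 expr1n (addrC (normc h ^+ 2)) (addrC (normc (h + 1) ^+ 2)).
by apply: ln_density; [rewrite normc_gt0|exact: normc2_gt0|exact: normc2_gt0].
Qed.

Lemma cder_addc f z (d a : C) : cder f z d -> cder (fun w => f w + a) z d.
Proof. by move=> fd; have := cderD fd (cder_cst a z); rewrite addr0. Qed.

(** The gap is the difference of two solutions of Liouville's equation. *)
Lemma gap_laplacian h h1 h2 (s3 : C) z :
  (\forall w \near z, [/\ cder h w (h1 w), cder h1 w (h2 w) & h1 w != 0]) -> cder h2 z s3 ->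
  (\forall w \near z, analytic_at h w) ->
  laplacian (gap h) z = expR (liouville (h1 z) (h z)) - expR (liouville (h1 z) (h z + 1)).
Proof.
move=> hyp dh2 an.
have hyp' : \forall w \near z, [/\ cder (fun w => h w + 1) w (h1 w), cder h1 w (h2 w) & h1 w != 0].
  apply: filterS hyp => w [d1 d2 d3].
  by split; [exact: (cder_addc 1 d1)|exact: d2|exact: d3].
have [A [B [aa [ab [ba [bb [l wA wB E]]]]]]] := liouville_second hyp dh2.
have [A' [B' [aa' [ab' [ba' [bb' [l' wA' wB' E']]]]]]] := liouville_second hyp' dh2.
have W : \forall w \near z, wd (fun w => (gap h w)%:C) w (A' w - A w) (B' w - B w).
  have near2 : \forall w \near z, \forall v \near w,
      (liouville (h1 v) (h v + 1))%:C - (liouville (h1 v) (h v))%:C = (gap h v)%:C.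
    apply/nbhs_interior; apply: filterS (filterI hyp an) => v [[_ _ v1] v2].
    rewrite gap_regular // liouville_unipotent // -(rmorphB (real_complex R)).
    by rewrite addrC addKr.
  apply: filterS (filterI near2 (filterI l l')) => w [w1 [w2 w3]].
  exact: (wd_eq w1 (wdB w3 w2)).
rewrite (laplacian_wd W (wdB wA' wA) (wdB wB' wB)).
have -> : (ab' - ab) + (ba' - ba) = (ab' + ba') - (ab + ba) by ring.
by rewrite raddfB mulrBr /= E E'; ring.
Qed.

End Correction.

(** * Half-periods *)

Section HalfPeriods.
Variable R : realType.
Local Notation C := R[i].
Variable tau : C.
Hypothesis tau0 : 0 < complex.Im tau.
Implicit Types (z w e p : C).

(** The numbers [1] and [tau] are linearly independent over the reals. *)
Lemma lattice_coord0 (m n : int) : (m%:~R : C) + n%:~R * tau = 0 -> m = 0 /\ n = 0.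
Proof.
move=> E; have [] := latt_coord tau0 (m%:~R : R) (n%:~R : R).
have -> : (m%:~R : R)%:C + (n%:~R : R)%:C * tau = 0 by rewrite !rmorph_int.
by rewrite normc0 mulr0 !normr_le0 !intr_eq0 => /eqP -> /eqP ->.
Qed.

Lemma omegaE j : (1 <= j <= 3)%N -> exists a b : nat,
  omega tau j = a%:~R + b%:~R * tau /\ (odd a || odd b).
Proof.
case: j => [|[|[|[|j]]]] //= _; [exists 1%N, 0%N|exists 0%N, 1%N|exists 1%N, 1%N]; split=> //;
  by rewrite ?mul0r ?mul1r ?addr0 ?add0r.
Qed.

(** Parity of the coordinates. *)
Lemma half_omega_not_lattice j e : (1 <= j <= 3)%N -> lattice tau e -> ~ lattice tau (omega tau j / 2 + e).
Proof.
move=> hj [m [n ->]] [m' [n' E]]; have [a [b [oE ab]]] := omegaE hj.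
have [] := @lattice_coord0 (a%:Z + 2 * (m - m')) (b%:Z + 2 * (n - n')).
  rewrite !rmorphD !rmorphM /= !rmorphB /=.
  have n2 : (2 : C) != 0 by rewrite pnatr_eq0.
  have {}E : omega tau j = 2 * (m'%:~R + n'%:~R * tau) - 2 * (m%:~R + n%:~R * tau).
    by rewrite -E; field.
  have -> : (2%:~R : C) = 2 by [].
  transitivity ((a%:~R + b%:~R * tau) + 2 * (m%:~R + n%:~R * tau)
    - 2 * (m'%:~R + n'%:~R * tau)); first by ring.
  by rewrite -oE E; ring.
by move: ab; lia.
Qed.

Lemma half_lattice_reflect j z : (1 <= j <= 3)%N -> half_lattice tau (omega tau j / 2 - z) ->
  half_lattice tau z.
Proof.
move=> /omegaE[a [b [oE _]]] [m [n E]]; exists (a%:Z - m), (b%:Z - n).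
have n2 : (2 : C) != 0 by rewrite pnatr_eq0.
have -> : 2 * z = omega tau j - 2 * (omega tau j / 2 - z) by field.
by rewrite E oE !rmorphB /=; ring.
Qed.

End HalfPeriods.

(** * Nontriviality of the monodromy *)

Section Monodromy.
Variable R : realType.
Local Notation C := R[i].
Variable tau : C.
Hypothesis tau0 : 0 < complex.Im tau.
Local Notation HL := (half_lattice tau).
Implicit Types (z w e p : C) (S : set C) (t : R).

Lemma pole_add1 (h : C -> C) p : pole_at h p -> pole_at (fun w => h w + 1) p.
Proof.
move=> [n [g [n0 ag gp hg]]]; exists n, (fun w => g w + (w - p) ^+ n); split.
- exact: n0.
- exact: (analytic_addX n ag).
- by rewrite subrr expr0n -[n == 0]negbK -lt0n n0 addr0.
have ne : \forall w \near p^', w != p by apply/dnbhscP; exists 1; [exact: ltr01|].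
apply: filterS (filterI hg ne) => w [-> wp].
by rewrite mulrDl divff // expf_neq0 // subr_eq0.
Qed.

Lemma meromorphic_add1 (h : C -> C) : meromorphic h -> meromorphic (fun w => h w + 1).
Proof.
move=> mh z; have [az|pz] := mh z; last by right; exact: pole_add1.
by left; have := analytic_addX 0 az; apply: analytic_eq; apply: filterE.
Qed.

Lemma analytic_add1 (h : C -> C) z : meromorphic h -> analytic_at (fun w => h w + 1) z ->
  analytic_at h z.
Proof.
move=> mh a1; have [//|pz] := mh z.
by case: (pole_not_analytic (pole_add1 pz)).
Qed.

(** Taking conjugates turns a relation between conjugates of [h] into one between
holomorphic functions, as [s] is real. *)
Lemma cancel_conj (s : R) (a x y : C) : 0 < s -> a != 0 ->
  s%:C ^+ 2 * (a * x^* ) = s%:C * (a * y^* ) -> s%:C * x = y.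
Proof.
move=> s0 a0 K.
have s0' : s%:C != 0 :> C by rewrite real_complex_eq0 gt_eqF.
apply: (can_inj (@conjCK _)); rewrite [LHS]rmorphM /=.
have -> : s%:C^* = s%:C :> C by apply/eqP; rewrite eq_complex /= oppr0 !eqxx.
apply: (mulfI (mulf_neq0 s0' a0)); move: x^* y^* K => x' y' K.
have -> : s%:C * a * (s%:C * x') = s%:C ^+ 2 * (a * x') by ring.
by rewrite K; ring.
Qed.

Section Family.
Variables (u : C -> R) (h : C -> C) (U : R -> C -> R).
Hypothesis usol : is_solution tau u.
Hypothesis uh : developing_map tau u h.
Hypothesis Uh : forall t z, ~ HL z -> analytic_at h z ->
  U t z = ln (8 * expR (2 * t) * normc (derive1 h z) ^+ 2 /
              (1 + expR (2 * t) * normc (h z) ^+ 2) ^+ 2).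
Hypothesis Ugen : forall v, generated tau u v <-> exists t, eq_off HL v (U t).
Local Notation h1 := (derive1 h).
Local Notation h2 := (derive1 (derive1 h)).
Local Notation h3 := (derive1 (derive1 (derive1 h))).
Local Notation sing := (singular tau h).

Lemma U_solution t : is_solution tau (U t).
Proof. by have [_ /(_ (ex_intro _ t _))[]] := Ugen (U t). Qed.

Lemma U_continuous t z : ~ HL z -> {for z, continuous (U t)}.
Proof. by have [_ [cU _] _ _ _] := U_solution t; exact: cU. Qed.

Lemma u_continuous z : ~ HL z -> {for z, continuous u}.
Proof. by have [_ [cu _] _ _ _] := usol; exact: cu. Qed.

(** At the poles of [h] the equation follows by continuity. *)
Lemma gap_equation : forall z, ~ HL z ->
  expR (u z + gap h z) = expR (u z) - laplacian (gap h) z.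
Proof.
move=> z nz; have mh := dev_meromorphic uh.
have [cg _] := gap_smooth 0 mh.
have cl : {for z, continuous (laplacian (gap h))} by exact: (C2_laplacian_cvg (gap_smooth 2 mh)).
have cu := u_continuous nz.
have cE (v : C -> R) : {for z, continuous v} -> {for z, continuous (fun w => expR (v w))}.
  by move=> cv; exact: (continuous_comp cv (@continuous_expR R (v z))).
have cL : {for z, continuous (fun w => expR (u w + gap h w))}.
  by apply: cE; exact: (@cvgD R R C (nbhs z) _ _ _ _ _ cu (cg z I)).
have cR : {for z, continuous (fun w => expR (u w) - laplacian (gap h) w)}.
  exact: (@cvgB R R C (nbhs z) _ _ _ _ _ (cE _ cu) cl).
apply: (continuous_eq cL cR).
apply: filterS (discrete_singular tau0 mh z) => w nw.
have [dh dh1 dh2 h10 uw] := dev_regular uh nw.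
have hyp : \forall v \near w, [/\ cder h v (h1 v), cder h1 v (h2 v) & h1 v != 0].
  by apply: (near_regular tau0 uh nw) => v nv; have [d1 d2 _ d3 _] := dev_regular uh nv.
have an : \forall v \near w, analytic_at h v.
  by apply: (near_regular tau0 uh nw) => v /not_singular[].
rewrite (gap_laplacian hyp dh2 an) (gap_regular (nbhs_singleton an)) uw.
rewrite -(liouville_unipotent (h w) h10).
by rewrite opprB addrCA subrr addr0.
Qed.
(** If both multipliers were one, [h + 1] would have the periods of [h] and would
develop a solution generated by [u]. Its density would be that of [U t] for some
[t]; differentiating this relation makes [h] satisfy a nontrivial linear
equation with constant coefficients. *)
Lemma trivial_monodromy_absurd :
  (forall e, (e = 1 \/ e = tau) -> forall z, ~ sing z -> ~ sing (z + e) -> h (z + e) = h z) ->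
  False.
Proof.
move=> mono; have mh := dev_meromorphic uh; have dsing := discrete_singular tau0 mh.
have pgap : periodic_off tau set0 (gap h).
  have key e : e = 1 \/ e = tau -> forall z, gap h (z + e) = gap h z.
    move=> he; pose S := sing `|` [set z | sing (z + e)].
    have dS : discrete S by apply: (discreteU dsing); exact: (discrete_shift e dsing).
    apply: (gap_periodic mh dS) => z nS.
    have n1 : ~ sing z by move=> ?; apply: nS; left.
    have n2 : ~ sing (z + e) by move=> ?; apply: nS; right.
    by split; [exact: (not_singular n1).2|exact: (not_singular n2).2|exact: (mono e he z n1 n2)].
  by move=> z _; split; apply: key; [left|right].
pose v z := u z + gap h z; pose g z := h z + 1.
have vsol : is_solution tau v.
  exact: (is_solution_add tau0 (discrete_half_lattice tau0) usol pgap (gap_smooth 2 mh) gap_equation).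
have reg z : ~ HL z -> analytic_at h z -> ~ sing z.
  by move=> a b [c|d]; [exact: (a c)|exact: (d b)].
have vg : developing_map tau v g.
  split; first exact: meromorphic_add1.
  move=> z nz /(analytic_add1 mh) az; have [dh _ _ h10 uz] := dev_regular uh (reg z nz az).
  have -> : derive1 g z = h1 z by exact: (cder_derive1 (cder_addc 1 dh)).
  split; first exact: h10.
  by rewrite /v gap_regular // uz -(liouville_unipotent (h z) h10).
have : generated tau u v.
  split; first exact: vsol.
  exists h, g; split; [exact: uh|exact: vg|].
  exists 1, 1, 0, 1; split; first by ring.
  move=> z _ _; rewrite mul0r add0r; split; first exact: oner_neq0.
  by rewrite mul1r divr1.
move=> /Ugen[t vU].
have [z0 [nz0 _ _]] := discrete_near_ex dsing (@filterT _ (nbhs (0 : C)) _).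
pose s := expR t; have s0 : 0 < s := expR_gt0 t.
have E1 z : ~ sing z -> 1 + s ^+ 2 * normc (h z) ^+ 2 = s * (1 + normc (h z + 1) ^+ 2).
  move=> nz; have [nH az] := not_singular nz.
  have [_ _ _ h10 uz] := dev_regular uh nz.
  have := vU z nH; rewrite (Uh t nH az) /v gap_regular // uz -(liouville_unipotent (h z) h10).
  rewrite expR_double -/s /liouville; have a0 : 0 < normc (h1 z) by rewrite normc_gt0; exact: h10.
  have p1 := normc2_gt0 (h z + 1).
  have p2 : 0 < 1 + s ^+ 2 * normc (h z) ^+ 2.
    by rewrite ltr_wpDr // mulr_ge0 ?sqr_ge0.
  move: (normc (h1 z)) a0 (1 + s ^+ 2 * _) (1 + _ ^+ 2) p1 p2 => a a0 x y x0 y0 E.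
  apply: (mulfI (lt0r_neq0 a0)); rewrite [RHS]mulrCA [RHS]mulrA.
  apply: ln_density_inj; [exact: a0|exact: x0|by rewrite mulr_gt0|exact: y0|].
  by rewrite exprMn [8 * (s ^+ 2 * _)]mulrA; exact: E.
have E2 : \forall z \near z0, 0 * h z ^+ 2 + (s%:C - 1) * h z + - 1 = 0.
  apply: (near_regular tau0 uh nz0) => z nz; have [dh _ _ h10 _] := dev_regular uh nz.
  have w1 := wdD (wd_cst 1 z) (wdM (wd_cst (s%:C ^+ 2) z) (wd_normc2 dh)).
  have w2 := wdM (wd_cst s%:C z) (wdD (wd_cst 1 z) (wd_normc2 (cder_addc 1 dh))).
  have near12 : \forall w \near z, 1 + s%:C ^+ 2 * (h w * (h w)^* ) = s%:C * (1 + (h w + 1) * (h w + 1)^*).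
    apply: (near_regular tau0 uh nz) => w nw.
    have c1 : (1 + s ^+ 2 * normc (h w) ^+ 2)%:C = 1 + s%:C ^+ 2 * (h w * (h w)^* ) :> C.
      rewrite (rmorphD (real_complex R)) (rmorphM (real_complex R)) /= sqr_normcE.
      by rewrite -(rmorphXn (real_complex R)) rmorph1.
    have c2 : (s * (1 + normc (h w + 1) ^+ 2))%:C = s%:C * (1 + (h w + 1) * (h w + 1)^* ) :> C.
      rewrite (rmorphM (real_complex R)) (rmorphD (real_complex R)) /= sqr_normcE.
      by rewrite rmorph1.
    by rewrite -c1 -c2 (E1 w nw).
  have [+ _] := wd_uniq (wd_eq near12 w1) w2.
  rewrite !mul0r !add0r => K.
  have {}K : s%:C * h z = h z + 1 by exact: (cancel_conj s0 h10 K).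
  by rewrite mulrBl K mul1r; move: (h z) => x; ring.
have hh : \forall w \near z0, cder h w (h1 w) /\ h1 w != 0.
  by apply: (near_regular tau0 uh nz0) => w nw; have [d1 _ _ d2 _] := dev_regular uh nw.
have [_ _ /eqP] := quadratic_relation_trivial hh E2.
by rewrite oppr_eq0 oner_eq0.
Qed.
(** * Reflection in a quarter period *)

Section Reflection.
Variables (j l : nat).
Hypothesis hj : (1 <= j <= 3)%N.
Hypothesis hl : (1 <= l <= 3)%N.
Hypothesis jl : j <> l.
Hypothesis typ : of_type tau l u.
Local Notation p := (omega tau j / 2).

Definition sing_pair : set C := sing `|` [set z | sing (p - z)].

Lemma sing_pairP z : ~ sing_pair z -> ~ sing z /\ ~ sing (p - z).
Proof. by move=> nz; split=> ?; apply: nz; [left|right]. Qed.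

Lemma discrete_sing_pair : discrete sing_pair.
Proof.
have d := discrete_singular tau0 (dev_meromorphic uh).
exact: (discreteU d (discrete_reflect p d)).
Qed.

Lemma potential_dev z : ~ sing z ->
  potential u z = - (1 / 2) * schwarzian (h1 z) (h2 z) (h3 z).
Proof.
move=> nz; have [_ _ d3 _ _] := dev_regular uh nz.
have hyp : \forall w \near z,
    [/\ cder h w (h1 w), cder h1 w (h2 w), h1 w != 0 & u w = liouville (h1 w) (h w)].
  by apply: (near_regular tau0 uh nz) => w nw; have [a1 a2 _ a3 a4] := dev_regular uh nw; split;
    [exact: a1|exact: a2|exact: a3|exact: a4].
exact: (potential_schwarzian hyp d3).
Qed.

Lemma schwarzian_opp (x1 x2 x3 : C) : schwarzian (- x1) x2 (- x3) = schwarzian x1 x2 x3.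
Proof. by rewrite /schwarzian invrN mulrNN mulrN sqrrN. Qed.

(** The potential is invariant under the reflection, hence so is the Schwarzian
derivative of [h]. *)
Lemma reflection_moebius : exists a b c d : C, a * d - b * c != 0 /\
  forall z, ~ sing_pair z -> c * h z + d != 0 /\ h (p - z) * (c * h z + d) = a * h z + b.
Proof.
apply: (schwarzian_moebius discrete_sing_pair (h1 := h1) (h2 := h2) (h3 := h3)
  (g1 := fun z => - h1 (p - z)) (g2 := fun z => h2 (p - z)) (g3 := fun z => - h3 (p - z))).
- by move=> z /sing_pairP[nz _]; have [d1 d2 d3 d4 _] := dev_regular uh nz; split;
    [exact: d1|exact: d2|exact: d3|exact: d4].
- move=> z /sing_pairP[_ nz]; have [d1 d2 d3 d4 _] := dev_regular uh nz; split.
  + exact: (cder_reflect d1).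
  + by rewrite -[h2 _]opprK; exact: (cderN (cder_reflect d2)).
  + exact: (cder_reflect d3).
  + by rewrite oppr_eq0.
move=> z /sing_pairP[nz nz']; have [T hT] := typ.
have [[nH _] [nH' _]] := (not_singular nz, not_singular nz').
have E : potential u (p - z) = potential u z.
  exact: (etrans (hT _ nH') (etrans (q_reflect tau0 T z hj hl jl) (esym (hT _ nH)))).
have {}E := etrans (esym (potential_dev nz')) (etrans E (potential_dev nz)).
have half : - (1 / 2) != 0 :> C by rewrite oppr_eq0 mulf_neq0 ?oner_neq0 // invr_neq0 // pnatr_eq0.
exact: (etrans (esym (mulfI half E)) (esym (schwarzian_opp _ _ _))).
Qed.

Lemma nontrivial_multiplier : exists e rho : C, [/\ e = 1 \/ e = tau, normc rho = 1, rho != 1 &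
  forall z, ~ sing z -> ~ sing (z + e) -> h (z + e) = rho * h z].
Proof.
apply: contrapT => no.
apply: trivial_monodromy_absurd => e he z nz nze.
have [rho n1 hm] := multiplier tau0 uh Uh U_solution he.
have [r1|r1] := eqVneq rho 1; first by rewrite hm // r1 mul1r.
by case: no; exists e, rho.
Qed.

Lemma dev_near z : ~ sing z -> \forall w \near z, cder h w (h1 w) /\ h1 w != 0.
Proof.
move=> nz; apply: (near_regular tau0 uh nz) => w nw.
by have [d1 _ _ d2 _] := dev_regular uh nw.
Qed.

(** The reflection reverses the translation by [e], so the transformation relating
[h (p - z)] to [h z] conjugates the rotation by [rho] to its inverse. It therefore
preserves the pair of fixed points [0] and infinity. *)
Lemma reflection_dichotomy (a b c d e rho : C) : a * d - b * c != 0 ->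
  (forall z, ~ sing_pair z -> c * h z + d != 0 /\ h (p - z) * (c * h z + d) = a * h z + b) ->
  normc rho = 1 -> rho != 1 ->
  (forall z, ~ sing z -> ~ sing (z + e) -> h (z + e) = rho * h z) ->
  [/\ b = 0, c = 0 & rho = -1] \/ a = 0 /\ d = 0.
Proof.
move=> det M n1 r1 hm.
pose S3 := sing_pair `|` [set z | sing_pair (z + e)].
have dS : discrete S3 by exact: (discreteU discrete_sing_pair (discrete_shift e discrete_sing_pair)).
have [z0 [nz0 _ _]] := discrete_near_ex dS (@filterT _ (nbhs (0 : C)) _).
have ns0 : ~ sing z0 by move=> s0; apply: nz0; left; left.
have E : \forall z \near z0,
    (a * c * rho * (1 - rho)) * h z ^+ 2 + (a * d * (1 - rho ^+ 2)) * h z + b * d * (1 - rho) = 0.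
  apply: filterS (discrete_near dS nz0) => z nz.
  have nz1 : ~ sing_pair z by move=> ?; apply: nz; left.
  have nz2 : ~ sing_pair (z + e) by move=> ?; apply: nz; right.
  have [s1 s2] := sing_pairP nz1; have [s3 s4] := sing_pairP nz2.
  have pe : p - (z + e) + e = p - z by ring.
  have s5 : ~ sing (p - (z + e) + e) by rewrite pe.
  have m1 := hm _ s1 s3; have := hm _ s4 s5; rewrite pe => m2.
  have [_ M1] := M _ nz1; have [_ M2] := M _ nz2; move: M2; rewrite m1 => M2.
  move: M1; rewrite m2; move: M2 {m1 m2}; move: (h z) (h (p - (z + e))) => x g M2 M1.
  transitivity ((a * x + b) * (c * (rho * x) + d) - rho * (a * (rho * x) + b) * (c * x + d)).
    by ring.
  by rewrite -M1 -M2; ring.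
have [/eqP Ea /eqP Eb /eqP Ed] := quadratic_relation_trivial (dev_near ns0) E.
have r0 : rho != 0 by rewrite -normc_eq0 n1 oner_eq0.
have r1' : 1 - rho != 0 by rewrite subr_eq0 eq_sym.
move: Ea Ed; rewrite !mulf_eq0 (negPf r0) (negPf r1') !orbF => ac bd.
have [c0|c0] := eqVneq c 0.
  left; move: det; rewrite c0 mulr0 subr0 mulf_eq0 negb_or => /andP[a0 d0].
  move: bd; rewrite (negPf d0) orbF => /eqP b0; split=> //.
  move: Eb; rewrite !mulf_eq0 (negPf a0) (negPf d0) /= subr_eq0 eq_sym -subr_eq0 => /eqP E1.
  have : (rho - 1) * (rho + 1) = 0 by rewrite -[RHS]E1; ring.
  by move/eqP; rewrite mulf_eq0 subr_eq0 (negPf r1) /= addr_eq0 => /eqP.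
right; move: ac; rewrite (negPf c0) orbF => /eqP a0; split=> //.
move: det; rewrite a0 mul0r sub0r oppr_eq0 mulf_eq0 negb_or => /andP[b0 _].
by move: bd; rewrite (negPf b0) /= => /eqP.
Qed.

(** In the diagonal case [h (p - z) = lam * h z] with [lam = 1] or [lam = -1], and
in the latter case the multiplier [-1] of [e] compensates for the sign. So [h]
would be even about [p / 2] or [(p + e) / 2], neither of which is a half-period. *)
Lemma reflection_inverts : exists2 lam : C, lam != 0 &
  forall z, ~ sing_pair z -> h (p - z) * h z = lam.
Proof.
have [a [b [c [d [det M]]]]] := reflection_moebius.
have [e [rho [he n1 r1 hm]]] := nontrivial_multiplier.
have [[b0 c0 rm]|[a0 d0]] := reflection_dichotomy det M n1 r1 hm; last first.
  exists (b / c).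
    move: det; rewrite a0 mul0r sub0r oppr_eq0 mulf_eq0 negb_or => /andP[x0 y0].
    by rewrite mulf_neq0 // invr_neq0.
  move=> z /M[]; rewrite a0 d0 mul0r add0r addr0 mulf_eq0 negb_or => /andP[y0 _] <-.
  by field.
exfalso.
have d0 : d != 0 by move: det; rewrite b0 mul0r subr0 mulf_eq0 negb_or => /andP[].
pose lam := a / d.
have lamE z : ~ sing_pair z -> h (p - z) = lam * h z.
  move=> /M[_]; rewrite c0 b0 mul0r add0r addr0 => E.
  by apply: (mulIf d0); rewrite E /lam; field.
have refl z : ~ sing_pair z -> ~ sing_pair (p - z).
  move=> /sing_pairP[s1 s2] [//|]; rewrite /= (_ : p - (p - z) = z); [exact: s1|by ring].
have [z0 [nz0 _ _]] := discrete_near_ex discrete_sing_pair (@filterT _ (nbhs (0 : C)) _).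
have [ns0 _] := sing_pairP nz0.
have E : \forall z \near z0, 0 * h z ^+ 2 + (1 - lam ^+ 2) * h z + 0 = 0.
  apply: filterS (discrete_near discrete_sing_pair nz0) => z nz.
  have := lamE _ (refl z nz); rewrite (_ : p - (p - z) = z); last by ring.
  rewrite (lamE z nz); move: (h z) => x E.
  by transitivity (x - lam * (lam * x)); [ring|rewrite -E subrr].
have [_ /eqP l2 _] := quadratic_relation_trivial (dev_near ns0) E.
have pts q : lattice tau q -> ~ HL ((p + q) / 2).
  move=> lq; rewrite /half_lattice /= (_ : 2 * ((p + q) / 2) = p + q).
    exact: half_omega_not_lattice.
  by field.
have cu z : {for z, continuous u} \/ HL z.
  by have [hz|nz] := EM (HL z); [right|left; exact: (u_continuous nz)].
have half2 (x : C) : x / 2 + x / 2 = x by field.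
have : (1 - lam) * (1 + lam) = 0 by move/eqP: l2 => <-; ring.
move/eqP; rewrite mulf_eq0 subr_eq0 addr_eq0 => /orP[/eqP l1|/eqP l1].
  have l0 : lattice tau 0 by exists 0, 0; rewrite !mul0r addr0.
  apply: (dev_not_even tau0 uh discrete_sing_pair cu (pts 0 l0)) => z nz.
  by rewrite half2 addr0 (lamE z nz) -l1 mul1r.
have le : lattice tau e.
  by case: he => ->; [exists 1, 0; rewrite mul0r addr0|exists 0, 1; rewrite mul1r add0r].
pose S4 := sing_pair `|` [set z | sing (p - z + e)].
have dS4 : discrete S4.
  apply: (discreteU discrete_sing_pair).
  exact: (discrete_reflect p (discrete_shift e (discrete_singular tau0 (dev_meromorphic uh)))).
apply: (dev_not_even tau0 uh dS4 cu (pts e le)) => z nz.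
have nz1 : ~ sing_pair z by move=> ?; apply: nz; left.
have nz2 : ~ sing (p - z + e) by move=> ?; apply: nz; right.
have [_ nz3] := sing_pairP nz1.
rewrite half2 (_ : p + e - z = p - z + e); last by ring.
rewrite (hm _ nz3 nz2) (lamE z nz1) rm; move/eqP: l1; rewrite -addr_eq0 addrC addr_eq0 => /eqP ->.
by rewrite !mulN1r opprK.
Qed.

(** * The symmetric member of the family *)

Section Inversion.
Variable lam : C.
Hypothesis lam0 : lam != 0.
Hypothesis inv : forall z, ~ sing_pair z -> h (p - z) * h z = lam.

Lemma inversion_moduli z : ~ sing_pair z -> [/\ 0 < normc (h1 z), 0 < normc (h1 (p - z)),
  normc (h z) * normc (h (p - z)) = normc lam &
  normc (h1 (p - z)) * normc (h z) = normc (h (p - z)) * normc (h1 z)].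
Proof.
move=> nz; have [s1 s2] := sing_pairP nz.
have [d1 _ _ h10 _] := dev_regular uh s1; have [d2 _ _ h10' _] := dev_regular uh s2.
split; [by rewrite normc_gt0; exact: h10|by rewrite normc_gt0; exact: h10'| |].
  by rewrite -normcM mulrC; congr normc; exact: inv.
have E : \forall w \near z, h (p - w) * h w = lam.
  by apply: filterS (discrete_near discrete_sing_pair nz) => w; exact: inv.
have := cder_uniq (cder_eq E (cderM (cder_reflect d2) d1)) (cder_cst lam z).
rewrite -!normcM mulNr addrC => /eqP; rewrite subr_eq0 => /eqP K.
by congr normc; rewrite K.
Qed.

(** With [s = expR (2 * t)] and [L = normc lam] the left-hand side measures the
asymmetry of [U t]. Of the two factors that can make it vanish, [L - y ^+ 2] does
so only if [h] has constant modulus. *)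
Lemma density_inversion (s x y x' y' L : R) : y * y' = L -> x' * y = y' * x ->
  y ^+ 2 * (x' * (1 + s * y ^+ 2) - x * (1 + s * y' ^+ 2)) = x * (L - y ^+ 2) * (1 - s * L).
Proof.
move=> <- E.
transitivity (y * (x' * y) * (1 + s * y ^+ 2) - x * (y ^+ 2 + s * (y * y') ^+ 2)); first by ring.
by rewrite E; ring.
Qed.

Lemma ln_density_eq (s x x' y a b : R) : y != 0 -> 0 < a -> 0 < b ->
  y ^+ 2 * (x' * a - x * b) = 0 -> ln (8 * (s * x') ^+ 2 / b ^+ 2) = ln (8 * (s * x) ^+ 2 / a ^+ 2).
Proof.
move=> y0 a0 b0 /eqP; rewrite mulf_eq0 expf_eq0 /= (negPf y0) /= subr_eq0 => /eqP E.
have -> : x' = x * b / a by rewrite -E mulfK // gt_eqF.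
by congr ln; field; rewrite !gt_eqF.
Qed.

Lemma density_balance (s x x' y a b L r : R) : 0 < s -> 0 < x -> s * x' * a = s * x * b ->
  y ^+ 2 * (x' * a - x * b) = x * (L - y ^+ 2) * (1 - r * L) -> y ^+ 2 = L \/ r * L = 1.
Proof.
move=> s0 x0; rewrite -[LHS]mulrA -[RHS]mulrA => /(mulfI (lt0r_neq0 s0)) ->.
rewrite subrr mulr0 => /esym/eqP; rewrite !mulf_eq0 (gt_eqF x0) /= !subr_eq0.
by case/orP=> /eqP; [left|right].
Qed.

Lemma inversion_modulus_nonzero z : ~ sing_pair z -> 0 < normc (h z).
Proof.
move=> /inv E; rewrite normc_gt0; apply: contra_eq_neq E => ->.
by rewrite mulr0 eq_sym.
Qed.

Lemma U_density t z : ~ sing z ->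
  U t z = ln (8 * (expR t * normc (h1 z)) ^+ 2 / (1 + expR (2 * t) * normc (h z) ^+ 2) ^+ 2).
Proof.
move=> /not_singular[nH az]; rewrite (Uh t nH az); congr (ln (_ / _)).
by rewrite exprMn -expR_double [RHS]mulrA.
Qed.

Lemma family_den_gt0 t (y : R) : 0 < 1 + expR (2 * t) * y ^+ 2.
Proof. by rewrite ltr_wpDr // mulr_ge0 ?sqr_ge0 // expR_ge0. Qed.

(** The equality at the remaining points follows by continuity, since the
reflection preserves the set of half-periods. *)
Lemma symmetric_member t : expR (2 * t) * normc lam = 1 -> symmetric_about_quarter tau j (U t).
Proof.
move=> tL z nz.
have nz' : ~ HL (p - z) by move=> /(half_lattice_reflect hj).
have c1 : {for z, continuous (fun w => U t (p - w))}.
  apply: (continuous_comp (f := fun w => p - w) (g := U t)); last exact: (U_continuous nz').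
  exact: (@cvgcB R C (nbhs z) _ _ _ _ _ (@cvgc_cst R C (nbhs z) _ p) (@cvg_id C (nbhs z))).
apply: (continuous_eq c1 (U_continuous nz)).
apply: filterS (discrete_sing_pair z) => w nw; have [s1 s2] := sing_pairP nw.
have [m1 m2 m3 m4] := inversion_moduli nw; have y0 := inversion_modulus_nonzero nw.
rewrite (U_density t s1) (U_density t s2).
have D := density_inversion (expR (2 * t)) m3 m4.
apply: (ln_density_eq _ (lt0r_neq0 y0) (family_den_gt0 t _) (family_den_gt0 t _)).
by apply: (etrans D); rewrite tL subrr mulr0.
Qed.

(** Otherwise [h] would have constant modulus. *)
Lemma symmetric_unique t : symmetric_about_quarter tau j (U t) -> expR (2 * t) * normc lam = 1.
Proof.
move=> sym; apply: contrapT => tL.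
have [z0 [nz0 _ _]] := discrete_near_ex discrete_sing_pair (@filterT _ (nbhs (0 : C)) _).
have [ns0 _] := sing_pairP nz0; have [d1 _ _ h10 _] := dev_regular uh ns0.
have E : \forall w \near z0, normc (h w) ^+ 2 = normc lam.
  apply: filterS (discrete_near discrete_sing_pair nz0) => w nw; have [s1 s2] := sing_pairP nw.
  have [m1 m2 m3 m4] := inversion_moduli nw; have y0 := inversion_modulus_nonzero nw.
  have D := density_inversion (expR (2 * t)) m3 m4; have s0 := expR_gt0 t.
  have := sym w (not_singular s1).1; rewrite (U_density t s1) (U_density t s2).
  move=> K; have K' := ln_density_inj (mulr_gt0 s0 m2) (family_den_gt0 t _)
    (mulr_gt0 s0 m1) (family_den_gt0 t _) K.
  have [//|//] := density_balance s0 m1 K' D.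
have L0 : normc lam != 0 by rewrite normc_eq0.
by move/eqP: h10; apply; exact: (const_normc_cder0 E L0 d1).
Qed.
End Inversion.

Lemma unique_symmetric_member : exists t, symmetric_about_quarter tau j (U t) /\
  forall s, symmetric_about_quarter tau j (U s) -> s = t.
Proof.
have [lam lam0 inv] := reflection_inverts.
have L0 : 0 < normc lam by rewrite normc_gt0.
have tL : expR (2 * (- ln (normc lam) / 2)) * normc lam = 1.
  have -> : 2 * (- ln (normc lam) / 2) = - ln (normc lam) by field.
  by rewrite expRN lnK ?posrE // mulVf // gt_eqF.
exists (- ln (normc lam) / 2); split; first exact: (symmetric_member lam0 inv tL).
move=> s /(symmetric_unique lam0 inv) sL.
have n2 : (2 : R) != 0 by rewrite pnatr_eq0.
apply: (mulfI n2); apply: expR_inj; apply: (mulIf (lt0r_neq0 L0)).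
by rewrite sL tL.
Qed.

End Reflection.
End Family.
End Monodromy.

Theorem theorem5p3 (R : realType) (tau : R[i]) (l : nat)
    (F : set (R[i] -> R)) :
  extra_critical tau ->
  (1 <= l <= 3)%N ->
  nonspecial_family tau l F ->
  forall j : nat, (1 <= j <= 3)%N -> j <> l ->
  exists u : R[i] -> R,
    F u /\ symmetric_about_quarter tau j u /\
    (forall v : R[i] -> R, F v -> symmetric_about_quarter tau j v ->
       eq_off (half_lattice tau) v u).
Proof.
move=> [tau0 _] hl [u [[usol [h [U [uh Uh Ugen _]]]] typ ->]] j hj jl.
have [t [st ut]] := unique_symmetric_member tau0 usol uh Uh Ugen hj hl jl typ.
exists (U t); split; first by apply/Ugen; exists t.
split; first exact: st.
move=> v /Ugen[s vs] sv; rewrite -(ut s) // => z nz.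
have nz' : ~ half_lattice tau (omega tau j / 2 - z) by move=> /(half_lattice_reflect hj).
by rewrite -(vs z nz) -(vs _ nz'); exact: sv.
Qed.
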